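(* Let $(\xi_t)_{t\in\mathbb{Z}}$ be i.i.d. random column vectors in $\mathbb{R}^q$ and let $\{C_i(t): i=0,\ldots,m;\, t\in\mathbb{Z}\}$ be an array of random $d\times q$ matrices, independent of $(\xi_t)$ and strictly stationary as a $d\times q\times(m+1)$-dimensional process indexed by $t\in\mathbb{Z}$. Define $X_t = \sum_{i=0}^m C_i(t)\xi_{t-i}$ for $t\in\mathbb{Z}$. Fix norms $\|\cdot\|$ on $\mathbb{R}^q$ and $\mathbb{R}^d$ and the corresponding operator norm on $\mathbb{R}^{d\times q}$. Assume: (M1) the law of $\xi_0$ is regularly varying of index $\alpha\in(0,\infty)$ with spectral measure $\mathcal{L}(\Theta)$ on the unit sphere $\mathbb{S}^{q-1}$ of $\mathbb{R}^q$; (M2) there exists $\beta>\alpha$ such that $\mathrm{E}\|C_i(0)\|^\beta<\infty$ for $i=0,\ldots,m$; (M3) for $\Theta$ as in (M1) and independent of $\{C_i(t)\}$, there exists $i\in\{0,\ldots,m\}$ with $\Pr(\|C_i(0)\Theta\|>0)>0$. Then $(X_t)$ is jointly regularly varying of index $\alpha$; as $x\to\infty$, \[ \frac{\Pr(\|X_0\|>x)}{\Pr(\|\xi_0\|>x)} \to \sum_{i=0}^m\mathrm{E}\|C_i(0)\Theta\|^\alpha =: c > 0, \] and for all $s,t\in\mathbb{Z}$ with $s\le t$ and all bounded continuous $f:(\mathbb{R}^d)^{t-s+1}\to\mathbb{R}$, as $x \to \infty$, \[ \mathrm{E}\Bigl[f\Bigl(\frac{X_s}{\|X_0\|},\ldots,\frac{X_t}{\|X_0\|}\Bigr)\,\Big|\,\|X_0\|>x\Bigr]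 \to c^{-1}\sum_{i=0}^m\mathrm{E}\Bigl[f\Bigl(\frac{C_{i+s}(s)\Theta}{\|C_i(0)\Theta\|},\ldots,\frac{C_{i+t}(t)\Theta}{\|C_i(0)\Theta\|}\Bigr)\|C_i(0)\Theta\|^\alpha\Bigr], \] where $C_j(\cdot)=0$ if $j<0$ or $j>m$, and $\Theta$ is independent of $\{C_i(t)\}$.
   Context: A random vector $X$ in $\mathbb{R}^k$ is regularly varying of index $\alpha$ with spectral measure $\mathcal{L}(\Theta)$ (for a given norm) if $\Theta$ is a random vector on the unit sphere such that for every $u>0$, $\Pr(\|X\|>ux, X/\|X\|\in\cdot)/\Pr(\|X\|>x) \to u^{-\alpha}\Pr(\Theta\in\cdot)$ weakly as $x\to\infty$. A stationary process $(X_t)$ in $\mathbb{R}^d$ is jointly regularly varying of index $\alpha$ if every $(X_1,\ldots,X_k)$, $k\ge1$, is regularly varying of index $\alpha$. Terms in the limit are interpreted as $0$ when $C_i(0)\Theta=0$. *)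

(* Defs.v *)
From mathcomp Require Import all_boot all_order all_algebra.
From mathcomp Require Import all_classical all_reals all_analysis.
Import Order.TTheory GRing.Theory Num.Theory.
Import numFieldNormedType.Exports.

Set Implicit Arguments.
Unset Strict Implicit.
Unset Printing Implicit Defensive.

Local Open Scope classical_set_scope.
Local Open Scope ring_scope.

Definition is_norm (R : realType) (a b : nat) (N : 'M[R]_(a, b) -> R) : Prop :=
  [/\ forall v, N v = 0 -> v = 0,
      forall (c : R) v, N (c *: v) = `|c| * N v
    & forall u v, N (u + v) <= N u + N v].

Definition opnorm (R : realType) (d q : nat) (Nq : 'cV[R]_q -> R)
  (Nd : 'cV[R]_d -> R) (A : 'M[R]_(d, q)) : R :=
  sup [set Nd (A *m v) | v in [set v | Nq v <= 1]].

Definition mx_coords (R : realType) (a b : nat) (A : 'M[R]_(a, b)) :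
  'I_a * 'I_b -> R := fun k => A k.1 k.2.

(* the product (= Borel, for finite K) sigma-algebra on K -> R *)
Definition cyl (R : realType) (K : Type) : set (set (K -> R)) :=
  smallest (sigma_algebra setT)
    [set A | exists (k : K) (B : set R), measurable B /\ A = (fun x => x k) @^-1` B].

Definition rv_family (R : realType) (dT : measure_display) (T : measurableType dT)
  (K : Type) (X : T -> K -> R) : Prop :=
  forall k, measurable_fun setT (fun w => X w k).

Definition sigma_of (R : realType) (dT : measure_display) (T : measurableType dT)
  (K : Type) (X : T -> K -> R) : set (set T) :=
  smallest (sigma_algebra setT)
    [set A | exists (k : K) (B : set R), measurable B /\ A = (fun w => X w k) @^-1` B].

Definition same_law (R : realType) (dT : measure_display) (T : measurableType dT)
  (P : probability T R) (K : Type) (X Y : T -> K -> R) : Prop :=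
  forall B, cyl B -> P (X @^-1` B) = P (Y @^-1` B).

Definition indep_family (R : realType) (dT : measure_display) (T : measurableType dT)
  (P : probability T R) (I : eqType) (F : I -> set (set T)) : Prop :=
  forall (J : seq I) (A : I -> set T), uniq J ->
    (forall i, i \in J -> F i (A i)) ->
    fine (P (\big[setI/setT]_(i <- J) A i)) = \prod_(i <- J) fine (P (A i)).

Definition indep2 (R : realType) (dT : measure_display) (T : measurableType dT)
  (P : probability T R) (F G : set (set T)) : Prop :=
  forall A B, F A -> G B -> P (A `&` B) = (P A * P B)%E.

(* X : T -> 'M[R]_(a,b) (a random vector of R^(a*b)) is regularly varying of
   index alpha w.r.t. the norm N, with spectral measure the law of
   Th : T' -> 'M[R]_(a,b) (a random vector on the unit sphere of N) *)
Definition regvar_with (R : realType) (dT : measure_display) (T : measurableType dT)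
  (P : probability T R) (a b : nat) (N : 'M[R]_(a, b) -> R) (X : T -> 'M[R]_(a, b))
  (alpha : R) (dT' : measure_display) (T' : measurableType dT')
  (P' : probability T' R) (Th : T' -> 'M[R]_(a, b)) : Prop :=
  [/\ rv_family (fun w => mx_coords (Th w)),
      forall w, N (Th w) = 1 &
      forall (u : R), 0 < u ->
      forall g : 'M[R]_(a, b) -> R,
        {within [set v | N v = 1], continuous g} ->
        (exists M : R, forall v, N v = 1 -> `|g v| <= M) ->
        (\int[P]_(w in [set w | u * x < N (X w)]) g ((N (X w))^-1 *: X w))
          / fine (P [set w | x < N (X w)])
        @[x --> +oo] --> u `^ (- alpha) * (\int[P']_(w in setT) g (Th w))].

Definition regvar (R : realType) (dT : measure_display) (T : measurableType dT)
  (P : probability T R) (a b : nat) (N : 'M[R]_(a, b) -> R) (X : T -> 'M[R]_(a, b))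
  (alpha : R) : Prop :=
  exists (dT' : measure_display) (T' : measurableType dT') (P' : probability T' R)
    (Th : T' -> 'M[R]_(a, b)), regvar_with P N X alpha P' Th.

(* the norm on (R^d)^k (vectors stored as the k columns of a d x k matrix):
   maximum of the norms of the columns *)
Definition colmax_norm (R : realType) (d k : nat) (Nd : 'cV[R]_d -> R)
  (A : 'M[R]_(d, k)) : R := \big[Num.max/0]_(j < k) Nd (col j A).

(* a stationary process (X_t) in R^d is jointly regularly varying of index alpha:
   every (X_1, ..., X_k), k >= 1, is regularly varying of index alpha *)
Definition jointly_regvar (R : realType) (dT : measure_display) (T : measurableType dT)
  (P : probability T R) (d : nat) (Nd : 'cV[R]_d -> R) (X : int -> T -> 'cV[R]_d)
  (alpha : R) : Prop :=
  forall k : nat,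
    regvar P (colmax_norm (k := k.+1) Nd)
      (fun w => \matrix_(i < d, j < k.+1) X (1 + (j : nat)%:Z) w i ord0) alpha.

Definition MA (R : realType) (T : Type) (d q m : nat)
  (C : 'I_m.+1 -> int -> T -> 'M[R]_(d, q)) (xi : int -> T -> 'cV[R]_q)
  (t : int) (w : T) : 'cV[R]_d :=
  \sum_(i < m.+1) C i t w *m xi (t - (i : nat)%:Z) w.

Definition Cext (R : realType) (T : Type) (d q m : nat)
  (C : 'I_m.+1 -> int -> T -> 'M[R]_(d, q)) (j : int) (t : int) (w : T)
  : 'M[R]_(d, q) :=
  if (0 <= j) && (j <= m%:Z) then C (inord `|j|%N) t w else 0.

(* Main.v *)
From HB Require Import structures.
Require Import Defs.
From mathcomp Require Import all_boot all_order all_algebra.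
From mathcomp Require Import all_classical all_reals all_analysis.
From mathcomp Require Import measurable_realfun.
From mathcomp Require Import ring lra zify.
Import Order.TTheory GRing.Theory Num.Theory.
Import numFieldNormedType.Exports.
Set Implicit Arguments.
Unset Strict Implicit.
Unset Printing Implicit Defensive.
Local Open Scope classical_set_scope.
Local Open Scope ring_scope.

(* A sum of independent heavy-tailed terms is large only because a single term
   is. Let Y collect X_t for t in a finite window; Y is the sum over t of A_t xi_t
   with random matrices A_t independent of the xi_t. For a seminorm rho and a
   bounded function H, homogeneous of degree 0 and continuous where rho > 0,
     E[H(Y); rho(Y) > x] / P(|xi_0| > x)
       -> sum_t E[H(A_t Theta) rho(A_t Theta)^alpha].
   For deterministic A_t this follows from regular variation of xi_0 and from
   the fact that two of the xi_t exceed a multiple of x with probability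
   O(P(|xi_0| > x)^2); random A_t are treated conditionally, with Potter's bound
   and the moment condition (M2) providing the domination. With rho the norm of
   the column X_0, H = 1 gives the tail ratio and H(y) = f(y / rho(y)) the
   conditional limit; with rho the maximum of the column norms and
   H(y) = g(y / rho(y)) one gets the joint regular variation, with spectral
   measure the law of A_t Theta / rho(A_t Theta) reweighted by
   rho(A_t Theta)^alpha and summed over t. *)

(** The norm of one column vanishes on nonzero windows, so rho is only a seminorm and nothing is
    known of H on its kernel. There the indicator of rho > x, or the weight rho^alpha, kills the
    product; this is also what makes these products measurable. Homogeneity of degree 0 allows
    division by x, so that values of H are compared on a fixed compact set. For one term, (M1) tests
    continuous functions of the direction v = xi / |xi| at thresholds u x with u constant, whereas
    tau(xi) > x means |xi| > x / tau(v), a threshold that depends on v. The range of tau(v) is cut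
    into slices lo < t < hi by a continuous partition of unity; replacing tau(v) by lo or by hi in
    each slice traps the expectation between two finite sums of quantities covered by (M1). For the
    sum, the indicator of rho > x is itself discontinuous. A perturbation of relative size e matters
    only in the shell between (1 - e) x and (1 + e) x, whose asymptotic weight is proportional to (1
    - e)^-alpha - (1 + e)^-alpha and so can be made small before x grows. *)

Lemma nbhs_dist_lt (R : realType) (U : normedModType R) (x : U) (e : R) :
  0 < e -> nbhs x [set z | `|x - z| < e].
Proof.
by move=> e0; apply/nbhs_ballP; exists e => // z; rewrite -ball_normE.
Qed.

(** Puts a product of two neighbourhoods into the form asked for by [compact_near_coveringP], on
    which both compactness arguments below rest. *)
Lemma near2_split (T U : Type) (F : set_system T) (G : set_system U)
  (A : set T) (B : set U) (Q : T -> U -> Prop) :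
  F A -> G B -> (forall x y, A x -> B y -> Q x y) ->
  \forall x \near F & y \near G, Q x y.
Proof. by move=> FA GB h; exists (A, B) => // -[x y] /= [] /h; apply. Qed.

Lemma continuous_atP (R : realType) (U V : normedModType R) (f : U -> V) (v : U) :
  {for v, continuous f} <->
  forall e : R, 0 < e -> exists2 d : R, 0 < d &
    forall u, `|v - u| < d -> `|f v - f u| < e.
Proof.
split=> [/cvgrPdist_lt h e e0|h].
  have /nbhs_ballP[d d0 hd] := h e e0; exists d => // u vu; apply: hd.
  by rewrite -ball_normE.
apply/cvgrPdist_lt => e /h[d d0 hd]; near=> u; apply: hd; near: u.
exact: cvgr_dist_lt.
Unshelve. all: by end_near. Qed.

Lemma ler_coord_norm (R : realType) a b (v : 'M[R]_(a, b)) i j : `|v i j| <= `|v|.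
Proof.
rewrite [leRHS]/Num.Def.normr /= mx_normrE.
by apply: (le_bigmax _ (fun ij : 'I_a * 'I_b => `|v ij.1 ij.2|) (i, j)).
Qed.

Lemma mxnorm_le (R : realType) a b (v : 'M[R]_(a, b)) (c : R) :
  0 <= c -> (forall i j, `|v i j| <= c) -> `|v| <= c.
Proof.
move=> c0 h; rewrite [leLHS]/Num.Def.normr /= mx_normrE.
by apply/bigmax_leP; split => // -[i j] _ /=.
Qed.

(** * Seminorms on matrices *)

Section seminorms.
Variables (R : realType) (a b : nat).
Implicit Types (rho : 'M[R]_(a, b) -> R) (u v y : 'M[R]_(a, b)).

Definition seminorm rho :=
  (forall (c : R) v, rho (c *: v) = `|c| * rho v) /\
  (forall u v, rho (u + v) <= rho u + rho v).

Lemma is_norm_seminorm rho : is_norm rho -> seminorm rho.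
Proof. by case. Qed.

Lemma seminorm0 rho : seminorm rho -> rho 0 = 0.
Proof. by case=> h _; rewrite -(scale0r 0) h normr0 mul0r. Qed.

Lemma seminormN rho v : seminorm rho -> rho (- v) = rho v.
Proof. by case=> h _; rewrite -scaleN1r h normrN1 mul1r. Qed.

Lemma seminorm_ge0 rho v : seminorm rho -> 0 <= rho v.
Proof.
move=> s; have := seminormN v s; have := seminorm0 s; case: s => _ /(_ v (- v)).
by rewrite subrr => h h0 hN; rewrite h0 hN in h; lra.
Qed.

Lemma seminormZ_pos rho (c : R) v : seminorm rho -> 0 <= c ->
  rho (c *: v) = c * rho v.
Proof. by case=> h _ c0; rewrite h ger0_norm. Qed.

Lemma seminorm_sum rho (I : Type) (s : seq I) (F : I -> 'M[R]_(a, b)) :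
  seminorm rho -> rho (\sum_(i <- s) F i) <= \sum_(i <- s) rho (F i).
Proof.
move=> sr; elim/big_ind2 : _ => [|x1 x2 y1 y2 h1 h2|//]; first by rewrite seminorm0.
by case: sr => _ t; rewrite (le_trans (t _ _))// lerD.
Qed.

Lemma seminorm_le_norm rho : seminorm rho ->
  exists2 k : R, 0 < k & forall v, rho v <= k * `|v|.
Proof.
(* The summand 1 keeps the constant positive even when [rho] vanishes identically. *)
move=> s; exists (1 + \sum_(i < a) \sum_(j < b) rho (delta_mx i j)).
  by rewrite ltr_wpDr// sumr_ge0// => i _; rewrite sumr_ge0// => j _; exact: seminorm_ge0.
move=> v; rewrite {1}(matrix_sum_delta v) mulrDl mul1r.
rewrite ler_wpDl// (le_trans (seminorm_sum _ _ s))// mulr_suml ler_sum// => i _.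
rewrite (le_trans (seminorm_sum _ _ s))// mulr_suml ler_sum// => j _.
case: (s) => -> _; rewrite mulrC ler_wpM2l ?seminorm_ge0//; exact: ler_coord_norm.
Qed.

Lemma seminorm_lip rho u v : seminorm rho -> `|rho u - rho v| <= rho (u - v).
Proof.
move=> s; rewrite ler_norml; case: (s) => _ t.
have := t (u - v) v; rewrite subrK; have := t (v - u) u; rewrite subrK.
rewrite -[rho (v - u)]seminormN // opprB; lra.
Qed.

Lemma seminorm_continuous rho : seminorm rho -> continuous rho.
Proof.
move=> s v; have [k k0 h] := seminorm_le_norm s.
apply/continuous_atP => e e0; exists (k^-1 * e); first by rewrite mulr_gt0 ?invr_gt0.
move=> u; rewrite ltr_pdivlMl// => vu.
by rewrite (le_lt_trans (seminorm_lip _ _ s))// (le_lt_trans (h _)).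
Qed.

(** The box is a closed subset of the image under the continuous map [vec_mx] of a product of
    segments. *)
Lemma mx_box_compact (K : R) : compact [set v : 'M[R]_(a, b) | `|v| <= K].
Proof.
pose B := [set v : 'rV[R]_(a * b) | forall i, `[- K, K]%classic (v ord0 i)].
have cB : compact B by apply: (@rV_compact _ _ (fun=> `[- K, K]%classic)) => i; exact: segment_compact.
have cv : continuous (@vec_mx R a b).
  move=> v; apply/continuous_atP => e e0; exists e => // u; apply: le_lt_trans.
  rewrite -raddfB /=; apply: mxnorm_le => // i j; rewrite mxE; exact: ler_coord_norm.
have cI := continuous_compact (continuous_subspaceT cv) cB.
have cl : closed [set v : 'M[R]_(a, b) | `|v| <= K].
  have nc : continuous (fun v : 'M[R]_(a, b) => `|v|) by exact: norm_continuous.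
  apply: (closed_comp (D := [set t : R | t <= K]) _ (@closed_le R K)).
  by move=> v _; exact: nc.
apply: (subclosed_compact cl cI) => v /= vK; exists (mxvec v); last by rewrite mxvecK.
move=> i /=; rewrite in_itv /= -ler_norml.
case/mxvec_indexP: i => i j; rewrite mxvecE.
exact: le_trans (ler_coord_norm _ _ _) vK.
Qed.

(** On the shell 1/2 <= |v| <= 1 the norm [rho] has a positive lower bound [eta], and every nonzero
    vector scales into the shell. The condition 1/2 <= |v| sits inside the covered predicate, so
    compactness of the whole ball suffices: near 0 the predicate is vacuous, and near any other
    point [rho] stays above half its value there. *)
Lemma norm_equiv rho : is_norm rho ->
  exists2 k : R, 0 < k & forall v, `|v| <= k * rho v.
Proof.
move=> nr; have s := is_norm_seminorm nr.
have /compact_near_coveringP/(_ R (0^'+)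
  (fun eta v => 2^-1 <= `|v| -> eta < rho v) _) := @mx_box_compact 1.
have H : forall x : 'M[R]_(a, b), [set v : 'M[R]_(a, b) | `|v| <= 1] x ->
   \forall x' \near x & eta \near 0^'+, 2^-1 <= `|x'| -> eta < rho x'.
  move=> x _; have [->|x0] := eqVneq x 0.
    refine (near2_split (F := nbhs (0 : 'M[R]_(a, b))) (G := 0^'+) (A := [set z | `|z| < 2^-1]) (B := setT) _ _ _).
    - have h2 : 0 < 2^-1 :> R by rewrite invr_gt0.
      have := @nbhs_dist_lt _ _ (0 : 'M[R]_(a, b)) _ h2.
      by apply: filterS => z /=; rewrite sub0r normrN.
    - exact: filterT.
    - by move=> z eta /= zl _; rewrite leNgt zl.
  have rx : 0 < rho x.
    rewrite lt0r seminorm_ge0// andbT; apply: contra_neq x0; by case: nr => + _ _; apply.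
  refine (near2_split (F := nbhs x) (G := 0^'+) (A := [set z | rho x / 2 < rho z]) (B := [set eta | eta < rho x / 2]) _ _ _).
  - have /(@continuous_atP _ _ R) := @seminorm_continuous _ s x.
    move=> /(_ (rho x / 2)); rewrite divr_gt0// => /(_ isT)[d d0 hd].
    have := nbhs_dist_lt x d0; apply: filterS => z /= /hd.
    by rewrite ltr_norml => /andP[_ h] /=; lra.
  - by apply: nbhs_right_lt; rewrite divr_gt0.
  - by move=> z eta /= h1 h2 _; lra.
move=> /(_ H) /= hn; near (0 : R)^'+ => eta.
have eta0 : 0 < eta by [].
have {}H : forall v, `|v| <= 1 -> 2^-1 <= `|v| -> eta < rho v by near: eta.
exists eta^-1; first by rewrite invr_gt0.
move=> v; have [->|v0] := eqVneq v 0.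
  by rewrite normr0 seminorm0// mulr0.
rewrite ler_pdivlMl//; have nv : 0 < `|v| by rewrite normr_gt0.
have : eta < rho (`|v|^-1 *: v).
  by apply: H; rewrite normrZ normfV normr_id mulVf ?gt_eqF// invf_le1// ler1n.
rewrite seminormZ_pos ?invr_ge0// ltr_pdivlMl// => h; rewrite mulrC; exact: ltW.
Unshelve. all: by end_near. Qed.

(** Heine-Cantor on the compact set |y| <= K, rho y >= c, in the form where only [y] is confined to
    that set and [z] is any nearby point. A point of the ball where [rho] vanishes has a
    neighbourhood with rho < c, where there is nothing to prove. *)
Lemma unif_cont_off_kernel rho (H : 'M[R]_(a, b) -> R) : seminorm rho ->
  (forall y, 0 < rho y -> {for y, continuous H}) ->
  forall K c delta : R, 0 < c -> 0 < delta ->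
  exists2 eta : R, 0 < eta & forall y z, `|y| <= K -> c <= rho y ->
    `|y - z| <= eta -> `|H y - H z| <= delta.
Proof.
move=> s Hc K c delta c0 d0.
have /compact_near_coveringP/(_ R (0^'+)
  (fun eta y => c <= rho y -> forall z, `|y - z| <= eta -> `|H y - H z| <= delta) _) := @mx_box_compact K.
have HH : forall x : 'M[R]_(a, b), [set v : 'M[R]_(a, b) | `|v| <= K] x ->
   \forall y \near x & eta \near 0^'+, c <= rho y ->
     forall z, `|y - z| <= eta -> `|H y - H z| <= delta.
  move=> x _; have [rx|rx] := ltP 0 (rho x); last first.
    refine (near2_split (F := nbhs x) (G := 0^'+) (A := [set z | rho z < c]) (B := setT) _ _ _).
    - have /(@continuous_atP _ _ R) := @seminorm_continuous _ s x.
      move=> /(_ c c0)[r r0 hr].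
      have := nbhs_dist_lt x r0; apply: filterS => z /= /hr.
      by rewrite ltr_norml => /andP[h _] /=; lra.
    - exact: filterT.
    - by move=> z eta /= zl _; rewrite leNgt zl.
  have /continuous_atP/(_ (delta / 2)) := Hc x rx.
  rewrite divr_gt0// => /(_ isT) [e e0 he].
  refine (near2_split (F := nbhs x) (G := 0^'+) (A := [set y | `|x - y| < e / 2]) (B := [set eta | eta < e / 2]) _ _ _).
  - by apply: nbhs_dist_lt; rewrite divr_gt0.
  - by apply: nbhs_right_lt; rewrite divr_gt0.
  move=> y eta /= xy eta2 _ z yz.
  have h1 : `|H x - H y| <= delta / 2.
    by apply/ltW/he; rewrite (lt_trans xy)//; lra.
  have h2 : `|H x - H z| <= delta / 2.
    apply/ltW/he.
    have := ler_distD y x z; lra.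
  have := ler_distD (H x) (H y) (H z); rewrite [`|H y - H x|]distrC; lra.
move=> /(_ HH) /= hn; near (0 : R)^'+ => eta.
exists eta => // y z yK cy; move: y yK cy z; by near: eta.
Unshelve. all: by end_near. Qed.
End seminorms.

(** * Random matrices and expectations *)

Section measurability.
Context (R : realType) (dT : measure_display) (T : measurableType dT).

Lemma measurable_ltr_indic (c : R) (f : T -> R) : measurable_fun setT f ->
  measurable_fun setT (fun w => (c < f w)%R%:R : R).
Proof.
move=> mf; have mA : measurable [set w | c < f w].
  rewrite -[X in measurable X]setTI; have -> : [set w | c < f w] = f @^-1` `]c, +oo[%classic.
    by apply/seteqP; split => w /=; rewrite in_itv /= andbT.
  exact: mf.
rewrite (_ : (fun w => _) = \1_[set w | c < f w]) //.
apply/funext => w; rewrite indicE; congr (_%:R); apply: congr1.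
by apply/idP/idP => [h|/set_mem//]; exact/mem_set.
Qed.

Section matrices.
Variables (a b : nat).
Implicit Types (X : T -> 'M[R]_(a, b)) (H : 'M[R]_(a, b) -> R).

Lemma rv_coord X : rv_family (fun w => mx_coords (X w)) <->
  forall i j, measurable_fun setT (fun w => X w i j).
Proof. by split=> [h i j|h [i j]]; [exact: (h (i, j))|exact: h]. Qed.

(* Only the coordinates of a random matrix X are known to be measurable; H o X is
   reached as the limit of H at discretisations of X with countably many values. *)
Definition mxfloor (n : nat) (y : 'M[R]_(a, b)) : 'M[int]_(a, b) :=
  \matrix_(i, j) Num.floor (n.+1%:R * y i j).

Definition mxdisc (n : nat) (y : 'M[R]_(a, b)) : 'M[R]_(a, b) :=
  \matrix_(i, j) ((mxfloor n y i j)%:~R / n.+1%:R).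

Lemma mxdisc_dist n y : `|y - mxdisc n y| <= n.+1%:R^-1.
Proof.
apply: mxnorm_le => [|i j]; first by rewrite invr_ge0.
rewrite !mxE; have /andP[h1 h2] := floor_itv (n.+1%:R * y i j).
have n0 : (0 : R) < n.+1%:R by rewrite ltr0n.
have n1 : n.+1%:R != 0 :> R by rewrite gt_eqF.
rewrite -[X in `|X - _|](mulKf n1) mulrC -mulrBl normrM normfV.
rewrite [`|n.+1%:R|]ger0_norm ?ler0n// ler_piMl ?invr_ge0//.
by rewrite intrD in h2; rewrite ler_norml; lra.
Qed.

Lemma mxdisc_cvg (H : 'M[R]_(a, b) -> R) y : {for y, continuous H} ->
  H (mxdisc n y) @[n --> \oo] --> H y.
Proof.
move=> /continuous_atP Hc; apply/cvgrPdist_lt => e /Hc[r r0 hr].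
near=> n; apply: hr; apply: le_lt_trans (mxdisc_dist _ _) _.
near: n; exact: near_infty_natSinv_lt (PosNum r0).
Unshelve. all: by end_near. Qed.

Lemma measurable_mxdisc n X H : rv_family (fun w => mx_coords (X w)) ->
  measurable_fun setT (fun w => H (mxdisc n (X w))).
Proof.
move=> /rv_coord mX _ B mB; rewrite setTI.
pose H' (Z : 'M[int]_(a, b)) := H (\matrix_(i, j) ((Z i j)%:~R / n.+1%:R)).
have -> : (fun w => H (mxdisc n (X w))) @^-1` B =
    \bigcup_(Z : 'M[int]_(a, b)) [set w | B (H' Z) /\ mxfloor n (X w) = Z].
  apply/seteqP; split => w /=; first by exists (mxfloor n (X w)).
  by move=> [Z _ /= [BZ ZE]]; move: BZ; rewrite -ZE.
apply: countable_bigcupT_measurable => [|Z]; first exact: countableP.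
have [BZ|nBZ] := pselect (B (H' Z)); last first.
  by rewrite (_ : mkset _ = set0)//; apply/seteqP; split => // w [].
have -> : [set w | B (H' Z) /\ mxfloor n (X w) = Z] =
    \bigcap_(ij in [set: 'I_a * 'I_b])
       (fun w => n.+1%:R * X w ij.1 ij.2) @^-1`
         `[(Z ij.1 ij.2)%:~R, (Z ij.1 ij.2 + 1)%:~R[%classic.
  apply/seteqP; split => w /=.
    move=> [_ <-] [i j] _ /=; rewrite in_itv /= mxE; exact: floor_itv.
  move=> h; split => //; apply/matrixP => i j; rewrite mxE; apply/esym.
  by have /= := h (i, j) I; rewrite in_itv /= => /floor_def.
apply: fin_bigcap_measurable => // -[i j] _.
by rewrite -[X in measurable X]setTI; apply: measurable_funM => //; exact: mX.
Qed.

Lemma measurable_continuous_comp X H : rv_family (fun w => mx_coords (X w)) ->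
  continuous H -> measurable_fun setT (H \o X).
Proof.
move=> rX Hc; apply: (measurable_fun_cvg (h := fun n w => H (mxdisc n (X w)))).
  by move=> n; exact: measurable_mxdisc.
by move=> w _; apply: mxdisc_cvg; exact: Hc.
Qed.

(** Only [H] is evaluated at the discretised matrix; the indicator keeps the original one. Where it
    is 1, [H] is continuous at [X w] because c >= 0; where it is 0, the approximations are
    constantly 0. *)
Lemma measurable_off_kernel X H rho (c : R) : rv_family (fun w => mx_coords (X w)) ->
  seminorm rho -> (forall y, 0 < rho y -> {for y, continuous H}) -> 0 <= c ->
  measurable_fun setT (fun w => H (X w) * (c < rho (X w))%R%:R).
Proof.
move=> rX s Hc c0.
have mi : measurable_fun setT (fun w => (c < rho (X w))%R%:R : R).
  apply: measurable_ltr_indic; apply: measurable_continuous_comp => //.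
  exact: seminorm_continuous.
apply: (measurable_fun_cvg
    (h := fun n w => H (mxdisc n (X w)) * (c < rho (X w))%R%:R)).
  by move=> n; apply: measurable_funM => //; exact: measurable_mxdisc.
move=> w _; have [cw|cw] := boolP (c < rho (X w)); last first.
  by under eq_fun do rewrite mulr0; rewrite mulr0; exact: cvg_cst.
apply: cvgMl; apply: mxdisc_cvg; apply: Hc; exact: le_lt_trans cw.
Qed.

End matrices.
End measurability.

(** * Expectations of bounded random variables *)

Section expectation.
Context (R : realType) (dT : measure_display) (T : measurableType dT).
Variable P : probability T R.
Implicit Types f g : T -> R.

(** Such functions are integrable for every probability, and the class is closed under the
    operations used below, so one predicate discharges the integrability conditions of the calculus
    of [Ex]. *)
Definition bounded_rv f := measurable_fun setT f /\ exists M : R, forall w, `|f w| <= M.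

Definition Ex f : R := \int[P]_w f w.

Lemma bounded_rv_integrable f : bounded_rv f -> P.-integrable setT (EFin \o f).
Proof.
move=> [mf [M hM]]; apply: measurable_bounded_integrable => //.
  by rewrite (le_lt_trans (probability_le1 P measurableT))// ltry.
exists M; split; first exact: num_real.
by move=> x Mx w _ /=; apply: (le_trans (hM w)); exact: ltW.
Qed.

Lemma bounded_rv_cst (c : R) : bounded_rv (fun=> c).
Proof. by split; [exact: measurable_cst|exists `|c|]. Qed.

Lemma bounded_rvD f g : bounded_rv f -> bounded_rv g -> bounded_rv (fun w => f w + g w).
Proof.
move=> [mf [M hM]] [mg [N hN]]; split; first exact: measurable_funD.
by exists (M + N) => w; rewrite (le_trans (ler_normD _ _))// lerD.
Qed.

Lemma bounded_rvN f : bounded_rv f -> bounded_rv (fun w => - f w).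
Proof.
move=> [mf [M hM]]; split; first exact: measurableT_comp.
by exists M => w; rewrite normrN.
Qed.

Lemma bounded_rvB f g : bounded_rv f -> bounded_rv g -> bounded_rv (fun w => f w - g w).
Proof. by move=> bf bg; apply: bounded_rvD => //; exact: bounded_rvN. Qed.

Lemma bounded_rvM f g : bounded_rv f -> bounded_rv g -> bounded_rv (fun w => f w * g w).
Proof.
move=> [mf [M hM]] [mg [N hN]]; split; first exact: measurable_funM.
by exists (M * N) => w; rewrite normrM ler_pM.
Qed.

Lemma bounded_rvZ (c : R) f : bounded_rv f -> bounded_rv (fun w => c * f w).
Proof. by move=> bf; apply: bounded_rvM => //; exact: bounded_rv_cst. Qed.

Lemma bounded_rv_norm f : bounded_rv f -> bounded_rv (fun w => `|f w|).
Proof.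
move=> [mf [M hM]]; split; first exact: measurableT_comp.
by exists M => w; rewrite normr_id.
Qed.

Lemma bounded_rv_sum (I : Type) (s : seq I) (F : I -> T -> R) :
  (forall i, bounded_rv (F i)) -> bounded_rv (fun w => \sum_(i <- s) F i w).
Proof.
move=> bF; elim: s => [|i s IH].
  by under eq_fun do rewrite big_nil; exact: bounded_rv_cst.
by under eq_fun do rewrite big_cons; exact: bounded_rvD.
Qed.

Lemma bounded_rv_ltr (c : R) f : measurable_fun setT f ->
  bounded_rv (fun w => (c < f w)%R%:R).
Proof.
move=> mf; split; first exact: measurable_ltr_indic.
by exists 1 => w; rewrite normr_nat lern1; case: (_ < _).
Qed.

Lemma Ex_cst (c : R) : Ex (fun=> c) = c.
Proof.
by rewrite /Ex Rintegral_cst// [X in _ * X](congr1 fine (probability_setT P)) /= mulr1.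
Qed.

Lemma ExD f g : bounded_rv f -> bounded_rv g -> Ex (fun w => f w + g w) = Ex f + Ex g.
Proof. by move=> bf bg; rewrite /Ex RintegralD//; exact: bounded_rv_integrable. Qed.

Lemma ExB f g : bounded_rv f -> bounded_rv g -> Ex (fun w => f w - g w) = Ex f - Ex g.
Proof. by move=> bf bg; rewrite /Ex RintegralB//; exact: bounded_rv_integrable. Qed.

Lemma ExZ (c : R) f : bounded_rv f -> Ex (fun w => c * f w) = c * Ex f.
Proof. by move=> bf; rewrite /Ex RintegralZl//; exact: bounded_rv_integrable. Qed.

Lemma Ex_sum (I : Type) (s : seq I) (F : I -> T -> R) :
  (forall i, bounded_rv (F i)) ->
  Ex (fun w => \sum_(i <- s) F i w) = \sum_(i <- s) Ex (F i).
Proof.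
move=> bF; elim: s => [|i s IH].
  by under [in LHS]eq_fun do rewrite big_nil; rewrite big_nil Ex_cst.
under [in LHS]eq_fun do rewrite big_cons.
by rewrite big_cons ExD ?IH//; exact: bounded_rv_sum.
Qed.

Lemma Ex_le f g : bounded_rv f -> bounded_rv g -> (forall w, f w <= g w) -> Ex f <= Ex g.
Proof.
by move=> bf bg h; apply: le_Rintegral => //; exact: bounded_rv_integrable.
Qed.

Lemma Ex_ge0 f : (forall w, 0 <= f w) -> 0 <= Ex f.
Proof. by move=> f0; apply: Rintegral_ge0. Qed.

Lemma Ex_norm f : bounded_rv f -> `|Ex f| <= Ex (fun w => `|f w|).
Proof. by move=> bf; apply: le_normr_Rintegral => //; exact: bounded_rv_integrable. Qed.

Lemma Rintegral_ltr (c : R) f g :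
  \int[P]_(w in [set w | c < f w]) g w = Ex (fun w => g w * (c < f w)%R%:R).
Proof.
rewrite Rintegral_mkcond /Ex; apply: eq_Rintegral => w _.
rewrite patchE; case: ifPn => [/set_mem /= ->|]; first by rewrite mulr1.
by rewrite notin_setE /= => /negP/negbTE ->; rewrite mulr0.
Qed.

Lemma Ex_ltr (c : R) f : measurable_fun setT f ->
  Ex (fun w => (c < f w)%R%:R) = fine (P [set w | c < f w]).
Proof.
move=> mf; have := Rintegral_ltr c f (fun=> 1).
rewrite Rintegral_cst ?mul1r => [->|]; first by under [in RHS]eq_fun do rewrite mul1r.
rewrite -[X in measurable X]setTI; have -> : [set w | c < f w] = f @^-1` `]c, +oo[%classic.
  by apply/seteqP; split => w /=; rewrite in_itv /= andbT.
exact: mf.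
Qed.

End expectation.

(** * A continuous partition of unity on a geometric grid *)

Section log_partition.
Variable R : realType.

(** Truncation of u to [0, 1], written with absolute values so that continuity is immediate. *)
Definition clamp (u : R) : R := (`|u| - `|u - 1| + 1) / 2.

Lemma clamp_le0 u : u <= 0 -> clamp u = 0.
Proof. by move=> u0; rewrite /clamp ler0_norm// ler0_norm; lra. Qed.

Lemma clamp_ge1 u : 1 <= u -> clamp u = 1.
Proof. by move=> u1; rewrite /clamp ger0_norm ?ger0_norm; lra. Qed.

Lemma clamp_itv u : 0 <= clamp u <= 1.
Proof.
have [u0|u0] := leP u 0; first by rewrite clamp_le0// lexx ler01.
have [u1|u1] := leP 1 u; first by rewrite clamp_ge1// lexx ler01.
by rewrite /clamp gtr0_norm// ltr0_norm; lra.
Qed.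

Lemma clamp_continuous : continuous clamp.
Proof.
move=> u; apply: cvgMl; apply: cvgD; last exact: cvg_cst.
apply: cvgB; first exact: norm_continuous.
by apply: cvg_norm; apply: cvgB; [exact: cvg_id|exact: cvg_cst].
Qed.

(** By Bernoulli's inequality. *)
Lemma exprn_unbounded (p K : R) : 1 < p -> exists n, K <= p ^+ n.
Proof.
move=> p1; have h n : 1 + n%:R * (p - 1) <= p ^+ n.
  elim: n => [|n IH]; first by rewrite expr0 mul0r addr0.
  rewrite exprS; have : p * (1 + n%:R * (p - 1)) <= p * p ^+ n by rewrite ler_pM2l; lra.
  apply: le_trans; rewrite -natr1.
  have : 0 <= n%:R * ((p - 1) * (p - 1)) by rewrite mulr_ge0// mulr_ge0; lra.
  nra.
exists (Num.bound (K / (p - 1))); apply: le_trans (h _).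
have := unstable.ltr_bound (K / (p - 1)); rewrite ltr_pdivrMr; lra.
Qed.

(* Slices in geometric progression make hi^alpha/lo^alpha constant, so no
   modulus of continuity of the power function is needed. *)
Lemma log_partition (alpha eta kappa : R) : 0 < alpha -> 0 < eta ->
  exists (n : nat) (lo hi : nat -> R) (phi : nat -> R -> R) (sigma : R),
  [/\ 0 < sigma, sigma `^ alpha = eta,
      forall k, [/\ 0 < lo k, 0 < hi k & hi k `^ alpha = (1 + eta) * lo k `^ alpha],
      forall k, [/\ continuous (phi k), forall t, 0 <= phi k t <= 1 &
                    forall t, phi k t != 0 -> lo k < t < hi k] &
      (forall t, \sum_(k < n) phi k t <= 1) /\
      (forall t, sigma <= t <= kappa -> \sum_(k < n) phi k t = 1)].
Proof.
move=> a0 e0; have ane : alpha != 0 by rewrite gt_eqF.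
(* Each bump will span two grid steps, so p is chosen with (p * p)^alpha = 1 + eta. *)
pose p := (1 + eta) `^ ((2 * alpha)^-1).
have p1 : 1 < p.
  rewrite [X in X < _](_ : 1 = 1 `^ (2 * alpha)^-1); last by rewrite powR1.
  apply: gt0_ltr_powR; rewrite ?nnegrE ?ler01//; last 2 first.
  - by rewrite addr_ge0 ?ler01// ltW.
  - by rewrite ltrDl.
  by rewrite invr_gt0 mulr_gt0.
have p0 : 0 < p by lra.
pose sigma := eta `^ alpha^-1.
have sigma0 : 0 < sigma by rewrite powR_gt0.
have sa : sigma `^ alpha = eta by rewrite -powRrM mulVf// powRr1// ltW.
(* The grid starts one step below sigma: the first ramp rises on [sigma / p, sigma] and has reached
   1 at sigma. *)
pose s k := sigma / p * p ^+ k.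
have s0 k : 0 < s k by rewrite mulr_gt0 ?exprn_gt0// divr_gt0.
have sS k : s k.+1 = p * s k by rewrite /s exprS; ring.
have slt k : s k < s k.+1 by rewrite sS ltr_pMl.
have s1 : s 1%N = sigma by rewrite /s expr1 divfK ?gt_eqF.
(* A ramp from 0 at [s k] to 1 at [s k.+1]. The bumps are differences of consecutive ramps, so their
   sum telescopes to [r 0 - r n]. *)
pose r k t := clamp ((t - s k) / (s k.+1 - s k)).
have d0 k : 0 < s k.+1 - s k by rewrite subr_gt0.
have r0 k t : t <= s k -> r k t = 0.
  by move=> h; apply: clamp_le0; rewrite pmulr_lle0 ?invr_gt0// subr_le0.
have r1 k t : s k.+1 <= t -> r k t = 1.
  by move=> h; apply: clamp_ge1; rewrite ler_pdivlMr// mul1r lerD2r.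
have rI k t : 0 <= r k t <= 1 by exact: clamp_itv.
have [n sn] : exists n, kappa <= s n.
  have [n hn] := exprn_unbounded (kappa / (sigma / p)) p1; exists n.
  by rewrite /s mulrC -ler_pdivrMr// divr_gt0.
pose phi k t := r k t - r k.+1 t.
have tele t : \sum_(k < n) phi k t = r 0%N t - r n t.
  elim: (n) => [|m IH]; first by rewrite big_ord0 subrr.
  by rewrite big_ord_recr /= IH /phi; ring.
exists n, s, (fun k => s k.+2), phi, sigma; split => //.
- move=> k; split => //.
  have pp : (p * p) `^ alpha = 1 + eta.
    rewrite -expr2 -powR_mulrn ?ltW// -!powRrM.
    by rewrite (_ : _ * _ = 1) ?powRr1//; [lra|field].
  by rewrite (sS k.+1) sS mulrA powRM ?pp// ?ltW// mulr_gt0.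
- move=> k; split.
  + have rc j : continuous (r j).
      move=> t; apply: (@continuous_comp _ _ _ (fun t => (t - s j) / (s j.+1 - s j)) clamp);
        last exact: clamp_continuous.
      by apply: cvgMl; apply: cvgB; [exact: cvg_id|exact: cvg_cst].
    by move=> t; apply: cvgB; exact: rc.
  + move=> t; have /andP[? ?] := rI k t; have /andP[? ?] := rI k.+1 t.
    rewrite /phi; have [h|h] := leP t (s k.+1); first by rewrite (r0 k.+1)//; lra.
    by rewrite (r1 k) ?(ltW h)//; lra.
  + move=> t; apply: contraNT; rewrite negb_and -!leNgt /phi => /orP[h|h].
      by rewrite !r0 ?subrr// (le_trans h)// ltW.
    by rewrite !r1 ?subrr// (le_trans _ h)// ltW.
- split=> t.
    by rewrite tele; have /andP[? ?] := rI 0%N t; have /andP[? ?] := rI n t; lra.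
  move=> /andP[h1 h2]; rewrite tele r1 ?s1// r0 ?subr0//; exact: le_trans sn.
Qed.

End log_partition.

Lemma ler_ltr_indic (R : realType) (x y z : R) :
  y <= z -> (x < y)%R%:R <= (x < z)%R%:R :> R.
Proof. by move=> yz; rewrite ler_nat; case: (ltP x y) => // h; rewrite (lt_le_trans h yz). Qed.

Lemma cvgr_sum (R : realType) (T : Type) (F : set_system T) (FF : Filter F)
    (I : Type) (s : seq I) (f : I -> T -> R) (l : I -> R) :
  (forall i, f i x @[x --> F] --> l i) ->
  \sum_(i <- s) f i x @[x --> F] --> \sum_(i <- s) l i.
Proof.
move=> h; elim: s => [|i s IH].
  by rewrite big_nil; under eq_fun do rewrite big_nil; exact: cvg_cst.
by rewrite big_cons; under eq_fun do rewrite big_cons; exact: cvgD.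
Qed.

(** * Tails of a regularly varying vector *)

Section tail.
Context (R : realType) (dT : measure_display) (T : measurableType dT)
  (P : probability T R) (q : nat) (N : 'cV[R]_q -> R) (xi : T -> 'cV[R]_q)
  (alpha : R) (dT' : measure_display) (T' : measurableType dT')
  (P' : probability T' R) (Th : T' -> 'cV[R]_q).
Hypothesis norm_N : is_norm N.
Hypothesis rv_xi : rv_family (fun w => mx_coords (xi w)).
Hypothesis alpha_gt0 : 0 < alpha.
Hypothesis rv_tail : regvar_with P N xi alpha P' Th.

Let sN : seminorm N := is_norm_seminorm norm_N.

Definition tail (x : R) : R := Ex P (fun w => (x < N (xi w))%R%:R).

Lemma measurable_norm_rv : measurable_fun setT (fun w => N (xi w)).
Proof. exact: (measurable_continuous_comp rv_xi (seminorm_continuous sN)). Qed.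

Let rv_Th : rv_family (fun w => mx_coords (Th w)). Proof. by case: rv_tail. Qed.

Let N_Th w : N (Th w) = 1. Proof. by case: rv_tail => _ ->. Qed.

Lemma tailE x : tail x = fine (P [set w | x < N (xi w)]).
Proof. by rewrite /tail Ex_ltr//; exact: measurable_norm_rv. Qed.

Lemma regvar_Ex (u : R) (g : 'cV[R]_q -> R) : 0 < u -> continuous g ->
  (exists M : R, forall v, `|g v| <= M) ->
  Ex P (fun w => g ((N (xi w))^-1 *: xi w) * (u * x < N (xi w))%R%:R) / tail x
    @[x --> +oo] --> u `^ (- alpha) * Ex P' (fun w => g (Th w)).
Proof.
move=> u0 gc [M hM]; case: rv_tail => _ _ /(_ u u0 g) h.
rewrite (_ : (fun x => _) = fun x : R =>
   (\int[P]_(w in [set w | u * x < N (xi w)]) g ((N (xi w))^-1 *: xi w))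
     / fine (P [set w | x < N (xi w)])).
  apply: h; first exact: continuous_subspaceT.
  by exists M.
by apply/funext => x; rewrite tailE Rintegral_ltr.
Qed.

Lemma tail_ge0 x : 0 <= tail x.
Proof. by apply: Ex_ge0 => w; rewrite ler0n. Qed.

Lemma bounded_tail x : bounded_rv (fun w => (x < N (xi w))%R%:R : R).
Proof. by apply: bounded_rv_ltr; exact: measurable_norm_rv. Qed.

Lemma tail_noninc x y : x <= y -> tail y <= tail x.
Proof.
move=> xy; apply: Ex_le; [exact: bounded_tail|exact: bounded_tail|] => w.
by rewrite ler_nat; case: (ltP y) => // h; rewrite (le_lt_trans xy h).
Qed.

Lemma tail_le1 x : tail x <= 1.
Proof.
rewrite -(Ex_cst P 1); apply: Ex_le; [exact: bounded_tail|exact: bounded_rv_cst|].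
by move=> w; rewrite lern1; case: (_ < _).
Qed.

Lemma tail_ratio (u : R) : 0 < u -> tail (u * x) / tail x @[x --> +oo] --> u `^ (- alpha).
Proof.
move=> u0; have := @regvar_Ex u (fun=> 1) u0.
rewrite Ex_cst mulr1 /tail => h; under [X in X @ _ --> _]eq_fun => x.
  rewrite (_ : (fun w => _) = fun w : T => 1 * (u * x < N (xi w))%R%:R); last first.
    by apply/funext => w; rewrite mul1r.
  over.
apply: h; first exact: cst_continuous.
by exists 1 => v; rewrite normr1.
Qed.

(** If the tail vanished at x, it would vanish beyond x; with the convention y / 0 = 0 the ratio of
    regular variation at u = 1 would then be eventually 0, while its limit is 1. *)
Lemma tail_gt0 x : 0 < tail x.
Proof.
rewrite lt0r tail_ge0 andbT; apply/eqP => x0.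
have t0 y : x <= y -> tail y = 0.
  by move=> /tail_noninc; rewrite x0 => h; apply/eqP; rewrite eq_le h tail_ge0.
have := tail_ratio (@ltr01 R); rewrite powR1 /= => /cvgrPdist_lt /(_ 1 ltr01).
move=> /(filterI (nbhs_pinfty_ge (num_real x))) /filter_ex[y /= [xy]].
by rewrite [tail y]t0// invr0 mulr0 subr0 normr1 ltxx.
Qed.

Lemma tail_ltrZ (a x : R) : 0 < a ->
  Ex P (fun w => (x < a * N (xi w))%R%:R) = tail (x / a).
Proof.
by move=> a0; congr Ex; apply/funext => w; rewrite ltr_pdivrMr// mulrC.
Qed.

(* Potter's bound, from the halving estimate tail (x / 2) <= 2^beta tail x. *)
Lemma potter (beta : R) : alpha < beta ->
  exists C x0 : R, [/\ 0 < C, 0 < x0 & forall x a, x0 <= x -> 0 <= a ->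
    Ex P (fun w => (x < a * N (xi w))%R%:R) <= C * (1 + a `^ beta) * tail x].
Proof.
move=> ab; pose B := 2 `^ beta.
have b0 : 0 < beta by exact: lt_trans ab.
have B1 : 1 < B.
  rewrite [X in X < _](_ : 1 = 1 `^ beta); last by rewrite powR1.
  by apply: gt0_ltr_powR; rewrite ?nnegrE ?ler01 ?ler0n ?ltr1n.
have B0 : 0 < B by lra.
(* The ratio of the tails at x / 2 and at x tends to 2^alpha, which is strictly below B = 2^beta. *)
have [x0 x00 hx0] : exists2 x0, 0 < x0 & forall x, x0 <= x -> tail (x / 2) <= B * tail x.
  have h2 : (0 : R) < 2^-1 by rewrite invr_gt0.
  have := tail_ratio h2; rewrite (_ : 2^-1 `^ (- alpha) = 2 `^ alpha); last first.
    by rewrite -powR_inv1 ?ler0n// -powRrM mulN1r opprK.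
  move=> /cvgrPdist_lt /(_ (B - 2 `^ alpha)); rewrite subr_gt0.
  have -> : 2 `^ alpha < B by rewrite /B /powR pnatr_eq0 /= ltr_expR ltr_pM2r// ln_gt0// ltr1n.
  move=> /(_ isT) [x1 [_ hx1]]; exists (1 + `|x1|); first by rewrite ltr_wpDr.
  move=> x xx; have /hx1 /= : x1 < x by have := ler_norm x1; lra.
  rewrite ltr_norml => /andP[h _]; rewrite -ler_pdivrMr ?tail_gt0// mulrC.
  by rewrite [x / 2]mulrC; lra.
have Vx0 := tail_gt0 x0.
have C1 : 1 <= (tail x0)^-1 by rewrite invf_ge1 ?tail_le1// posrE.
(* Halving is iterated while the argument stays above x0. Once x / 2 < x0, the left side is bounded
   by 1, and the factor 1 / tail x0 pays for this because tail x0 <= tail (x / 2) <= B * tail x. *)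
have key k x : x0 <= x -> tail (x / 2 ^+ k) <= (tail x0)^-1 * B ^+ k * tail x.
  elim: k x => [|k IH] x xx.
    by rewrite !expr0 invr1 !mulr1 ler_peMl ?tail_ge0.
  rewrite exprS invfM mulrA.
  have [h|h] := leP x0 (x / 2).
    apply: le_trans (IH _ h) _; rewrite exprS [B * _]mulrC mulrA -[leRHS]mulrA.
    by rewrite ler_pM2l ?hx0// mulr_gt0 ?invr_gt0 ?exprn_gt0.
  apply: le_trans (tail_le1 _) _; rewrite -ler_pdivrMl ?mulr_gt0 ?invr_gt0 ?exprn_gt0//.
  rewrite mulr1 invfM invrK exprS invfM mulrCA.
  have : tail x0 <= B * tail x by apply: le_trans (hx0 _ xx); apply/tail_noninc/ltW.
  rewrite -ler_pdivrMl// => h'; apply: le_trans h'.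
  rewrite ler_pM2l ?invr_gt0// ler_piMr ?tail_ge0//.
  by rewrite invf_le1 ?exprn_gt0// exprn_ege1// ltW.
exists ((tail x0)^-1 * B), x0; split => //; first by rewrite mulr_gt0 ?invr_gt0.
move=> x a xx a0; have [->|an0] := eqVneq a 0.
  rewrite (_ : (fun w => _) = fun=> 0) ?Ex_cst; last first.
    by apply/funext => w; rewrite mul0r ltNge (le_trans _ xx) ?ltW.
  by rewrite !mulr_ge0 ?invr_ge0 ?ltW// ?addr_gt0 ?tail_gt0// powR_gt0.
have {an0}a0 : 0 < a by rewrite lt0r an0.
rewrite tail_ltrZ//.
(* The least k with a <= 2^k: for k > 0 minimality gives 2^(k-1) <= a, hence B^k <= B * a^beta; for
   k = 0 the summand 1 is enough. *)
have [k ka kB] : exists2 k, a <= 2 ^+ k & B ^+ k <= B * (1 + a `^ beta).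
  have ex : exists k, a <= 2 ^+ k by apply: exprn_unbounded; rewrite ltr1n.
  exists (ex_minn ex); case: ex_minnP => // -[|k] _ hm.
    by rewrite expr0 mulrDr mulr1 ler_wpDr ?ltW// mulr_gt0// powR_gt0.
  rewrite exprS ler_pM2l// ler_wpDl//.
  have : 2 ^+ k <= a by rewrite leNgt; apply/negP => /ltW /hm; rewrite ltnn.
  move=> h; rewrite /B -powR_mulrn ?powR_ge0// -powRrM mulrC powRrM powR_mulrn ?ler0n//.
  by apply: ge0_ler_powR => //; rewrite ?nnegrE ?ltW// exprn_gt0.
have /tail_noninc/le_trans : x / 2 ^+ k <= x / a.
  by rewrite ler_pM2l ?(lt_le_trans x00)// lef_pV2 ?posrE ?exprn_gt0.
apply; apply: le_trans (key k x xx) _.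
by rewrite ler_wpM2r ?tail_ge0// -mulrA ler_wpM2l// invr_ge0 ltW.
Qed.

Lemma seminorm_le_normed (tau : 'cV[R]_q -> R) : seminorm tau ->
  exists2 k : R, 0 < k & forall v, tau v <= k * N v.
Proof.
move=> st; have [k1 k10 h1] := seminorm_le_norm st.
have [k2 k20 h2] := norm_equiv norm_N.
exists (k1 * k2); first by rewrite mulr_gt0.
by move=> v; rewrite (le_trans (h1 v))// -mulrA ler_pM2l.
Qed.

(** The weight [p] is the value of a bump, so [a] and [b] need to be compared only on the slice
    where the bump is nonzero. *)
Lemma slice_le (g p a b : R) : 0 <= g -> 0 <= p -> (p != 0 -> a <= b) ->
  a * (g * p) <= g * b * p.
Proof.
move=> g0 p0 h; rewrite mulrCA -mulrA ler_wpM2l//.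
by have [->|/h] := eqVneq p 0; [rewrite !mulr0|exact: ler_wpM2r].
Qed.

Lemma slice_ge (g p a b : R) : 0 <= g -> 0 <= p -> (p != 0 -> b <= a) ->
  g * b * p <= a * (g * p).
Proof.
move=> g0 p0 h; rewrite [leRHS]mulrCA -[leLHS]mulrA ler_wpM2l//.
by have [->|/h] := eqVneq p 0; [rewrite !mulr0|exact: ler_wpM2r].
Qed.

Section single_term.
Variables (G tau : 'cV[R]_q -> R).
Hypothesis sem_tau : seminorm tau.
Hypothesis cont_G : forall v, 0 < tau v -> {for v, continuous G}.

Lemma bounded_ind_off_kernel (M c : R) : (forall v, `|G v| <= M) -> 0 <= c ->
  bounded_rv (fun w => G (xi w) * (c < tau (xi w))%R%:R).
Proof.
move=> hM c0; split; first exact: (measurable_off_kernel rv_xi sem_tau).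
exists M => w; rewrite normrM normr_nat (le_trans _ (hM (xi w)))//.
by rewrite ler_piMr// lern1; case: (_ < _).
Qed.

(** On the kernel of [tau], where [G] may be discontinuous, the factor tau^alpha is 0, so an
    indicator of tau > 0 can be inserted for measurability. The bound comes from [Th] lying on the
    unit sphere, where [tau] is bounded. *)
Lemma bounded_powR_off_kernel (M : R) : (forall v, `|G v| <= M) ->
  bounded_rv (fun w => G (Th w) * tau (Th w) `^ alpha).
Proof.
move=> hM; split.
  rewrite (_ : (fun w => _) = fun w =>
      (G (Th w) * (0 < tau (Th w))%R%:R) * tau (Th w) `^ alpha); last first.
    apply/funext => w; have := seminorm_ge0 (Th w) sem_tau; rewrite le_eqVlt.
    by case: eqP => [<- _|_ /= ->]; rewrite ?mulr1// powR0 ?gt_eqF// !mulr0.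
  apply: measurable_funM; first exact: (measurable_off_kernel rv_Th sem_tau).
  apply: (measurableT_comp (measurable_powR alpha)).
  exact: (measurable_continuous_comp rv_Th (seminorm_continuous sem_tau)).
have [k k0 hk] := seminorm_le_normed sem_tau.
exists (M * k `^ alpha) => w; rewrite normrM ler_pM// ger0_norm ?powR_ge0//.
have tk : tau (Th w) <= k by rewrite (le_trans (hk _))// N_Th mulr1.
by apply: ge0_ler_powR; rewrite ?nnegrE ?seminorm_ge0// ltW.
Qed.

Hypothesis hom_G : forall c v, 0 < c -> G (c *: v) = G v.

(** On the slice lo < tau(v) < hi, the event x < N(xi) * tau(v) contains x < lo * N(xi) and is
    contained in x < hi * N(xi), events with constant thresholds. Directions with tau(v) <= sigma
    are left out of the lower bound and cost at most M * tail (x / sigma) in the upper one,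
    asymptotically M * eta. Nonnegativity of [G] lets these inclusions pass to expectations. *)
Lemma single_term_nonneg (M : R) : (forall v, 0 <= G v <= M) ->
  Ex P (fun w => G (xi w) * (x < tau (xi w))%R%:R) / tail x
    @[x --> +oo] --> Ex P' (fun w => G (Th w) * tau (Th w) `^ alpha).
Proof.
move=> hM; have nGM v : `|G v| <= M.
  by have /andP[? ?] := hM v; rewrite ger0_norm.
have M0 : 0 <= M by exact: le_trans (nGM 0).
have [kappa kappa0 hk] := seminorm_le_normed sem_tau.
set T0 := Ex P' _.
have T00 : 0 <= T0.
  by apply: Ex_ge0 => w; rewrite mulr_ge0 ?powR_ge0//; case/andP: (hM (Th w)).
apply/cvgrPdist_le => e e0.
(* The limits of the two bounds will differ by eta * (M + L) with L <= T0, which this choice keeps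
   below e / 2. *)
have [eta etaE] : exists eta, eta = e / (2 * (M + T0 + 1)) by eexists.
have MT0 : 0 < 2 * (M + T0 + 1) by lra.
have eta0 : 0 < eta by rewrite etaE divr_gt0.
have [n [lo [hi [phi [sigma [sig0 sigE lohi phiP [phi1 phi2]]]]]]] :=
  log_partition kappa alpha_gt0 eta0.
(* The bump vanishes for tau <= lo k, hence near the kernel of [tau]: the product is continuous
   everywhere and is an admissible test function for (M1). *)
pose g k v := G v * phi k (tau v).
have phi_ge0 k t : 0 <= phi k t by have [_ /(_ t)/andP[]] := phiP k.
have phi_le1 k t : phi k t <= 1 by have [_ /(_ t)/andP[]] := phiP k.
have gM k v : `|g k v| <= M.
  rewrite normrM -[leRHS]mulr1 ler_pM// ger0_norm//.
have gc k : continuous (g k).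
  have [pc _ psupp] := phiP k; have [lo0 _ _] := lohi k.
  move=> v; have [tv|tv] := ltP 0 (tau v).
    have h2 : {for v, continuous (phi k \o tau)}.
      by apply: continuous_comp; [exact: seminorm_continuous|exact: pc].
    exact: cvgM (cont_G tv) h2.
  apply/continuous_atP => r r0.
  have /(@continuous_atP _ _ R)/(_ (lo k) lo0) := @seminorm_continuous _ _ _ _ sem_tau v.
  move=> [d d0 hd]; exists d => // u /hd; rewrite ltr_norml => /andP[hu _].
  have z t : t <= lo k -> phi k t = 0.
    by move=> tl; apply/eqP; apply: contraTT tl => /psupp /andP[h _]; rewrite -ltNge.
  by rewrite /g !z ?mulr0 ?subrr ?normr0//; lra.
pose E k := Ex P' (fun w => g k (Th w)).
have bgTh k : bounded_rv (fun w => g k (Th w)).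
  split; last by exists M.
  exact: (measurable_continuous_comp rv_Th (gc k)).
have bgxi k c : bounded_rv (fun w => g k ((N (xi w))^-1 *: xi w) * (c < N (xi w))%R%:R).
  apply: bounded_rvM; last exact: bounded_tail.
  split; last by exists M => w; exact: gM.
  apply: (measurable_continuous_comp _ (gc k)).
  apply/rv_coord => i j; under eq_fun do rewrite mxE; apply: measurable_funM; last first.
    by move/rv_coord : rv_xi.
  rewrite (_ : (fun w => _) = fun w => N (xi w) `^ (-1)); last first.
    by apply/funext => w; rewrite powR_inv1// seminorm_ge0.
  by apply: (measurableT_comp (measurable_powR (-1))); exact: measurable_norm_rv.
(* [L] and [U] are the limits of the lower and the upper bound. Since hi^alpha = (1 + eta) *
   lo^alpha in every slice, [U] is an explicit function of [L]; both enclose [T0] by the same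
   slicing applied to [Th]. *)
pose L := \sum_(k < n) lo k `^ alpha * E k.
pose U := M * eta + \sum_(k < n) hi k `^ alpha * E k.
have UE : U = M * eta + (1 + eta) * L.
  rewrite /U mulr_sumr; congr (_ + _); apply: eq_bigr => k _.
  by have [_ _ ->] := lohi k; rewrite mulrA.
have bT0 : bounded_rv (fun w => G (Th w) * tau (Th w) `^ alpha).
  exact: bounded_powR_off_kernel nGM.
have LT : L <= T0.
  rewrite /L; under eq_bigr do rewrite -ExZ//.
  rewrite -Ex_sum; last by move=> k; exact: bounded_rvZ.
  apply: Ex_le => //; first by apply: bounded_rv_sum => k; exact: bounded_rvZ.
  move=> w; set v := Th w; have /andP[G0 GM] := hM v.
  apply: (@le_trans _ _ (\sum_(k < n) (G v * tau v `^ alpha) * phi k (tau v))).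
    apply: ler_sum => k _; apply: slice_le => // nz.
    have [_ _ /(_ _ nz)/andP[h _]] := phiP k; have [lo0 _ _] := lohi k.
    by apply: ge0_ler_powR; rewrite ?nnegrE ?seminorm_ge0// ltW.
  by rewrite -mulr_sumr ler_piMr// mulr_ge0// powR_ge0.
have TU : T0 <= U.
  rewrite /U -[M * eta](Ex_cst P'); under eq_bigr do rewrite -ExZ//.
  rewrite -Ex_sum; last by move=> k; exact: bounded_rvZ.
  rewrite -ExD; [|exact: bounded_rv_cst|by apply: bounded_rv_sum => k; exact: bounded_rvZ].
  apply: Ex_le => //.
    by apply: bounded_rvD; [exact: bounded_rv_cst|apply: bounded_rv_sum => k; exact: bounded_rvZ].
  move=> w; set v := Th w; have /andP[G0 GM] := hM v.
  have tk : tau v <= kappa by rewrite (le_trans (hk _))// N_Th mulr1.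
  have [ts|ts] := leP (tau v) sigma.
    rewrite ler_wpDr//.
      by apply: sumr_ge0 => k _; rewrite mulr_ge0 ?powR_ge0// mulr_ge0.
    rewrite -sigE ler_pM ?powR_ge0//.
    by apply: ge0_ler_powR; rewrite ?nnegrE ?seminorm_ge0// ltW.
  rewrite ler_wpDl ?mulr_ge0 ?(ltW eta0)//.
  rewrite -[leLHS]mulr1 -(phi2 (tau v)) ?(ltW ts)// mulr_sumr.
  apply: ler_sum => k _; apply: slice_ge => // nz.
  have [_ _ /(_ _ nz)/andP[_ h]] := phiP k; have [_ hi0 _] := lohi k.
  by apply: ge0_ler_powR; rewrite ?nnegrE ?seminorm_ge0// ltW.
pose I k (c x : R) := Ex P (fun w => g k ((N (xi w))^-1 *: xi w) * (c^-1 * x < N (xi w))%R%:R).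
have Ilim k c : 0 < c -> I k c x / tail x @[x --> +oo] --> c `^ alpha * E k.
  move=> c0; have ci : 0 < c^-1 by rewrite invr_gt0.
  have -> : c `^ alpha = c^-1 `^ (- alpha).
    by rewrite -(powR_inv1 (ltW c0)) -powRrM mulN1r opprK.
  by apply: regvar_Ex => //; exists M.
pose lower x := \sum_(k < n) I k (lo k) x / tail x.
pose upper x := M * (tail (sigma^-1 * x) / tail x) + \sum_(k < n) I k (hi k) x / tail x.
have lowerL : lower x @[x --> +oo] --> L.
  by apply: cvgr_sum => k; apply: Ilim; case: (lohi k).
have upperU : upper x @[x --> +oo] --> U.
  apply: cvgD; last by apply: cvgr_sum => k; apply: Ilim; case: (lohi k).
  apply: cvgMr; rewrite -sigE (_ : sigma `^ alpha = sigma^-1 `^ (- alpha)).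
    by apply: tail_ratio; rewrite invr_gt0.
  by rewrite -(powR_inv1 (ltW sig0)) -powRrM mulN1r opprK.
pose v w := (N (xi w))^-1 *: xi w.
have N0 w : 0 <= N (xi w) by exact: seminorm_ge0.
have vk w : tau (v w) <= kappa.
  rewrite (le_trans (hk _))// -[leRHS]mulr1 ler_pM2l// /v seminormZ_pos ?invr_ge0//.
  by have [->|nz] := eqVneq (N (xi w)) 0; rewrite ?mulr0// mulVf.
(* Homogeneity replaces xi by its direction. If N(xi) = 0, then xi = 0 and both indicators vanish
   because x > 0. *)
have vE x w : 0 < x -> G (xi w) * (x < tau (xi w))%R%:R =
    G (v w) * (x < N (xi w) * tau (v w))%R%:R.
  move=> x0; have [nz|nz] := eqVneq (N (xi w)) 0.
    have -> : xi w = 0 by case: norm_N => + _ _; apply.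
    by rewrite !(seminorm0 sN, seminorm0 sem_tau, mul0r) ltNge (ltW x0) !mulr0.
  have Np : 0 < N (xi w) by rewrite lt0r nz N0.
  by rewrite /v hom_G ?invr_gt0// seminormZ_pos ?invr_ge0// mulVKf.
have vEx x : 0 < x -> Ex P (fun w => G (xi w) * (x < tau (xi w))%R%:R) =
    Ex P (fun w => G (v w) * (x < N (xi w) * tau (v w))%R%:R).
  by move=> x0; congr Ex; apply/funext => w; exact: vE.
have bvG x : 0 < x -> bounded_rv (fun w => G (v w) * (x < N (xi w) * tau (v w))%R%:R).
  move=> x0; rewrite (_ : (fun w => _) = fun w => G (xi w) * (x < tau (xi w))%R%:R).
    exact: bounded_ind_off_kernel nGM (ltW x0).
  by apply/funext => w; rewrite vE.
have IE k c x : 0 < c -> I k c x = Ex P (fun w => g k (v w) * (x < c * N (xi w))%R%:R).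
  by move=> c0; congr Ex; apply/funext => w; rewrite ltr_pdivrMl.
have bI k c x : 0 < c -> bounded_rv (fun w => g k (v w) * (x < c * N (xi w))%R%:R).
  move=> c0; have := bgxi k (c^-1 * x); congr bounded_rv.
  by apply/funext => w; rewrite ltr_pdivrMl.
have lo0 k : 0 < lo k by case: (lohi k).
have hi0 k : 0 < hi k by case: (lohi k).
have lower_le x : 0 < x ->
    lower x <= Ex P (fun w => G (xi w) * (x < tau (xi w))%R%:R) / tail x.
  move=> x0; rewrite /lower -mulr_suml ler_pM2r ?invr_gt0 ?tail_gt0//.
  under eq_bigr do rewrite IE//; rewrite -Ex_sum; last by move=> k; exact: bI.
  rewrite vEx//.
  apply: Ex_le; [by apply: bounded_rv_sum => k; exact: bI|exact: bvG|] => w.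
  have /andP[G0 _] := hM (v w).
  apply: (@le_trans _ _ (\sum_(k < n)
     (G (v w) * (x < N (xi w) * tau (v w))%R%:R) * phi k (tau (v w)))).
    apply: ler_sum => k _; rewrite mulrC; apply: slice_le => // nz.
    apply: ler_ltr_indic; rewrite mulrC ler_wpM2l//.
    by have [_ _ /(_ _ nz)/andP[/ltW h _]] := phiP k.
  by rewrite -mulr_sumr ler_piMr// mulr_ge0.
have le_upper x : 0 < x ->
    Ex P (fun w => G (xi w) * (x < tau (xi w))%R%:R) / tail x <= upper x.
  move=> x0; rewrite /upper mulrA -mulr_suml -mulrDl ler_pM2r ?invr_gt0 ?tail_gt0//.
  under eq_bigr do rewrite IE//; rewrite -Ex_sum; last by move=> k; exact: bI.
  have -> : tail (sigma^-1 * x) = Ex P (fun w => (x < sigma * N (xi w))%R%:R).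
    by congr Ex; apply/funext => w; rewrite ltr_pdivrMl.
  have bs : bounded_rv (fun w => (x < sigma * N (xi w))%R%:R : R).
    by apply: bounded_rv_ltr; apply: measurable_funM => //; exact: measurable_norm_rv.
  rewrite -ExZ// -ExD; [|exact: bounded_rvZ|by apply: bounded_rv_sum => k; exact: bI].
  rewrite vEx//.
  apply: Ex_le; [exact: bvG|apply: bounded_rvD|]; [exact: bounded_rvZ|by apply: bounded_rv_sum => k; exact: bI|] => w.
  have tk := vk w; have /andP[G0 GM] := hM (v w).
  have [ts|ts] := leP (tau (v w)) sigma.
    rewrite ler_wpDr//; first by apply: sumr_ge0 => k _; rewrite !mulr_ge0.
    by apply: ler_pM => //; apply: ler_ltr_indic; rewrite mulrC ler_wpM2r.
  rewrite ler_wpDl ?mulr_ge0//.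
  rewrite -[leLHS]mulr1 -[X in _ * X <= _](phi2 (tau (v w))) ?(ltW ts)// mulr_sumr.
  apply: ler_sum => k _; rewrite [leRHS]mulrC; apply: slice_ge => // nz.
  apply: ler_ltr_indic; rewrite [leRHS]mulrC ler_wpM2l//.
  by have [_ _ /(_ _ nz)/andP[_ /ltW h]] := phiP k.
have L0 : 0 <= L.
  apply: sumr_ge0 => k _; rewrite mulr_ge0 ?powR_ge0//; apply: Ex_ge0 => w.
  by rewrite mulr_ge0//; case/andP: (hM (Th w)).
have UL : U - L <= e / 2.
  rewrite UE (_ : _ - L = eta * (M + L)); last by ring.
  rewrite etaE mulrAC ler_pdivrMr// -[leRHS]mulrA ler_pM2l//; lra.
have e2 : 0 < e / 2 by rewrite divr_gt0.
near=> x.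
have x0 : 0 < x by near: x; exact: nbhs_pinfty_gt.
have h1 : L - e / 2 <= lower x.
  rewrite lerBlDr -lerBlDl.
  suff : `|L - lower x| <= e / 2 by rewrite ler_norml => /andP[].
  by near: x; move/cvgrPdist_le : lowerL; apply.
have h2 : upper x <= U + e / 2.
  suff : `|U - upper x| <= e / 2 by rewrite ler_norml; lra.
  by near: x; move/cvgrPdist_le : upperU; apply.
have := lower_le x x0; have := le_upper x x0.
by rewrite ler_norml; lra.
Unshelve. all: by end_near. Qed.

End single_term.

(** Both sides are linear in G = (G + M) - M, a difference of two nonnegative functions that are
    still homogeneous of degree 0. *)
Lemma single_term (G tau : 'cV[R]_q -> R) (M : R) : seminorm tau ->
  (forall v, 0 < tau v -> {for v, continuous G}) ->
  (forall c v, 0 < c -> G (c *: v) = G v) -> (forall v, `|G v| <= M) ->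
  Ex P (fun w => G (xi w) * (x < tau (xi w))%R%:R) / tail x
    @[x --> +oo] --> Ex P' (fun w => G (Th w) * tau (Th w) `^ alpha).
Proof.
move=> st cG hG hM; have M0 : 0 <= M by exact: le_trans (hM 0).
pose G1 v := G v + M; pose G2 := fun _ : 'cV[R]_q => M.
have G1M v : 0 <= G1 v <= M + M.
  by have := hM v; rewrite ler_norml /G1; lra.
have G2M v : 0 <= G2 v <= M by rewrite /G2 M0 lexx.
have c1 v : 0 < tau v -> {for v, continuous G1}.
  by move=> tv; exact: cvgD (cG v tv) (cvg_cst _).
have c2 v : 0 < tau v -> {for v, continuous G2} by move=> _; exact: cst_continuous.
have l1 := single_term_nonneg st c1 _ G1M.
have l2 := single_term_nonneg st c2 (fun _ _ _ => erefl) G2M.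
have n1 v : `|G1 v| <= M + M by have := G1M v; rewrite ler_norml; lra.
have n2 v : `|G2 v| <= M by have := G2M v; rewrite ler_norml; lra.
have := cvgB (l1 (fun c v c0 => congr1 (fun t => t + M) (hG c v c0))) l2.
rewrite -ExB; [|exact: (bounded_powR_off_kernel st c1 n1)|exact: (bounded_powR_off_kernel st c2 n2)].
rewrite (_ : (fun w => _) = fun w : T' => G (Th w) * tau (Th w) `^ alpha); last first.
  by apply/funext => w; rewrite /G1 /G2 -mulrBl addrK.
have FF : Filter (pinfty_nbhs R) by exact: _.
move=> /(_ FF); apply: cvg_trans; apply: near_eq_cvg; near=> x.
have x0 : 0 <= x by near: x; exact: nbhs_pinfty_ge.
transitivity (Ex P (fun w => G1 (xi w) * (x < tau (xi w))%R%:R) / tail x -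
  Ex P (fun w => G2 (xi w) * (x < tau (xi w))%R%:R) / tail x) => //.
rewrite -mulrBl -ExB; [|exact: (bounded_ind_off_kernel st c1 n1)|exact: (bounded_ind_off_kernel st c2 n2)].
by congr (Ex _ _ / _); apply/funext => w; rewrite /G1 /G2 -mulrBl addrK.
Unshelve. all: by end_near. Qed.

End tail.

(** * Laws and independence *)

Section laws.
Context (R : realType) (dT : measure_display) (T : measurableType dT)
  (P : probability T R).

Definition cyl_gen (K : Type) : set (set (K -> R)) :=
  [set A | exists (k : K) (B : set R), measurable B /\ A = (fun x => x k) @^-1` B].

Definition sigma_gen (K : Type) (X : T -> K -> R) : set (set T) :=
  [set A | exists (k : K) (B : set R), measurable B /\ A = (fun w => X w k) @^-1` B].

Lemma measurable_fun_gen (U : pointedType) (G : set (set U))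
    (f : T -> g_sigma_algebraType G) :
  (forall A, G A -> measurable (f @^-1` A)) -> measurable_fun setT f.
Proof.
move=> h; apply: (@measurability _ _ _ (g_sigma_algebraType G) setT f G) => //.
by move=> _ [A GA <-]; rewrite setTI; exact: h.
Qed.

Lemma rv_family_cyl K (X : T -> K -> R) : rv_family X ->
  measurable_fun setT (X : T -> g_sigma_algebraType (@cyl_gen K)).
Proof.
move=> rX; apply: measurable_fun_gen => _ [k [B [mB ->]]].
by rewrite -[X in measurable X]setTI; exact: rX.
Qed.

Lemma rv_family_eval (K : Type) :
  rv_family (fun (x : g_sigma_algebraType (@cyl_gen K)) (k : K) => x k).
Proof.
move=> k _ B mB; rewrite setTI; apply: sub_sigma_algebra.
by exists k, B.
Qed.

(** [same_law] says that the two image measures on the cylinder sigma-algebra coincide, and each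
    integral is an integral against the image measure. *)
Lemma same_law_integral K (X Y : T -> K -> R)
    (f : g_sigma_algebraType (@cyl_gen K) -> \bar R) :
  rv_family X -> rv_family Y -> same_law P X Y ->
  measurable_fun setT f -> (forall x, 0 <= f x)%E ->
  (\int[P]_w f (X w) = \int[P]_w f (Y w))%E.
Proof.
move=> /rv_family_cyl mX /rv_family_cyl mY XY mf f0.
have -> : (\int[P]_w f (X w) =
    \int[pushforward P (X : T -> g_sigma_algebraType (@cyl_gen K))]_x f x)%E.
  by rewrite ge0_integral_pushforward.
have -> : (\int[P]_w f (Y w) =
    \int[pushforward P (Y : T -> g_sigma_algebraType (@cyl_gen K))]_x f x)%E.
  by rewrite ge0_integral_pushforward.
by apply: eq_measure_integral => A mA _; exact: XY.
Qed.

Lemma measurable_id_sigma_gen K (X : T -> K -> R) : rv_family X ->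
  measurable_fun setT (id : T -> g_sigma_algebraType (sigma_gen X)).
Proof.
move=> rX; apply: measurable_fun_gen => _ [k [B [mB ->]]].
by rewrite -[X in measurable X]setTI; exact: rX.
Qed.

Lemma Ex_fin (f : T -> R) : bounded_rv f -> ((Ex P f)%:E = \int[P]_w (f w)%:E)%E.
Proof.
move=> bf; rewrite /Ex /Rintegral fineK//.
exact: (integrable_fin_num measurableT (bounded_rv_integrable P bf)).
Qed.

Lemma same_law_Ex K (X Y : T -> K -> R) (f : g_sigma_algebraType (@cyl_gen K) -> R) :
  rv_family X -> rv_family Y -> same_law P X Y ->
  bounded_rv f -> Ex P (f \o X) = Ex P (f \o Y).
Proof.
move=> rX rY XY [mf [M hM]].
have b (Z : T -> K -> R) : rv_family Z -> bounded_rv (f \o Z).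
  move=> /rv_family_cyl mZ; split; first exact: (measurableT_comp mf mZ).
  by exists M => w; exact: hM.
apply: (addIr M); rewrite -(Ex_cst P M) -!ExD; [|exact: b|exact: bounded_rv_cst|exact: b|exact: bounded_rv_cst].
rewrite /Ex /Rintegral; congr fine.
apply: (@same_law_integral K X Y (fun x => (f x + M)%:E)) => //.
  by apply/measurable_EFinP; exact: measurable_funD.
by move=> x; rewrite lee_fin; have := hM x; rewrite ler_norml; lra.
Qed.

(* The sigma-algebras generated by X and Y are made into measurable spaces on
   T, so that independence says that the law of w |-> (w, w) is the product. *)
Lemma indep_integral K K' (X : T -> K -> R) (Y : T -> K' -> R)
  (F : g_sigma_algebraType (sigma_gen X) * g_sigma_algebraType (sigma_gen Y) -> \bar R) :
  rv_family X -> rv_family Y -> indep2 P (sigma_of X) (sigma_of Y) ->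
  measurable_fun setT F -> (forall z, 0 <= F z)%E ->
  (\int[P]_w F (w, w) = \int[P]_w \int[P]_w' F (w, w'))%E /\
  measurable_fun setT (fun w : T => \int[P]_w' F (w, w'))%E.
Proof.
move=> rX rY ind mF F0.
pose T1 := g_sigma_algebraType (sigma_gen X).
pose T2 := g_sigma_algebraType (sigma_gen Y).
have m1 : measurable_fun setT (id : T -> T1) := measurable_id_sigma_gen rX.
have m2 : measurable_fun setT (id : T -> T2) := measurable_id_sigma_gen rY.
pose i1 : {mfun T >-> T1} := HB.pack (id : T -> T1) (isMeasurableFun.Build _ _ _ _ _ m1).
pose i2 : {mfun T >-> T2} := HB.pack (id : T -> T2) (isMeasurableFun.Build _ _ _ _ _ m2).
have m12 : measurable_fun setT (fun w : T => (i1 w, i2 w)) by exact: measurable_fun_pair.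
pose P1 := distribution P i1; pose P2 := distribution P i2.
have inner (w : T1) : (\int[P]_w' F (w, w') = \int[P2]_w' F (w, w'))%E.
  rewrite (@ge0_integral_distribution _ _ _ _ _ P i2 (fun w' => F (w, w'))) //.
  by apply: measurableT_comp => //; exact: pair1_measurable.
have mI : measurable_fun setT (fun w : T1 => \int[P2]_w' F (w, w'))%E.
  exact: measurable_fun_fubini_tonelli_F.
split; last first.
  rewrite (_ : (fun w => _) = (fun w : T1 => \int[P2]_w' F (w, w'))%E \o i1).
    exact: measurableT_comp mI m1.
  by apply/funext => w /=; rewrite inner.
transitivity (\int[pushforward P (fun w : T => (i1 w, i2 w))]_z F z)%E.
  by rewrite ge0_integral_pushforward.
transitivity (\int[(P1 \x P2)%E]_z F z)%E.
  apply: eq_measure_integral => A mA _; apply/esym.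
  apply: (product_measure_unique (m' := pushforward P (fun w : T => (i1 w, i2 w)))) => //.
rewrite fubini_tonelli1//.
rewrite /P1 (@ge0_integral_distribution _ _ _ _ _ P i1) //=.
  by apply: eq_integral => w _ /=; rewrite inner.
by move=> w; apply: integral_ge0.
Qed.

(** Adding the bound [M] makes [F] nonnegative, so that the Tonelli form above applies; the constant
    is subtracted afterwards. *)
Lemma indep_Ex K K' (X : T -> K -> R) (Y : T -> K' -> R)
  (F : g_sigma_algebraType (sigma_gen X) * g_sigma_algebraType (sigma_gen Y) -> R) :
  rv_family X -> rv_family Y -> indep2 P (sigma_of X) (sigma_of Y) ->
  bounded_rv F ->
  bounded_rv (fun w : T => Ex P (fun w' => F (w, w'))) /\
  Ex P (fun w => F (w, w)) = Ex P (fun w => Ex P (fun w' => F (w, w'))).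
Proof.
move=> rX rY ind [mF [M hM]].
have bin (w : T) : bounded_rv (fun w' : T => F (w, w')).
  split; last by exists M => w'; exact: hM.
  have : measurable_fun setT (F \o pair w).
    by apply: measurableT_comp => //; exact: pair1_measurable.
  by move=> h; exact: (measurableT_comp h (measurable_id_sigma_gen rY)).
have bdiag : bounded_rv (fun w : T => F (w, w)).
  split; last by exists M => w'; exact: hM.
  have m12 := measurable_fun_pair (measurable_id_sigma_gen rX) (measurable_id_sigma_gen rY).
  exact: (measurableT_comp mF m12).
have mFM : measurable_fun setT (fun z => (F z + M)%:E).
  by apply/measurable_EFinP; exact: measurable_funD.
have FM0 z : (0 <= (F z + M)%:E)%E.
  by rewrite lee_fin; have := hM z; rewrite ler_norml; lra.
have [e m] := indep_integral rX rY ind mFM FM0.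
have inE (w : T) : (\int[P]_w' (F (w, w') + M)%:E = (Ex P (fun w' => F (w, w')) + M)%:E)%E.
  rewrite -[in RHS](Ex_cst P M) -ExD//; last exact: bounded_rv_cst.
  by rewrite Ex_fin//; apply: bounded_rvD => //; exact: bounded_rv_cst.
have bout : bounded_rv (fun w : T => Ex P (fun w' => F (w, w'))).
  split.
    rewrite (_ : (fun w => _) = fun w => (Ex P (fun w' => F (w, w')) + M) - M); last first.
      by apply/funext => w; rewrite addrK.
    apply: measurable_funB => //; apply/measurable_EFinP.
    by rewrite (_ : EFin \o _ = (fun w => \int[P]_w' (F (w, w') + M)%:E)%E) //; apply/funext => w /=; rewrite inE.
  exists M => w; apply: le_trans (Ex_norm _ (bin w)) _; rewrite -[leRHS](Ex_cst P M).
  by apply: Ex_le => //; [exact: bounded_rv_norm|exact: bounded_rv_cst].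
split => //; apply: (addIr M); rewrite -[in LHS](Ex_cst P M) -[in RHS](Ex_cst P M).
rewrite -!ExD//; try exact: bounded_rv_cst.
apply: EFin_inj; rewrite Ex_fin; last by apply: bounded_rvD => //; exact: bounded_rv_cst.
rewrite e Ex_fin; last by apply: bounded_rvD => //; exact: bounded_rv_cst.
by apply: eq_integral => w _; exact: inE.
Qed.

End laws.

Lemma ler_sum_mem (R : realType) (I : eqType) (s : seq I) (f : I -> R) (t : I) :
  t \in s -> (forall i, 0 <= f i) -> f t <= \sum_(i <- s) f i.
Proof.
move=> ts f0; rewrite (big_rem t)//= ler_wpDr// sumr_ge0//.
Qed.

(** * The single big jump for deterministic coefficients *)

Section one_big_jump.
Context (R : realType) (a b : nat) (I : eqType).
Variables (J : seq I) (z : I -> 'M[R]_(a, b)) (nrm : I -> R).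
Variables (H rho : 'M[R]_(a, b) -> R) (M k kappa e K h delta x : R).
Hypothesis uniq_J : uniq J.
Hypothesis sem_rho : seminorm rho.
Hypothesis rho_le : forall y, rho y <= kappa * `|y|.
Hypothesis z_le : forall t, `|z t| <= k * nrm t.
Hypothesis H_le : forall y, `|H y| <= M.
Hypothesis hom_H : forall c v, 0 < c -> H (c *: v) = H v.
Hypotheses (x0 : 0 < x) (k0 : 0 < k) (h0 : 0 < h) (kappa0 : 0 < kappa)
  (delta0 : 0 <= delta) (e01 : 0 < e < 1).
Let n : R := (size J)%:R.
Hypothesis small_h : kappa * (n * (k * h)) <= e.
Hypothesis unif_H : forall y y', `|y| <= k * K -> 1 <= rho y ->
  `|y - y'| <= n * (k * h) -> `|H y - H y'| <= delta.

Let F y : R := H y * (x < rho y)%R%:R.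
Let pairs : R := \sum_(t <- J) \sum_(s <- J)
  (t != s)%:R * ((h * x < nrm t)%R%:R * (h * x < nrm s)%R%:R).
Let rest t : R := delta * (x < rho (z t))%R%:R
  + 2 * M * (((1 - e) * x < rho (z t))%R%:R - ((1 + e) * x < rho (z t))%R%:R)
  + 2 * M * (K * x < nrm t)%R%:R.

Let M0 : 0 <= M. Proof. exact: le_trans (H_le 0). Qed.

Let ind01 (c : bool) : 0 <= (c%:R : R) <= 1. Proof. by case: c; rewrite /= lexx ler01. Qed.

Let F_le y : `|F y| <= M.
Proof.
rewrite /F normrM normr_nat -[leRHS]mulr1 ler_pM//.
by have /andP[] := ind01 (x < rho y).
Qed.

Let rest_ge0 t : 0 <= rest t.
Proof.
have /andP[e0 e1] := e01.
have /andP[? _] := ind01 (x < rho (z t)); have /andP[? _] := ind01 (K * x < nrm t).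
have : ((1 + e) * x < rho (z t))%R%:R <= ((1 - e) * x < rho (z t))%R%:R :> R.
  rewrite ler_nat; case: (ltP ((1 + e) * x)) => // hl.
  by rewrite (lt_trans _ hl)// ltr_pM2r//; lra.
by move=> ?; rewrite /rest !addr_ge0// !mulr_ge0// subr_ge0.
Qed.

(** Below (1 - e) x both values of [F] are 0; above (1 + e) x both indicators are 1 and only [H]
    changes. In the shell between, or when [nrm t] exceeds K x, the trivial bound 2 M is charged to
    the corresponding summand of [rest t]. *)
Let perturb t y : `|z t - y| <= n * (k * h) * x -> `|F y - F (z t)| <= rest t.
Proof.
have /andP[e0 e1] := e01; move=> yz.
have F2 : `|F y - F (z t)| <= 2 * M.
  by have := ler_normB (F y) (F (z t)); have := F_le y; have := F_le (z t); lra.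
have rz : `|rho (z t) - rho y| <= e * x.
  rewrite (le_trans (seminorm_lip _ _ sem_rho))// (le_trans (rho_le _))//.
  apply: (@le_trans _ _ (kappa * (n * (k * h) * x))); first by rewrite ler_pM2l.
  by rewrite mulrA ler_pM2r.
have /andP[d0 _] := ind01 (x < rho (z t)).
have d1 : 0 <= delta * (x < rho (z t))%R%:R by rewrite mulr_ge0.
have bd : 0 <= (((1 - e) * x < rho (z t))%R%:R - ((1 + e) * x < rho (z t))%R%:R : R).
  rewrite subr_ge0 ler_nat; case: (ltP ((1 + e) * x)) => // hl.
  by rewrite (lt_trans _ hl)// ltr_pM2r//; lra.
have M2 : 0 <= 2 * M by rewrite mulr_ge0.
have [nK|nK] := ltP (K * x) (nrm t).
  rewrite /rest nK mulr1 (le_trans F2)// lerDr addr_ge0// mulr_ge0//.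
have bd2 := mulr_ge0 M2 bd.
have [r1|r1] := leP (rho (z t)) ((1 - e) * x).
  have rt : rho (z t) <= x by rewrite (le_trans r1)// ger_pMl//; lra.
  have ry : rho y <= x by move: rz; rewrite ler_norml; lra.
  by rewrite /F !ltNge rt ry !mulr0 subrr normr0 rest_ge0.
have [r2|r2] := leP (rho (z t)) ((1 + e) * x).
  rewrite /rest (ltNge ((1 + e) * x)) r2 r1 /= subr0 mulr1 (ltNge (K * x)) nK mulr0 addr0.
  by rewrite (le_trans F2)// lerDr.
have xt : x < rho (z t) by rewrite (lt_trans _ r2)// ltr_pMl//; lra.
have xy : x < rho y by move: rz; rewrite ler_norml; lra.
rewrite /rest xt /F xt xy !mulr1 r1 r2 subrr mulr0 addr0 (ltNge (K * x)) nK mulr0 addr0.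
(* Division by x leaves [H] unchanged and brings [z t] into the ball of radius k K, with rho >= 1,
   where [unif_H] applies. *)
have xi0 : 0 < x^-1 by rewrite invr_gt0.
rewrite -(hom_H y xi0) -(hom_H (z t) xi0) distrC; apply: unif_H.
- rewrite normrZ gtr0_norm// ler_pdivrMl// (le_trans (z_le t))// mulrCA.
  by rewrite ler_pM2l// mulrC.
- by rewrite (seminormZ_pos _ sem_rho (ltW xi0)) ler_pdivlMl// mulr1 ltW.
- by rewrite -scalerBr normrZ gtr0_norm// ler_pdivrMl// mulrC.
Qed.

(* Unless two of the terms are large ([pairs]), only one term z t is larger
   than h x, and the others perturb z t by at most n k h x; [rest t] pays for
   the modulus of continuity of H, for rho (z t) being close to the threshold,
   and for z t / x leaving the compact set where H is uniformly continuous. *)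
Lemma one_big_jump_bound :
  `|F (\sum_(t <- J) z t) - \sum_(t <- J) F (z t)| <= (n + 1) * M * pairs + \sum_(t <- J) rest t.
Proof.
have /andP[e0 e1] := e01.
have rest_sum : 0 <= \sum_(t <- J) rest t by rewrite sumr_ge0.
have pr0 t s : 0 <= (t != s)%:R * ((h * x < nrm t)%R%:R * (h * x < nrm s)%R%:R) :> R.
  by rewrite !mulr_ge0.
have pairs0 : 0 <= pairs by rewrite sumr_ge0// => t _; rewrite sumr_ge0.
have n0 : 0 <= n by rewrite ler0n.
have [[t [s [tJ sJ ts tb sb]]]|nob] := pselect (exists t s,
    [/\ t \in J, s \in J, t != s, h * x < nrm t & h * x < nrm s]).
  have p1 : 1 <= pairs.
    apply: (@le_trans _ _ (\sum_(s <- J) (t != s)%:R * ((h * x < nrm t)%R%:R * (h * x < nrm s)%R%:R))).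
      apply: le_trans (ler_sum_mem sJ _); first by rewrite ts tb sb !mulr1.
      by move=> i; exact: pr0.
    apply: (ler_sum_mem (f := fun t => \sum_(s <- J) (t != s)%:R * ((h * x < nrm t)%R%:R * (h * x < nrm s)%R%:R)) tJ).
    by move=> i; rewrite sumr_ge0.
  apply: (@le_trans _ _ ((n + 1) * M)); last first.
    by rewrite ler_wpDr// ler_peMr// mulr_ge0// addr_ge0.
  rewrite (le_trans (ler_normB _ _))// mulrDl mul1r addrC lerD//.
  rewrite (le_trans (ler_norm_sum _ _ _))//.
  rewrite (le_trans (ler_sum _ (fun i _ => F_le (z i))))//.
  by rewrite big_const_seq count_predT iter_addr_0 /n mulr_natl.
(* An empty family has no main term to single out; [F 0] vanishes since x > 0. *)
have [->|Jn] := eqVneq J [::].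
  have F0 : F 0 = 0 by rewrite /F (seminorm0 sem_rho) ltNge (ltW x0) mulr0.
  by rewrite !big_nil subr0 F0 normr0 addr0 !mulr_ge0// addr_ge0.
(* If no term is large, any index can play the part of the main term. *)
have [t tJ ht] : exists2 t, t \in J & forall s, s \in J -> s != t -> nrm s <= h * x.
  have [[t [tJ tb]]|nb] := pselect (exists t, t \in J /\ h * x < nrm t).
    exists t => // s sJ st; rewrite leNgt; apply/negP => sb; apply: nob.
    by exists t, s; split => //; rewrite eq_sym.
  case: J Jn nb => // t J' _ nb; exists t; first by rewrite mem_head.
  by move=> s sJ _; rewrite leNgt; apply/negP => sb; apply: nb; exists s.
have n1 : 1 <= n by rewrite /n ler1n lt0n size_eq0.
have zs s : s \in J -> s != t -> `|z s| <= k * h * x.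
  by move=> sJ st; rewrite (le_trans (z_le s))// -mulrA ler_pM2l// ht.
have Fs s : s \in J -> s != t -> F (z s) = 0.
  move=> sJ st; rewrite /F ltNge (_ : rho (z s) <= x) ?mulr0//.
  rewrite (le_trans (rho_le _))//; apply: (@le_trans _ _ (kappa * (k * h * x))).
    by rewrite ler_pM2l// zs.
  rewrite mulrA -[leRHS]mul1r ler_pM2r//.
  apply: le_trans (ltW e1); apply: le_trans small_h.
  by rewrite ler_pM2l// ler_peMl// mulr_ge0// ltW.
have S0 : \sum_(s <- J | s != t) F (z s) = 0.
  by rewrite big_seq_cond big1// => s /andP[]; exact: Fs.
rewrite [X in _ - X](bigD1_seq t)//= S0 addr0.
apply: le_trans (_ : rest t <= _); last first.
  rewrite ler_wpDl//; first by rewrite !mulr_ge0// addr_ge0.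
  exact: ler_sum_mem.
apply: perturb; rewrite (bigD1_seq t)//= opprD addrA subrr sub0r normrN.
rewrite (le_trans (ler_norm_sum _ _ _))// big_seq_cond.
apply: (@le_trans _ _ (\sum_(i <- J | (i \in J) && (i != t)) k * h * x)).
  by apply: ler_sum => s /andP[]; exact: zs.
rewrite -big_seq_cond big_const_seq iter_addr_0 -mulr_natl -mulrA.
rewrite -[leRHS]mulrA -[X in _ <= _ * X]mulrA.
apply: ler_wpM2r; first by rewrite !mulr_ge0// ltW.
by rewrite /n ler_nat count_size.
Qed.

End one_big_jump.

(** The left side is the asymptotic relative weight of the shell around the threshold x. It is small
    by continuity of the power at 1; the minimum with 1/2 in the choice of [e] keeps 1 - e away from
    0. *)
Lemma powR_neg_near1 (R : realType) (alpha theta : R) : 0 < alpha -> 0 < theta ->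
  exists2 e : R, 0 < e < 1 & (1 - e) `^ (- alpha) - (1 + e) `^ (- alpha) <= theta.
Proof.
move=> a0 t0.
have c1 : {for (1 : R), continuous (fun x : R => x `^ (- alpha))}.
  apply: differentiable_continuous; apply/derivable1_diffP.
  by apply: derivable_powR; rewrite in_itv /= ltr01.
have /continuous_atP/(_ (theta / 2)) := c1; rewrite divr_gt0// => /(_ isT)[d d0 hd].
pose e := Num.min (2^-1) (d / 2).
have e0 : 0 < e by rewrite lt_min invr_gt0 ltr0n divr_gt0.
have e1 : e <= 2^-1 by rewrite ge_min lexx.
have ed : e < d by rewrite (@le_lt_trans _ _ (d / 2))// ?ge_min ?lexx ?orbT//; lra.
exists e; first by rewrite e0 /=; lra.
have h1 : `|1 `^ (- alpha) - (1 - e) `^ (- alpha)| < theta / 2.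
  by apply: hd; rewrite opprB addrCA subrr addr0 gtr0_norm.
have h2 : `|1 `^ (- alpha) - (1 + e) `^ (- alpha)| < theta / 2.
  by apply: hd; rewrite opprD addrA subrr sub0r normrN gtr0_norm.
by move: h1 h2; rewrite !ltr_norml; lra.
Qed.

(** Turns a budget eps / 4 into a tolerance for a quantity multiplied by [c]; c + 1 replaces c
    because c may be 0. *)
Lemma quarter_bound (R : realType) (eps c : R) : 0 < eps -> 0 <= c ->
  eps / (4 * (c + 1)) * c <= eps / 4.
Proof.
move=> e0 c0; have c1 : 0 < c + 1 by lra.
have -> : eps / (4 * (c + 1)) * c = (eps / 4) * (c / (c + 1)) by field; lra.
by rewrite ler_piMr ?ler_pdivrMr//; lra.
Qed.

Section deterministic_sum.
Context (R : realType) (dT : measure_display) (T : measurableType dT)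
  (P : probability T R) (q : nat) (N : 'cV[R]_q -> R) (I : eqType) (o : I)
  (xi : I -> T -> 'cV[R]_q) (alpha : R) (dT' : measure_display)
  (T' : measurableType dT') (P' : probability T' R) (Th : T' -> 'cV[R]_q).
Hypothesis norm_N : is_norm N.
Hypothesis rv_xi : forall t, rv_family (fun w => mx_coords (xi t w)).
Hypothesis law_xi : forall t,
  same_law P (fun w => mx_coords (xi t w)) (fun w => mx_coords (xi o w)).
Hypothesis alpha_gt0 : 0 < alpha.
Hypothesis rv_tail : regvar_with P N (xi o) alpha P' Th.

Local Notation V := (tail P N (xi o)).

Hypothesis pair_tail : forall t s x, t != s ->
  Ex P (fun w => (x < N (xi t w))%R%:R * (x < N (xi s w))%R%:R) = V x * V x.

Let sN : seminorm N := is_norm_seminorm norm_N.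

Lemma same_law_off_kernel (G tau : 'cV[R]_q -> R) (M c : R) t : seminorm tau ->
  (forall v, 0 < tau v -> {for v, continuous G}) -> (forall v, `|G v| <= M) -> 0 <= c ->
  Ex P (fun w => G (xi t w) * (c < tau (xi t w))%R%:R) =
  Ex P (fun w => G (xi o w) * (c < tau (xi o w))%R%:R).
Proof.
move=> st cG hM c0.
pose mx (x : g_sigma_algebraType (@cyl_gen R ('I_q * 'I_1))) : 'cV[R]_q :=
  \matrix_(i, j) x (i, j).
have rmx : rv_family (fun x => mx_coords (mx x)).
  apply/rv_coord => i j; have := rv_family_eval (R := R) (i, j).
  by congr (measurable_fun _ _); apply/funext => x; rewrite mxE.
pose f x := G (mx x) * (c < tau (mx x))%R%:R.
have bf : bounded_rv f.
  split; first exact: (measurable_off_kernel rmx st cG c0).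
  exists M => x; rewrite /f normrM normr_nat -[leRHS]mulr1 ler_pM//.
  by case: (_ < _).
have mxK t' w : mx (mx_coords (xi t' w)) = xi t' w.
  by apply/matrixP => i j; rewrite mxE.
have := same_law_Ex (rv_xi t) (rv_xi o) (law_xi t) bf.
rewrite /f /comp; under eq_fun do rewrite mxK; move=> ->.
by under eq_fun do rewrite mxK.
Qed.

Lemma tail_same t x : 0 <= x -> tail P N (xi t) x = V x.
Proof.
move=> x0; have := @same_law_off_kernel (fun=> 1) N 1 x t sN.
rewrite /tail (_ : (fun w => 1 * _) = fun w => (x < N (xi t w))%R%:R); last first.
  by apply/funext => w; rewrite mul1r.
rewrite (_ : (fun w => 1 * _) = fun w => (x < N (xi o w))%R%:R); last first.
  by apply/funext => w; rewrite mul1r.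
by apply => //; [move=> v _; exact: cst_continuous|move=> v; rewrite normr1].
Qed.

(** The ratio of the tails at 2 x and at x tends to 2^-alpha < 1, so doubling x eventually shrinks
    the tail by a fixed factor r < 1; monotonicity fills in between the points 2^k x0. This makes
    the squared tail of [pair_tail] negligible against the tail. *)
Lemma tail_cvg0 : V x @[x --> +oo] --> 0.
Proof.
have u1 : 2 `^ (- alpha) < 1.
  by rewrite /powR pnatr_eq0 /= -[X in _ < X]expR0 ltr_expR mulNr oppr_lt0 mulr_gt0// ln_gt0// ltr1n.
have u0 : 0 < 2 `^ (- alpha) by rewrite powR_gt0.
pose r := (1 + 2 `^ (- alpha)) / 2.
have [r0 r1] : 0 < r /\ r < 1 by rewrite /r; lra.
have Vp x : 0 < V x by exact: (tail_gt0 norm_N (rv_xi o) rv_tail).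
have [x0 x00 hx0] : exists2 x0, 0 < x0 & forall x, x0 <= x -> V (2 * x) <= r * V x.
  have := tail_ratio norm_N (rv_xi o) rv_tail (ltr0n R 2).
  move=> /cvgrPdist_lt /(_ (r - 2 `^ (- alpha))).
  have -> : 0 < r - 2 `^ (- alpha) by rewrite /r; lra.
  move=> /(_ isT) [x1 [_ hx1]]; exists (1 + `|x1|); first by rewrite ltr_wpDr.
  move=> x xx; have /hx1 /= : x1 < x by have := ler_norm x1; lra.
  by rewrite ltr_norml => /andP[h _]; rewrite -ler_pdivrMr//; lra.
have key k : V (2 ^+ k * x0) <= r ^+ k.
  elim: k => [|k IH]; first by rewrite !expr0 mul1r (tail_le1 P norm_N (rv_xi o)).
  rewrite !exprS -mulrA (le_trans (hx0 _ _))//; last by rewrite ler_pM2l.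
  by rewrite ler_peMl ?(ltW x00)// exprn_ege1// ler1n.
apply/cvgrPdist_lt => e e0.
have [k hk] : exists k, e^-1 + 1 <= r^-1 ^+ k by apply: exprn_unbounded; rewrite invf_gt1.
near=> x; rewrite sub0r normrN gtr0_norm//.
apply: (@le_lt_trans _ _ (r ^+ k)).
  apply: le_trans (key k); apply: (tail_noninc P norm_N (rv_xi o)).
  by near: x; apply: nbhs_pinfty_ge; exact: num_real.
rewrite -[e]invrK -[r]invrK exprVn ltf_pV2 ?posrE ?exprn_gt0 ?invr_gt0//; lra.
Unshelve. all: by end_near. Qed.

Section linear_images.
Variables (a b : nat) (A : I -> {linear 'cV[R]_q -> 'M[R]_(a, b)}) (k : R).
Variables (H rho : 'M[R]_(a, b) -> R) (M : R).
Hypothesis k_gt0 : 0 < k.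
Hypothesis A_le : forall t v, `|A t v| <= k * N v.
Hypothesis sem_rho : seminorm rho.
Hypothesis cont_H : forall y, 0 < rho y -> {for y, continuous H}.
Hypothesis hom_H : forall c y, 0 < c -> H (c *: y) = H y.
Hypothesis H_le : forall y, `|H y| <= M.

Let M0 : 0 <= M. Proof. exact: le_trans (H_le 0). Qed.

Lemma linear_image_continuous t : continuous (A t).
Proof.
have [k' k'0 hk'] := seminorm_le_norm sN.
move=> v; apply/continuous_atP => e e0; exists (e / (k * k')).
  by rewrite divr_gt0 ?mulr_gt0.
move=> u; rewrite ltr_pdivlMr ?mulr_gt0// => h; rewrite -linearB.
apply: le_lt_trans h; rewrite (le_trans (A_le _ _))// mulrCA ler_pM2l// mulrC.
exact: hk'.
Qed.

Lemma seminorm_linear t : seminorm (fun v => rho (A t v)).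
Proof.
case: sem_rho => s1 s2; split=> [c v|u v]; first by rewrite linearZ s1.
by rewrite linearD s2.
Qed.

Lemma cont_linear t v : 0 < rho (A t v) -> {for v, continuous (H \o A t)}.
Proof.
move=> h; apply: continuous_comp; first exact: linear_image_continuous.
exact: cont_H.
Qed.

Lemma rv_linear_sum (J : seq I) :
  rv_family (fun w => mx_coords (\sum_(t <- J) A t (xi t w))).
Proof.
apply/rv_coord => i j; under eq_fun do rewrite summxE.
apply: measurable_sum => t.
apply: (measurable_continuous_comp (rv_xi t) (H := fun v => A t v i j)) => v.
apply: (@continuous_comp _ _ _ (A t) (fun B : 'M[R]_(a, b) => B i j)).
  exact: linear_image_continuous.
exact: coord_continuous.
Qed.

Let E (F : 'M[R]_(a, b) -> R) t := Ex P' (fun w => F (A t (Th w)) * rho (A t (Th w)) `^ alpha).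

Lemma linear_image_tail (G : 'M[R]_(a, b) -> R) (M' : R) t :
  (forall y, 0 < rho y -> {for y, continuous G}) ->
  (forall c y, 0 < c -> G (c *: y) = G y) -> (forall y, `|G y| <= M') ->
  Ex P (fun w => G (A t (xi t w)) * (x < rho (A t (xi t w)))%R%:R) / V x
    @[x --> +oo] --> E G t.
Proof.
move=> cG hG mG.
have cGA v : 0 < rho (A t v) -> {for v, continuous (G \o A t)}.
  move=> h; apply: continuous_comp; first exact: linear_image_continuous.
  exact: cG.
have hGA c v : 0 < c -> (G \o A t) (c *: v) = (G \o A t) v.
  by move=> c0; rewrite /= linearZ hG.
have mGA v : `|(G \o A t) v| <= M' by exact: mG.
have := single_term norm_N (rv_xi o) alpha_gt0 rv_tail (seminorm_linear t) cGA hGA mGA.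
have FF : Filter (pinfty_nbhs R) by exact: _.
apply: cvg_trans; apply: near_eq_cvg; near=> x.
have x0 : 0 <= x by near: x; exact: nbhs_pinfty_ge.
by rewrite -(same_law_off_kernel t (seminorm_linear t) cGA mGA x0).
Unshelve. all: by end_near. Qed.

Let m t := E (fun=> 1) t.

(** The limit at the argument c x, multiplied by the ratio of [V] at c x and at x. *)
Lemma linear_image_tailZ t c : 0 < c ->
  Ex P (fun w => (c * x < rho (A t (xi t w)))%R%:R) / V x
    @[x --> +oo] --> c `^ (- alpha) * m t.
Proof.
move=> c0.
have c1 y : 0 < rho y -> {for y, continuous (fun _ : 'M[R]_(a, b) => 1 : R)}.
  by move=> _; exact: cst_continuous.
have b1 (y : 'M[R]_(a, b)) : `|1| <= 1 :> R by rewrite normr1.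
have h := linear_image_tail (t := t) c1 (fun _ _ _ => erefl) b1.
have cy : c * x @[x --> +oo] --> +oo by apply: gt0_cvgMry => //; exact: cvg_id.
have h2 := cvg_comp _ _ cy h.
have h3 := tail_ratio norm_N (rv_xi o) rv_tail c0.
have FF : Filter (pinfty_nbhs R) by exact: _.
rewrite mulrC; have := cvgM h2 h3 => /(_ FF).
apply: cvg_trans; apply: near_eq_cvg; near=> x.
have V0 : V (c * x) != 0 by rewrite gt_eqF// (tail_gt0 norm_N (rv_xi o) rv_tail).
transitivity (Ex P (fun w => 1 * (c * x < rho (A t (xi t w)))%R%:R) / V (c * x) * (V (c * x) / V x)) => //.
rewrite mulrA divfK//; congr (Ex _ _ / _).
by apply/funext => w; rewrite mul1r.
Unshelve. all: by end_near. Qed.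

Lemma m_ge0 t : 0 <= m t.
Proof. by apply: Ex_ge0 => w; rewrite mul1r powR_ge0. Qed.

(** The single terms have the right limits, so it remains to show that the normalised difference
    between the sum and the single terms tends to 0. [one_big_jump_bound] is integrated and divided
    by [V x]; the parameters are fixed before x goes to infinity. *)
Lemma deterministic_sum (J : seq I) : uniq J ->
  Ex P (fun w => H (\sum_(t <- J) A t (xi t w)) *
     (x < rho (\sum_(t <- J) A t (xi t w)))%R%:R) / V x
    @[x --> +oo] --> \sum_(t <- J) E H t.
Proof.
move=> uJ; pose n : R := (size J)%:R; have n0 : 0 <= n by rewrite ler0n.
have [kappa kappa0 rho_le] := seminorm_le_norm sem_rho.
have Vp x : 0 < V x by exact: (tail_gt0 norm_N (rv_xi o) rv_tail).
pose S x := Ex P (fun w => H (\sum_(t <- J) A t (xi t w)) *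
     (x < rho (\sum_(t <- J) A t (xi t w)))%R%:R) / V x.
pose St t x := Ex P (fun w => H (A t (xi t w)) * (x < rho (A t (xi t w)))%R%:R) / V x.
have lS : (fun x => \sum_(t <- J) St t x) x @[x --> +oo] --> \sum_(t <- J) E H t.
  by apply: cvgr_sum => t; apply: linear_image_tail.
suff d0 : (S x - \sum_(t <- J) St t x) @[x --> +oo] --> 0.
  have FF : Filter (pinfty_nbhs R) by exact: _.
  rewrite -[X in _ --> X]add0r; have := cvgD d0 lS => /(_ FF).
  by apply: cvg_trans; apply: near_eq_cvg; apply: nearW => x; rewrite /= subrK.
apply/cvgrPdist_le => eps eps0.
pose mm := \sum_(t <- J) m t.
have mm0 : 0 <= mm by apply: sumr_ge0 => t _; exact: m_ge0.
have Mmm0 : 0 <= 2 * M * mm by rewrite !mulr_ge0.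
have Mn0 : 0 <= 2 * M * n by rewrite !mulr_ge0.
(* One quarter of eps each: [delta] for the modulus of continuity of H, [theta] for the shell around
   the threshold, [sg] for terms beyond K x. The last quarter absorbs the convergence of the bound
   [B] to its limit [D]. *)
have [delta dE] : exists d, d = eps / (4 * (mm + 1)) by eexists.
have [theta tE] : exists d, d = eps / (4 * (2 * M * mm + 1)) by eexists.
have [sg sgE] : exists d, d = eps / (4 * (2 * M * n + 1)) by eexists.
have delta0 : 0 < delta by rewrite dE divr_gt0//; lra.
have theta0 : 0 < theta by rewrite tE divr_gt0//; lra.
have sg0 : 0 < sg by rewrite sgE divr_gt0//; lra.
(* Chosen so that K^-alpha = sg, the limit of V (K x) / V x. *)
pose K := sg `^ (- alpha^-1).
have K0 : 0 < K by rewrite powR_gt0.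
have KE : K `^ (- alpha) = sg.
  by rewrite -powRrM mulrNN mulVf ?gt_eqF// powRr1// ltW.
have [e e01 he] := powR_neg_near1 alpha_gt0 theta0.
have /andP[e0 e1] := e01.
have [eta eta0 heta] := unif_cont_off_kernel sem_rho cont_H (k * K) ltr01 delta0.
(* At most n small terms, each of norm at most k h x, perturb the large one. The total n k h must
   stay below [eta] for H and, after multiplication by [kappa], below [e] for rho; n + 1 in the
   denominator covers n = 0. *)
pose h := Num.min eta (e / kappa) / ((n + 1) * k).
have min0 : 0 < Num.min eta (e / kappa) by rewrite lt_min eta0 divr_gt0.
have n1 : 0 < n + 1 by lra.
have h0 : 0 < h by rewrite divr_gt0// mulr_gt0.
have nkh : n * (k * h) <= Num.min eta (e / kappa).
  have -> : n * (k * h) = (n / (n + 1)) * Num.min eta (e / kappa).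
    by rewrite /h; field; rewrite !gt_eqF.
  by rewrite ger_pMl// ler_pdivrMr// mul1r lerDl.
have small_h : kappa * (n * (k * h)) <= e.
  by rewrite -ler_pdivlMl// [_^-1 * _]mulrC (le_trans nkh)// ge_min lexx orbT.
have unif_H y y' : `|y| <= k * K -> 1 <= rho y ->
    `|y - y'| <= n * (k * h) -> `|H y - H y'| <= delta.
  by move=> h1 h2 h3; apply: heta => //; rewrite (le_trans h3)// (le_trans nkh)// ge_min lexx.
(* The pair term V (h x)^2 / V x is written as (V (h x) / V x) * V (h x), which tends to h^-alpha *
   0. *)
pose B x := (n + 1) * M * (\sum_(t <- J) \sum_(s <- J) (t != s)%:R * (V (h * x) / V x * V (h * x)))
  + \sum_(t <- J) (delta * (Ex P (fun w => (1 * x < rho (A t (xi t w)))%R%:R) / V x)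
     + 2 * M * (Ex P (fun w => ((1 - e) * x < rho (A t (xi t w)))%R%:R) / V x -
                Ex P (fun w => ((1 + e) * x < rho (A t (xi t w)))%R%:R) / V x)
     + 2 * M * (V (K * x) / V x)).
pose D := \sum_(t <- J) (delta * m t
   + 2 * M * ((1 - e) `^ (- alpha) * m t - (1 + e) `^ (- alpha) * m t) + 2 * M * sg).
have Blim : B x @[x --> +oo] --> D.
  have -> : D = (n + 1) * M * (\sum_(t <- J) \sum_(s <- J) (t != s)%:R * (h `^ (- alpha) * 0)) + D.
    rewrite big1 ?mulr0 ?add0r// => t _; rewrite big1// => s _; by rewrite !mulr0.
  apply: cvgD.
    apply: cvgMr; apply: cvgr_sum => t; apply: cvgr_sum => s; apply: cvgMr.
    apply: cvgM; first exact: (tail_ratio norm_N (rv_xi o) rv_tail h0).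
    have hy : h * x @[x --> +oo] --> +oo by apply: gt0_cvgMry => //; exact: cvg_id.
    exact: cvg_comp _ _ hy tail_cvg0.
  apply: cvgr_sum => t; apply: cvgD; last first.
    by apply: cvgMr; rewrite -KE; exact: (tail_ratio norm_N (rv_xi o) rv_tail K0).
  apply: cvgD; apply: cvgMr.
    by have := linear_image_tailZ (t := t) (@ltr01 R); rewrite powR1 mul1r.
  apply: cvgB; apply: linear_image_tailZ; by [rewrite subr_gt0|rewrite addr_gt0].
have DE : D <= eps * (3 / 4).
  rewrite /D !big_split /= -!mulr_sumr -/mm sumrB -!mulr_sumr -/mm.
  rewrite big_const_seq count_predT iter_addr_0.
  have d1 : delta * mm <= eps / 4.
    by rewrite dE quarter_bound.
  have d2 : 2 * M * ((1 - e) `^ (- alpha) * mm - (1 + e) `^ (- alpha) * mm) <= eps / 4.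
    rewrite -mulrBl mulrCA; apply: (@le_trans _ _ (theta * (2 * M * mm))).
      by rewrite ler_wpM2r.
    by rewrite tE quarter_bound.
  have d3 : n * (2 * M * sg) <= eps / 4.
    have -> : n * (2 * M * sg) = sg * (2 * M * n) by ring.
    by rewrite sgE quarter_bound.
  have -> : eps * (3 / 4) = eps / 4 + eps / 4 + eps / 4 by field.
  apply: lerD; last by rewrite -[sg *+ _]mulr_natl -/n (_ : _ * (n * sg) = n * (2 * M * sg)) //; ring.
  by apply: lerD.
have SB x : 0 < x -> `|S x - \sum_(t <- J) St t x| <= B x.
  move=> x0.
  have bi t1 (c : R) : bounded_rv (fun w => (c < N (xi t1 w))%R%:R : R).
    by apply: bounded_rv_ltr; exact: (measurable_norm_rv norm_N (rv_xi t1)).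
  have br t1 (c : R) : bounded_rv (fun w => (c < rho (A t1 (xi t1 w)))%R%:R : R).
    apply: bounded_rv_ltr.
    exact: (measurable_continuous_comp (rv_xi t1) (seminorm_continuous (seminorm_linear t1))).
  have leM (y : 'M[R]_(a, b)) (c : bool) : `|H y * c%:R| <= M.
    by rewrite normrM normr_nat -[leRHS]mulr1 ler_pM//; case: c.
  have bFt t1 : bounded_rv (fun w => H (A t1 (xi t1 w)) * (x < rho (A t1 (xi t1 w)))%R%:R).
    split; last by exists M => w; exact: leM.
    exact: (measurable_off_kernel (rv_xi t1) (seminorm_linear t1) (@cont_linear t1) (ltW x0)).
  have bFY : bounded_rv (fun w => H (\sum_(t <- J) A t (xi t w)) *
     (x < rho (\sum_(t <- J) A t (xi t w)))%R%:R).
    split; last by exists M => w; exact: leM.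
    exact: (measurable_off_kernel (rv_linear_sum J) sem_rho cont_H (ltW x0)).
  have bpr t1 s1 : bounded_rv (fun w => (t1 != s1)%:R *
      ((h * x < N (xi t1 w))%R%:R * (h * x < N (xi s1 w))%R%:R) : R).
    by apply: bounded_rvZ; apply: bounded_rvM; exact: bi.
  have bsum2 : bounded_rv (fun w => \sum_(t <- J) \sum_(s <- J) (t != s)%:R *
      ((h * x < N (xi t w))%R%:R * (h * x < N (xi s w))%R%:R) : R).
    by do 2! apply: bounded_rv_sum => ?; exact: bpr.
  have brest t1 : bounded_rv (fun w => delta * (x < rho (A t1 (xi t1 w)))%R%:R
      + 2 * M * (((1 - e) * x < rho (A t1 (xi t1 w)))%R%:R -
                 ((1 + e) * x < rho (A t1 (xi t1 w)))%R%:R)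
      + 2 * M * (K * x < N (xi t1 w))%R%:R).
    apply: bounded_rvD; last by apply: bounded_rvZ; exact: bi.
    apply: bounded_rvD; apply: bounded_rvZ; first exact: br.
    by apply: bounded_rvB; exact: br.
  have pw w := one_big_jump_bound (J := J) (z := fun t => A t (xi t w))
    (nrm := fun t => N (xi t w)) uJ sem_rho rho_le (fun t => A_le t (xi t w))
    H_le hom_H x0 k_gt0 h0 kappa0 (ltW delta0) e01 small_h unif_H.
  rewrite /S /St -mulr_suml -mulrBl normrM [`|(V x)^-1|]gtr0_norm ?invr_gt0//.
  rewrite -Ex_sum// -ExB//; last exact: bounded_rv_sum.
  have bL := bounded_rvB bFY (bounded_rv_sum J bFt).
  have bR := bounded_rvD (bounded_rvZ ((n + 1) * M) bsum2) (bounded_rv_sum J brest).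
  have := le_trans (Ex_norm P bL) (Ex_le P (bounded_rv_norm bL) bR pw).
  rewrite -(ler_pM2r (x := (V x)^-1)) ?invr_gt0// => /le_trans; apply.
  rewrite le_eqVlt; apply/orP; left; apply/eqP.
  rewrite ExD; [|exact: bounded_rvZ|exact: bounded_rv_sum].
  rewrite mulrDl; congr (_ + _).
    rewrite ExZ// -[LHS]mulrA; congr (_ * _); rewrite Ex_sum; last first.
      by move=> t1; apply: bounded_rv_sum => s1; exact: bpr.
    rewrite mulr_suml; apply: eq_bigr => t1 _; rewrite Ex_sum; last by move=> s1; exact: bpr.
    rewrite mulr_suml; apply: eq_bigr => s1 _; rewrite ExZ; last by apply: bounded_rvM; exact: bi.
    have [->|ts] := eqVneq t1 s1; first by rewrite !mul0r.
    by rewrite pair_tail//; ring.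
  rewrite Ex_sum// mulr_suml; apply: eq_bigr => t1 _.
  have b1 := bounded_rvB (br t1 ((1 - e) * x)) (br t1 ((1 + e) * x)).
  have b2 := bounded_rvZ delta (br t1 x).
  rewrite ExD; [|exact: (bounded_rvD b2 (bounded_rvZ (2 * M) b1))|exact: (bounded_rvZ (2 * M) (bi t1 (K * x)))].
  rewrite ExD; [|exact: b2|exact: (bounded_rvZ (2 * M) b1)].
  rewrite (ExZ P _ (br t1 x)) (ExZ P _ b1) (ExZ P _ (bi t1 _)) (ExB P (br t1 _) (br t1 _)).
  rewrite -(@tail_same t1 (K * x)) ?mulr_ge0 ?ltW// /tail mul1r; ring.
have nB : \forall y \near +oo, `|D - B y| <= eps / 4.
  have /cvgrPdist_le h1 := Blim; apply: h1; by rewrite divr_gt0.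
have n0' : \forall y \near +oo, 0 < (y : R) by exact: nbhs_pinfty_gt.
apply: filterS2 n0' nB => y y0; rewrite sub0r normrN ler_norml => /andP[By _].
by apply: (le_trans (SB _ y0)); lra.
Qed.

End linear_images.
End deterministic_sum.

Section lin_cols.
Context (R : realType) (a b q : nat).
Variable B : 'I_b -> 'M[R]_(a, q).

(** A single innovation v enters every column of the window, column j through its own coefficient
    [B j]. The linear structure declared below makes this map an instance of the [A t] of the
    deterministic case. *)
Definition lin_cols (v : 'cV[R]_q) : 'M[R]_(a, b) := \matrix_(i, j) (B j *m v) i ord0.

Lemma lin_colsE v i j : lin_cols v i j = (B j *m v) i ord0.
Proof. by rewrite mxE. Qed.

Let lin_cols_linear : linear lin_cols.
Proof.
move=> c u v; apply/matrixP => i j; rewrite lin_colsE linearP /= mxE [in RHS]mxE [X in _ = X + _]mxE.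
by rewrite mxE !lin_colsE.
Qed.

HB.instance Definition _ := GRing.isLinear.Build R 'cV[R]_q 'M[R]_(a, b) *:%R
  lin_cols lin_cols_linear.

End lin_cols.

(** Lets a moment of order beta control the power alpha of the spectral terms. *)
Lemma powR_le1D (R : realType) (k alpha beta : R) : 0 <= k -> 0 < alpha < beta ->
  k `^ alpha <= 1 + k `^ beta.
Proof.
move=> k0 /andP[a0 ab]; have [k1|k1] := leP k 1.
  rewrite ler_wpDr ?powR_ge0//; rewrite [leRHS](_ : 1 = 1 `^ alpha); last by rewrite powR1.
  by apply: ge0_ler_powR; rewrite ?nnegrE ?ler01// ltW.
by rewrite ler_wpDl// ler_powR// ltW.
Qed.

(** * Random coefficients *)

Section random_sum.
Context (R : realType) (dT : measure_display) (T : measurableType dT)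
  (P : probability T R) (q a b : nat) (N : 'cV[R]_q -> R) (I : eqType) (o : I)
  (xi : I -> T -> 'cV[R]_q) (alpha beta : R) (dT' : measure_display)
  (T' : measurableType dT') (P' : probability T' R) (Th : T' -> 'cV[R]_q)
  (K : Type) (Cf : T -> K -> R) (B : I -> 'I_b -> T -> 'M[R]_(a, q)) (eB : T -> R)
  (J : seq I) (H rho : 'M[R]_(a, b) -> R) (M : R).
Hypothesis norm_N : is_norm N.
Hypothesis rv_xi : forall t, rv_family (fun w => mx_coords (xi t w)).
Hypothesis law_xi : forall t,
  same_law P (fun w => mx_coords (xi t w)) (fun w => mx_coords (xi o w)).
Hypothesis alpha_gt0 : 0 < alpha.
Hypothesis alpha_beta : alpha < beta.
Hypothesis rv_tail : regvar_with P N (xi o) alpha P' Th.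

Local Notation V := (tail P N (xi o)).

Hypothesis pair_tail : forall t s x, t != s ->
  Ex P (fun w => (x < N (xi t w))%R%:R * (x < N (xi s w))%R%:R) = V x * V x.

Let xif (w : T) (k : I * ('I_q * 'I_1)) : R := mx_coords (xi k.1 w) k.2.

Hypothesis indep_C : indep2 P (sigma_of Cf) (sigma_of xif).
Hypothesis rv_C : rv_family Cf.
Hypothesis rv_B : forall t j i l,
  measurable_fun [set: g_sigma_algebraType (sigma_gen Cf)] (fun w => B t j w i l).
Hypothesis measurable_eB : measurable_fun setT eB.
Hypothesis eB_ge0 : forall w, 0 <= eB w.
Hypothesis B_le : forall t w v, `|lin_cols (B t ^~ w) v| <= eB w * N v.
Hypothesis eB_moment : (\int[P]_w ((eB w) `^ beta)%:E < +oo)%E.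
Hypothesis uniq_J : uniq J.
Hypothesis sem_rho : seminorm rho.
Hypothesis cont_H : forall y, 0 < rho y -> {for y, continuous H}.
Hypothesis hom_H : forall c y, 0 < c -> H (c *: y) = H y.
Hypothesis H_le : forall y, `|H y| <= M.

Let M0 : 0 <= M. Proof. exact: le_trans (H_le 0). Qed.

Let sN : seminorm N := is_norm_seminorm norm_N.

Let A w t := lin_cols (B t ^~ w).

Let Y w1 w2 : 'M[R]_(a, b) := \sum_(t <- J) A w1 t (xi t w2).

Let F x y : R := H y * (x < rho y)%R%:R.

Let rv_xif : rv_family xif.
Proof. by move=> [t k]; exact: (rv_xi t). Qed.

Let F_le x y : `|F x y| <= M.
Proof. by rewrite /F normrM normr_nat -[leRHS]mulr1 ler_pM//; case: (_ < _). Qed.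

Lemma rv_sigma_gen (K0 : Type) (Z : T -> K0 -> R) k :
  measurable_fun [set: g_sigma_algebraType (sigma_gen Z)] (fun w => Z w k).
Proof.
move=> _ D mD; rewrite setTI; apply: sub_sigma_algebra; by exists k, D.
Qed.

Let bounded_F x : 0 <= x -> bounded_rv (fun z : g_sigma_algebraType (sigma_gen Cf) *
    g_sigma_algebraType (sigma_gen xif) => F x (Y z.1 z.2)).
Proof.
move=> x0; split; last by exists M => z; exact: F_le.
apply: (measurable_off_kernel _ sem_rho cont_H x0).
apply/rv_coord => i j; rewrite /Y.
rewrite (_ : (fun w => _) = fun z => \sum_(t <- J) \sum_(l < q) B t j z.1 i l * xif z.2 (t, (l, ord0))); last first.
  by apply/funext => z; rewrite summxE; apply: eq_bigr => t _; rewrite !mxE.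
apply: measurable_sum => t; apply: measurable_sum => l; apply: measurable_funM.
  exact: (measurableT_comp (rv_B t j i l) measurable_fst).
exact: (measurableT_comp (rv_sigma_gen (Z := xif) (t, (l, ord0))) measurable_snd).
Qed.

Let g x w1 : R := Ex P (fun w2 => F x (Y w1 w2)) / V x.

Let Vp x : 0 < V x. Proof. exact: (tail_gt0 norm_N (rv_xi o) rv_tail). Qed.

(** By independence the coefficients can be frozen at w1 while the innovations are integrated over
    w2; [g x w1] is the resulting conditional expectation divided by the tail. *)
Lemma random_sum_split x : 0 <= x ->
  bounded_rv (g x) /\ Ex P (fun w => F x (Y w w)) / V x = Ex P (g x).
Proof.
move=> x0; have [b1 e1] := indep_Ex rv_C rv_xif indep_C (bounded_F x0).
split; first by apply: bounded_rvM => //; exact: bounded_rv_cst.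
rewrite [X in X / _]e1 /g; under [in RHS]eq_fun do rewrite mulrC.
by rewrite ExZ// mulrC.
Qed.

Lemma random_sum_pointwise w1 : g x w1 @[x --> +oo] -->
  \sum_(t <- J) Ex P' (fun w => H (A w1 t (Th w)) * rho (A w1 t (Th w)) `^ alpha).
Proof.
(* The deterministic result asks for a positive constant, while [eB w1] may be 0. *)
have k0 : 0 < 1 + eB w1 by rewrite ltr_wpDr.
have Ak t v : `|A w1 t v| <= (1 + eB w1) * N v.
  by rewrite (le_trans (B_le _ _ _))// ler_wpM2r ?seminorm_ge0// lerDr.
exact: (deterministic_sum norm_N rv_xi law_xi alpha_gt0 rv_tail pair_tail
  k0 Ak sem_rho cont_H hom_H H_le uniq_J).
Qed.

(** If rho of the sum exceeds x, one of the n terms satisfies x < n * kappa * eB * N(xi t). The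
    union bound and Potter's bound with a = n * kappa * eB give a multiple of 1 + eB^beta, uniformly
    for x >= x0. *)
Lemma random_sum_dominated : exists2 D : R, 0 <= D & exists2 x0 : R, 0 < x0 &
  forall x w, x0 <= x -> `|g x w| <= D * (1 + (eB w) `^ beta).
Proof.
have [kappa kappa0 rho_le] := seminorm_le_norm sem_rho.
have [C [x0 [C0 x00 hC]]] := potter norm_N (rv_xi o) alpha_gt0 rv_tail alpha_beta.
pose n : R := (size J)%:R.
have b0 : 0 < beta by exact: lt_trans alpha_beta.
have nk0 : 0 <= n * kappa by rewrite mulr_ge0 ?ler0n// ltW.
exists (M * (n * (C * (1 + (n * kappa) `^ beta)))).
  by rewrite !mulr_ge0 ?ler0n ?addr_ge0 ?powR_ge0// ltW.
exists x0 => // x w xx; have xp : 0 < x by exact: lt_le_trans xx.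
have ind t : bounded_rv (fun w2 => (x < n * kappa * eB w * N (xi t w2))%R%:R : R).
  apply: bounded_rv_ltr; apply: measurable_funM => //.
  exact: (measurable_norm_rv norm_N (rv_xi t)).
have bY : bounded_rv (fun w2 => F x (Y w w2)).
  split; last by exists M => w2; exact: F_le.
  apply: (measurable_off_kernel _ sem_rho cont_H (ltW xp)).
  apply: (rv_linear_sum norm_N rv_xi (k := 1 + eB w) (A := A w)); first by rewrite ltr_wpDr.
  by move=> t v; rewrite (le_trans (B_le _ _ _))// ler_wpM2r ?seminorm_ge0// lerDr.
have pw w2 : `|F x (Y w w2)| <= M * \sum_(t <- J) (x < n * kappa * eB w * N (xi t w2))%R%:R.
  have s0 : 0 <= \sum_(t <- J) (x < n * kappa * eB w * N (xi t w2))%R%:R :> R.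
    by apply: sumr_ge0.
  have [xr|xr] := ltP x (rho (Y w w2)); last by rewrite /F ltNge xr mulr0 normr0 mulr_ge0.
  have [[t tJ ht]|no] := pselect (exists2 t, t \in J & x < n * kappa * eB w * N (xi t w2)).
    rewrite (le_trans (F_le _ _))// ler_peMr//.
    apply: le_trans (ler_sum_mem (f := fun t => (x < n * kappa * eB w * N (xi t w2))%R%:R) tJ _) => //.
    by rewrite ht.
  exfalso; move: xr; rewrite ltNge => /negP; apply.
  rewrite (le_trans (seminorm_sum _ _ sem_rho))//.
  have [Jn|Jn] := eqVneq (size J) 0%N.
    by move/size0nil : Jn => ->; rewrite big_nil ltW.
  have np : 0 < n by rewrite /n ltr0n lt0n.
  apply: (@le_trans _ _ (\sum_(t <- J) x / n)).
    rewrite big_seq [leRHS]big_seq; apply: ler_sum => t tJ.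
    rewrite (le_trans (rho_le _))// ler_pdivlMr//.
    apply: (@le_trans _ _ (n * kappa * eB w * N (xi t w2))).
      by rewrite mulrC -!mulrA ler_pM2l// ler_pM2l// B_le.
    by rewrite leNgt; apply/negP => h; apply: no; exists t.
  by rewrite big_const_seq count_predT iter_addr_0 -[leLHS]mulr_natr divfK// gt_eqF.
have bS : bounded_rv (fun w2 => M * \sum_(t <- J) (x < n * kappa * eB w * N (xi t w2))%R%:R : R).
  by apply: bounded_rvZ; exact: bounded_rv_sum.
rewrite /g normrM [`|(V x)^-1|]gtr0_norm ?invr_gt0// ler_pdivrMr//.
have := le_trans (Ex_norm P bY) (Ex_le P (bounded_rv_norm bY) bS pw).
move/le_trans; apply; rewrite ExZ//; last exact: bounded_rv_sum.
rewrite (_ : M * _ * _ * V x = M * (n * (C * (1 + (n * kappa) `^ beta) * (1 + eB w `^ beta) * V x))); last by rewrite !mulrA.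
apply: ler_wpM2l => //; rewrite Ex_sum//.
apply: (@le_trans _ _ (\sum_(t <- J) C * (1 + (n * kappa) `^ beta) * (1 + eB w `^ beta) * V x)); last first.
  by rewrite big_const_seq count_predT iter_addr_0 -mulr_natl -/n !mulrA.
apply: ler_sum => t _.
have c1 v : 0 < N v -> {for v, continuous (fun _ : 'cV[R]_q => 1 : R)}.
  by move=> _; exact: cst_continuous.
have c0 : 0 <= n * kappa * eB w by rewrite mulr_ge0.
have lawE : Ex P (fun w2 => (x < n * kappa * eB w * N (xi t w2))%R%:R) =
            Ex P (fun w2 => (x < n * kappa * eB w * N (xi o w2))%R%:R).
  have [cz|cz] := eqVneq (n * kappa * eB w) 0.
    by congr Ex; apply/funext => w2; rewrite cz !mul0r.
  have cp : 0 < n * kappa * eB w by rewrite lt0r cz.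
  rewrite (tail_ltrZ P N (xi t))// (tail_ltrZ P N (xi o))//.
  by apply: (tail_same norm_N rv_xi law_xi); rewrite divr_ge0// ltW.
rewrite lawE; apply: (le_trans (hC x _ xx c0)).
apply: ler_wpM2r; first exact: ltW.
rewrite -[leRHS]mulrA; apply: ler_wpM2l; first exact: ltW.
rewrite powRM//.
have := powR_ge0 (n * kappa) beta; have := powR_ge0 (eB w) beta; nra.
Qed.

Lemma integrable_moment (D : R) : P.-integrable setT (fun w => (D * (1 + (eB w) `^ beta))%:E).
Proof.
have i1 : P.-integrable setT (fun w => ((eB w) `^ beta)%:E).
  apply/integrableP; split.
    apply/measurable_EFinP; exact: (measurableT_comp (measurable_powR beta)).
  by under eq_integral do rewrite gee0_abs ?lee_fin ?powR_ge0//.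
have i2 : P.-integrable setT (fun w : T => (1 : R)%:E).
  exact: (bounded_rv_integrable P (bounded_rv_cst _ 1)).
have := integrableZl measurableT D (integrableD measurableT i2 i1).
by congr (integrable _ _ _).
Qed.

(** Dominated convergence along an arbitrary sequence u n going to infinity. The argument is
    replaced by max x0 (u n), so that the domination holds for every n and not merely eventually. *)
Lemma random_sum_cvg :
  Ex P (fun w => F x (Y w w)) / V x @[x --> +oo] -->
  Ex P (fun w1 => \sum_(t <- J) Ex P' (fun w => H (A w1 t (Th w)) * rho (A w1 t (Th w)) `^ alpha)).
Proof.
have [D D0 [x0 x00 hD]] := random_sum_dominated.
pose L w1 := \sum_(t <- J) Ex P' (fun w => H (A w1 t (Th w)) * rho (A w1 t (Th w)) `^ alpha).
rewrite -/L.
have mp (y : R) : 0 <= Num.max x0 y by rewrite le_max (ltW x00).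
pose G w := (D * (1 + (eB w) `^ beta))%:E.
have hm (u : R^nat) n : measurable_fun setT (fun w => (g (Num.max x0 (u n)) w)%:E).
  by apply/measurable_EFinP; have [[]] := random_sum_split (mp (u n)).
have hc (u : R^nat) : u n @[n --> \oo] --> +oo ->
    forall w, setT w -> (g (Num.max x0 (u n)) w)%:E @[n --> \oo] --> (L w)%:E.
  move=> uoo w _; apply/cvg_EFin; first by apply: nearW.
  have h : Num.max x0 (u n) @[n --> \oo] --> +oo.
    apply/cvgryPge => c; move/cvgryPge : uoo => /(_ c).
    by apply: filterS => n; rewrite le_max => ->; rewrite orbT.
  rewrite (_ : fine \o _ = (fun x => g x w) \o (fun n => Num.max x0 (u n)))//.
  exact: (cvg_comp (fun n => Num.max x0 (u n)) (fun x => g x w) h (random_sum_pointwise (w1 := w))).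
have hb (u : R^nat) n w : setT w -> (`|(g (Num.max x0 (u n)) w)%:E| <= G w)%E.
  by move=> _; rewrite abse_EFin lee_fin; apply: hD; rewrite le_max lexx.
have G_fin w : setT w -> G w \is a fin_num by [].
have iG : P.-integrable setT G by exact: integrable_moment.
have iL : P.-integrable setT (EFin \o L).
  pose u n : R := n%:R.
  have uoo : u n @[n --> \oo] --> +oo by exact: cvgr_idn.
  have mL : measurable_fun setT (EFin \o L) := emeasurable_fun_cvg _ _ (hm u) (hc u uoo).
  have [] // := dominated_convergence measurableT (hm u) mL (aeW P (hc u uoo)) iG _.
  by apply: aeW => w n; exact: (hb u).
have h0 : Ex P (g (Num.max x0 x)) @[x --> +oo] --> Ex P L.
  apply/cvg_pinftyP => u uoo.
  have dc := dominated_cvg measurableT (hm u) (hc u uoo) G_fin iG (hb u).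
  apply: fine_cvg; rewrite fineK//.
  exact: integrable_fin_num.
have FF : Filter (pinfty_nbhs R) by exact: _.
apply: cvg_trans h0; apply: near_eq_cvg; near=> x.
have xx : x0 <= x by near: x; apply: nbhs_pinfty_ge; exact: num_real.
rewrite (max_idPr xx).
have [_ ->] := random_sum_split (le_trans (ltW x00) xx) => //.
Unshelve. all: by end_near. Qed.

Let Phi t w1 w2 := H (A w1 t (Th w2)) * rho (A w1 t (Th w2)) `^ alpha.

Let rv_Th : rv_family (fun w => mx_coords (Th w)). Proof. by case: rv_tail. Qed.

Let N_Th w : N (Th w) = 1. Proof. by case: rv_tail => _ ->. Qed.

(** Since N(Th) = 1, rho of the image is at most kappa * eB, and its power alpha is at most 1 +
    (kappa * eB)^beta, integrable by the moment condition. *)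
Lemma integrable_spectral t :
  (P \x P')%E.-integrable setT (fun z => (Phi t z.1 z.2)%:E).
Proof.
have [kappa kappa0 rho_le] := seminorm_le_norm sem_rho.
have rvZ : rv_family (fun z : T * T' => mx_coords (A z.1 t (Th z.2))).
  apply/rv_coord => i j.
  rewrite (_ : (fun w => _) = fun z => \sum_(l < q) B t j z.1 i l * Th z.2 l ord0); last first.
    by apply/funext => z; rewrite !mxE.
  apply: measurable_sum => l; apply: measurable_funM; last first.
    by move/rv_coord : rv_Th => h; exact: (measurableT_comp (h l ord0) measurable_snd).
  have h : measurable_fun [set: T] (fun w => B t j w i l).
    exact: (measurableT_comp (rv_B t j i l) (measurable_id_sigma_gen rv_C)).
  exact: (measurableT_comp h measurable_fst).
have mPhi : measurable_fun setT (fun z : T * T' => Phi t z.1 z.2).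
  rewrite (_ : (fun w => _) = fun z : T * T' =>
      (H (A z.1 t (Th z.2)) * (0 < rho (A z.1 t (Th z.2)))%R%:R) * rho (A z.1 t (Th z.2)) `^ alpha); last first.
    apply/funext => z; rewrite /Phi; have := seminorm_ge0 (A z.1 t (Th z.2)) sem_rho; rewrite le_eqVlt.
    by case: eqP => [<- _|_ /= ->]; rewrite ?mulr1// powR0 ?gt_eqF// !mulr0.
  apply: measurable_funM; first exact: (measurable_off_kernel rvZ sem_rho).
  apply: (measurableT_comp (measurable_powR alpha)).
  exact: (measurable_continuous_comp rvZ (seminorm_continuous sem_rho)).
pose D := M * (1 + kappa `^ beta).
have D0 : 0 <= D by rewrite mulr_ge0// addr_ge0// powR_ge0.
have b0 : 0 < beta by exact: lt_trans alpha_beta.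
have iG : (P \x P')%E.-integrable setT (fun z : T * T' => (D * (1 + (eB z.1) `^ beta))%:E).
  apply/integrable12ltyP.
    apply/measurable_EFinP; apply: measurable_funM => //; apply: measurable_funD => //.
    apply: (measurableT_comp (measurable_powR beta)).
    exact: (measurableT_comp measurable_eB measurable_fst).
  have /integrableP[_] := integrable_moment D; apply: le_lt_trans.
  rewrite le_eqVlt; apply/orP; left; apply/eqP; apply: eq_integral => w _ /=.
  by rewrite integral_cst// [X in (_ * X)%E]probability_setT mule1.
apply: (le_integrable measurableT _ _ iG); first exact/measurable_EFinP.
move=> z _; rewrite !abse_EFin lee_fin /Phi normrM.
rewrite [leRHS]ger0_norm ?mulr_ge0 ?addr_ge0 ?powR_ge0// /D -mulrA ler_pM//.
rewrite ger0_norm ?powR_ge0//.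
have r1 : rho (A z.1 t (Th z.2)) <= kappa * eB z.1.
  rewrite (le_trans (rho_le _))// ler_pM2l// (le_trans (B_le _ _ _))//.
  by rewrite N_Th mulr1.
have ke : 0 <= kappa * eB z.1 by rewrite mulr_ge0// ltW.
apply: (@le_trans _ _ ((kappa * eB z.1) `^ alpha)).
  by apply: ge0_ler_powR; rewrite ?nnegrE ?seminorm_ge0// ltW.
apply: (le_trans (powR_le1D ke (_ : 0 < alpha < beta))); first by rewrite alpha_gt0.
rewrite powRM ?(ltW kappa0)//.
have := powR_ge0 kappa beta; have := powR_ge0 (eB z.1) beta; nra.
Qed.

(** Fubini turns the expectation over the coefficients of expectations over [Th] into one integral
    over the product space, where [Th] and the coefficients are independent by construction. *)
Theorem random_sum_limit :
  Ex P (fun w => H (\sum_(t <- J) lin_cols (B t ^~ w) (xi t w)) *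
      (x < rho (\sum_(t <- J) lin_cols (B t ^~ w) (xi t w)))%R%:R) / V x
    @[x --> +oo] -->
  \sum_(t <- J) \int[(P \x P')%E]_(z in setT)
    (H (lin_cols (B t ^~ z.1) (Th z.2)) * rho (lin_cols (B t ^~ z.1) (Th z.2)) `^ alpha).
Proof.
have := random_sum_cvg.
have bin t w1 : bounded_rv (fun w2 => Phi t w1 w2).
  have k0 : 0 < 1 + eB w1 by rewrite ltr_wpDr.
  have Ak t' v : `|A w1 t' v| <= (1 + eB w1) * N v.
    by rewrite (le_trans (B_le _ _ _))// ler_wpM2r ?seminorm_ge0// lerDr.
  apply: (bounded_powR_off_kernel norm_N alpha_gt0 rv_tail
    (seminorm_linear (A w1) sem_rho t)
    (cont_linear norm_N k0 Ak cont_H (t := t)) (M := M)).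
  by move=> v; exact: H_le.
have iin t : P.-integrable setT (fun w1 => (Ex P' (Phi t w1))%:E).
  have := integrable_fubini_F (integrable_spectral t).
  by congr (integrable _ _ _); apply/funext => w1; rewrite /fubini_F Ex_fin.
have e1 t : Ex P (fun w1 => Ex P' (Phi t w1)) = \int[(P \x P')%E]_(z in setT) Phi t z.1 z.2.
  rewrite /Ex /Rintegral -(integral12_prod_meas1 (integrable_spectral t)).
  congr fine; apply: eq_integral => w1 _; rewrite /fubini_F -Ex_fin//.
rewrite (_ : Ex P _ = \sum_(t <- J) \int[(P \x P')%E]_(z in setT) Phi t z.1 z.2) //.
under eq_bigr do rewrite -e1.
elim: (J) => [|t J' IH].
  by rewrite big_nil (_ : (fun w1 => _) = fun=> 0) ?Ex_cst//; apply/funext => w1; rewrite big_nil.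
rewrite big_cons -IH (_ : (fun w1 => _) = fun w1 => Ex P' (Phi t w1) +
   \sum_(t <- J') Ex P' (Phi t w1)); last by apply/funext => w1; rewrite big_cons.
rewrite /Ex RintegralD//; first exact: iin.
rewrite (_ : _ \o _ = fun w1 => (\sum_(t <- J') (Ex P' (Phi t w1))%:E)%E); last first.
  by apply/funext => w1; rewrite sumEFin.
exact: integrable_sum.
Qed.

End random_sum.

(** * Finite sums, powers and comparison of integrals *)

Lemma sum_uniq_support (V : nmodType) (I : eqType) (J S : seq I) (f : I -> V) :
  uniq J -> uniq S -> {subset S <= J} -> (forall t, t \notin S -> f t = 0) ->
  \sum_(t <- J) f t = \sum_(t <- S) f t.
Proof.
move=> uJ uS SJ f0.
rewrite (bigID (mem S))/= [X in _ + X]big1 ?addr0; last by move=> t; exact: f0.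
rewrite -big_filter; apply: perm_big; apply: uniq_perm => //; first exact: filter_uniq.
by move=> t; rewrite mem_filter andb_idr//; exact: SJ.
Qed.

(** Goes through a number m that bounds every term: the sum is at most size * m, and m^beta is at
    most the sum of the powers. *)
Lemma powR_sum_le (R : realType) (I : Type) (s : seq I) (x : I -> R) (beta : R) :
  0 < beta -> (forall i, 0 <= x i) ->
  (\sum_(i <- s) x i) `^ beta <= (size s)%:R `^ beta * \sum_(i <- s) x i `^ beta.
Proof.
move=> b0 x0.
have [m [m0 m1 m2]] : exists m : R, [/\ 0 <= m,
    \sum_(i <- s) x i <= (size s)%:R * m & m `^ beta <= \sum_(i <- s) x i `^ beta].
  elim: s => [|i s [m [m0 m1 m2]]].
    by exists 0; rewrite !big_nil mulr0 powR0 ?gt_eqF.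
  exists (Num.max m (x i)); split; first by rewrite le_max m0.
    rewrite big_cons /= -natr1 mulrDl mul1r addrC lerD ?le_max ?lexx ?orbT//.
    by rewrite (le_trans m1)// ler_wpM2l// le_max lexx.
  rewrite big_cons; have [mx|mx] := leP m (x i).
    by rewrite lerDl sumr_ge0// => j _; exact: powR_ge0.
  by rewrite (le_trans m2)// lerDr powR_ge0.
have s0 : 0 <= \sum_(i <- s) x i by rewrite sumr_ge0.
apply: (@le_trans _ _ (((size s)%:R * m) `^ beta)).
  by apply: ge0_ler_powR; rewrite ?nnegrE ?mulr_ge0// ltW.
by rewrite powRM// ler_wpM2l// powR_ge0.
Qed.

(** The integral of a nonnegative function is a supremum over the simple functions below it, hence
    monotone for arbitrary functions. It is applied to powers of [opnorm], a supremum whose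
    measurability is not established here. *)
Lemma ge0_le_integral_nonmeasurable (R : realType) (dT : measure_display)
    (T : measurableType dT) (P : {measure set T -> \bar R}) (f g : T -> \bar R) :
  (forall x, 0 <= f x)%E -> (forall x, f x <= g x)%E ->
  (\int[P]_x f x <= \int[P]_x g x)%E.
Proof.
move=> f0 fg; have g0 x : (0 <= g x)%E by exact: le_trans (fg x).
rewrite !ge0_integralTE//; apply: ereal_sup_le => _ [h hf <-].
exists h => // x; exact: le_trans (fg x).
Qed.

(** * The operator norm and the maximum of column norms *)

Section operator_norm.
Context (R : realType) (d q : nat) (Nq : 'cV[R]_q -> R) (Nd : 'cV[R]_d -> R).
Hypotheses (norm_q : is_norm Nq) (norm_d : is_norm Nd).

Lemma mulmx_norm_le (A : 'M[R]_(d, q)) (v : 'cV[R]_q) :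
  `|A *m v| <= q%:R * `|A| * `|v|.
Proof.
apply: mxnorm_le => [|i j]; first by rewrite !mulr_ge0.
rewrite mxE (le_trans (ler_norm_sum _ _ _))//.
apply: (@le_trans _ _ (\sum_(l < q) `|A| * `|v|)).
  by apply: ler_sum => l _; rewrite normrM ler_pM// ler_coord_norm.
by rewrite sumr_const card_ord -[leLHS]mulr_natl mulrA.
Qed.

Lemma ler_opnorm (A : 'M[R]_(d, q)) (v : 'cV[R]_q) :
  Nq v <= 1 -> Nd (A *m v) <= opnorm Nq Nd A.
Proof.
move=> v1; apply: ub_le_sup; last by exists v.
have [k1 k10 h1] := seminorm_le_norm (is_norm_seminorm norm_d).
have [k2 k20 h2] := norm_equiv norm_q.
exists (k1 * (q%:R * `|A| * k2)) => _ [u /= u1 <-].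
rewrite (le_trans (h1 _))// ler_pM2l// (le_trans (mulmx_norm_le _ _))//.
rewrite ler_wpM2l ?mulr_ge0// (le_trans (h2 _))// ger_pMr//.
Qed.

(** Each entry of A is a coordinate of A applied to a basis vector, which is rescaled to Nq-norm 1
    before [opnorm] is used. The summand 1 keeps the constant positive when q = 0. *)
Lemma norm_le_opnorm : exists2 k : R, 0 < k & forall A, `|A| <= k * opnorm Nq Nd A.
Proof.
have sq := is_norm_seminorm norm_q; have sd := is_norm_seminorm norm_d.
have [kn kn0 hn] := norm_equiv norm_d.
exists (1 + kn * \sum_(j < q) Nq (delta_mx j ord0)).
  by rewrite ltr_wpDr// mulr_ge0 ?(ltW kn0)// sumr_ge0// => j _; exact: seminorm_ge0.
move=> A; have op0 : 0 <= opnorm Nq Nd A.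
  have := @ler_opnorm A 0; rewrite mulmx0 !seminorm0// => h; exact: (h ler01).
apply: mxnorm_le => [|i j].
  by rewrite mulr_ge0// addr_ge0// mulr_ge0 ?(ltW kn0)// sumr_ge0// => l _; exact: seminorm_ge0.
have Nj0 : 0 < Nq (delta_mx j ord0).
  rewrite lt0r seminorm_ge0// andbT; apply/eqP => e0.
  have : delta_mx j ord0 = 0 :> 'cV[R]_q by case: norm_q => + _ _; apply.
  move=> /matrixP/(_ j ord0); rewrite !mxE !eqxx => /eqP; by rewrite oner_eq0.
have -> : A i j = (A *m (delta_mx j ord0 : 'cV[R]_q)) i ord0.
  rewrite mxE (bigD1 j)//= mxE !eqxx mulr1 big1 ?addr0// => l lj.
  by rewrite mxE (negbTE lj) mulr0.
rewrite (le_trans (ler_coord_norm _ _ _))// (le_trans (hn _))//.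
have -> : delta_mx j ord0 = Nq (delta_mx j ord0) *: ((Nq (delta_mx j ord0))^-1 *: delta_mx j ord0) :> 'cV[R]_q.
  by rewrite scalerA mulfV ?gt_eqF// scale1r.
rewrite -scalemxAr seminormZ_pos ?(ltW Nj0)//.
have h := @ler_opnorm A ((Nq (delta_mx j ord0))^-1 *: delta_mx j ord0).
have {}h : Nd (A *m ((Nq (delta_mx j ord0))^-1 *: delta_mx j ord0)) <= opnorm Nq Nd A.
  by apply: h; rewrite seminormZ_pos ?invr_ge0 ?(ltW Nj0)// mulVf ?gt_eqF.
apply: (@le_trans _ _ (kn * Nq (delta_mx j ord0) * opnorm Nq Nd A)).
  by rewrite -mulrA ler_pM2l// ler_pM2l.
rewrite ler_wpM2r// ler_wpDl// ler_pM2l// (bigD1 j)//= lerDl sumr_ge0// => l _.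
exact: seminorm_ge0.
Qed.

End operator_norm.

Section column_max.
Context (R : realType) (d k : nat) (Nd : 'cV[R]_d -> R).
Hypothesis norm_d : is_norm Nd.
Let sd : seminorm Nd := is_norm_seminorm norm_d.

Lemma seminorm_col (j : 'I_k) : seminorm (fun y : 'M[R]_(d, k) => Nd (col j y)).
Proof.
split=> [c v|u v].
  by rewrite -(proj1 sd); congr Nd; apply/matrixP => i l; rewrite !mxE.
rewrite (le_trans _ (proj2 sd _ _))// le_eqVlt; apply/orP; left; apply/eqP.
by congr Nd; apply/matrixP => i l; rewrite !mxE.
Qed.

Lemma seminorm_colmax : seminorm (colmax_norm (k := k) Nd).
Proof.
split=> [c v|u v]; rewrite /colmax_norm.
  have h : (fun j : 'I_k => Nd (col j (c *: v))) =1 (fun j => `|c| * Nd (col j v)).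
    by move=> j; exact: (proj1 (seminorm_col j)).
  under eq_bigr do rewrite h.
  elim/big_ind2 : _ => [|x1 x2 y1 y2 -> ->|//]; first by rewrite mulr0.
  by rewrite maxr_pMr.
apply/bigmax_leP; split=> [|j _].
  by rewrite addr_ge0//; apply: bigmax_ge_id.
rewrite (le_trans (proj2 (seminorm_col j) u v))// lerD//.
  exact: (le_bigmax _ (fun j => Nd (col j u)) j).
exact: (le_bigmax _ (fun j => Nd (col j v)) j).
Qed.

Lemma ler_colmax (y : 'M[R]_(d, k)) j : Nd (col j y) <= colmax_norm Nd y.
Proof. exact: (le_bigmax _ (fun j => Nd (col j y)) j). Qed.

End column_max.

(** * Images of measures with a density *)

Section density.
Context (R : realType) (d1 d2 : measure_display) (U : measurableType d1)
  (S : measurableType d2) (mu : {measure set U -> \bar R}).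
Variables (f : U -> S) (h : U -> R).
Hypotheses (mf : measurable_fun setT f) (mh : measurable_fun setT h)
  (h0 : forall z, 0 <= h z).

(** The image under [f] of the measure with density [h] with respect to [mu]. *)
Definition push_density (B : set S) : \bar R := (\int[mu]_(z in f @^-1` B) (h z)%:E)%E.

Let mpre B : measurable B -> measurable (f @^-1` B).
Proof. by move=> mB; rewrite -[X in measurable X]setTI; exact: mf. Qed.

Let push_density0 : push_density set0 = 0%E.
Proof. by rewrite /push_density preimage_set0 integral_set0. Qed.

Let push_density_ge0 B : (0 <= push_density B)%E.
Proof. by apply: integral_ge0 => z _; rewrite lee_fin. Qed.

Let push_density_sigma_additive : semi_sigma_additive push_density.
Proof.
move=> F mF tF mUF; rewrite /push_density preimage_bigcup.
rewrite ge0_integral_bigcup//=.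
- apply: is_cvg_ereal_nneg_natsum_cond => n _ _; exact: push_density_ge0.
- by move=> k; exact: mpre.
- by apply: measurable_funTS; exact/measurable_EFinP.
- by move=> z _; rewrite lee_fin.
- apply/trivIsetP => /= i j _ _ ij; rewrite -preimage_setI.
  by move/trivIsetP : tF => /(_ _ _ _ _ ij) ->//; rewrite preimage_set0.
Qed.

HB.instance Definition _ := isMeasure.Build _ _ _ push_density
  push_density0 push_density_ge0 push_density_sigma_additive.

Definition push_density_measure : {measure set S -> \bar R} := push_density.

Import HBNNSimple.

Let integral_push_density_nnsfun (g : {nnsfun S >-> R}) :
  (\int[push_density]_x (g x)%:E = \int[mu]_z (g (f z) * h z)%:E)%E.
Proof.
under [LHS]eq_integral do rewrite fimfunE -fsumEFin//.
rewrite ge0_integral_fsum//; last 2 first.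
  - by move=> r; exact/measurable_EFinP/measurableT_comp.
  - by move=> r z _; rewrite EFinM nnfun_muleindic_ge0.
transitivity (\sum_(r \in range g) \int[mu]_z ((r * \1_(g @^-1` [set r]) (f z)) * h z)%:E)%E.
  apply: eq_fsbigr => r _; under eq_integral do rewrite EFinM.
  rewrite integralZl_indic_nnsfun//= integral_indic//= setIT.
  have [r0|r0] := leP 0 r; last first.
    rewrite preimage_nnfun0// measure0 mule0 integral0_eq// => z _.
    by rewrite indic0 mulr0 mul0r.
  have mr : measurable_fun setT ((fun z => (h z)%:E) \_ (f @^-1` (g @^-1` [set r]))).
    have mB : measurable (f @^-1` (g @^-1` [set r])) by exact: mpre.
    apply/(measurable_restrictT _ mB).
    by apply: measurable_funTS; exact/measurable_EFinP.
  have mr0 z : (0 <= ((fun z => (h z)%:E) \_ (f @^-1` (g @^-1` [set r]))) z)%E.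
    by rewrite patchE; case: ifP => // _; rewrite lee_fin.
  rewrite /push_density integral_mkcond /= -ge0_integralZl//.
  apply: eq_integral => z _; rewrite patchE indicE.
  rewrite (_ : (z \in f @^-1` (g @^-1` [set r])) = (f z \in g @^-1` [set r]))//.
  by case: ifP => _; rewrite ?mulr1 ?mulr0 ?mul0r ?mule0// EFinM.
rewrite -ge0_integral_fsum//; last 2 first.
  - move=> r; apply/measurable_EFinP; apply: measurable_funM => //.
    apply: measurable_funM => //.
    have mi : measurable_fun setT (\1_(g @^-1` [set r]) : S -> R) by exact: measurable_indic.
    exact: (measurableT_comp mi mf).
  - by move=> r z _; rewrite lee_fin mulr_ge0// -lee_fin EFinM nnfun_muleindic_ge0.
apply: eq_integral => z _; rewrite fsumEFin//; congr EFin.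
by rewrite [in RHS]fimfunE mulr_fsuml.
Qed.

(** By monotone convergence from simple functions, for which the formula is summed over their
    finitely many values. *)
Lemma integral_push_density (g : S -> \bar R) :
  measurable_fun setT g -> (forall x, 0 <= g x)%E ->
  (\int[push_density]_x g x = \int[mu]_z (g (f z) * (h z)%:E))%E.
Proof.
move=> mg g0; pose g_ := nnsfun_approx measurableT mg.
have cg x : (g_ n x)%:E @[n --> \oo] --> g x by apply: cvg_nnsfun_approx.
transitivity (limn (fun n => \int[push_density]_x (g_ n x)%:E))%E.
  rewrite -monotone_convergence//.
  - by apply: eq_integral => x _; apply/esym/cvg_lim.
  - by move=> n; exact/measurable_EFinP.
  - by move=> n x _; rewrite lee_fin.
  - by move=> x _ m n mn; rewrite lee_fin; exact/lefP/nd_nnsfun_approx.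
under eq_fun do rewrite integral_push_density_nnsfun.
have mgf n : measurable_fun setT (fun z => (g_ n (f z) * h z)%:E).
  apply/measurable_EFinP; apply: measurable_funM => //.
  exact: measurableT_comp.
rewrite -monotone_convergence//.
- apply: eq_integral => z _; apply/cvg_lim => //; under eq_fun do rewrite EFinM.
  by apply: cvgeZr.
- by move=> n z _; rewrite lee_fin mulr_ge0.
- by move=> z _ m n mn; rewrite lee_fin ler_wpM2r//; exact/lefP/nd_nnsfun_approx.
Qed.

End density.

(** * From limits of test functions to regular variation *)

Section spectral_measure.
Context (R : realType) (dT : measure_display) (T : measurableType dT)
  (P : probability T R) (a b : nat) (rho : 'M[R]_(a, b) -> R) (Y : T -> 'M[R]_(a, b))
  (V : R -> R) (alpha : R) (dU : measure_display) (U : measurableType dU)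
  (mu : {measure set U -> \bar R}) (n : nat) (Z : nat -> U -> 'M[R]_(a, b)).
Hypothesis norm_rho : is_norm rho.
Hypothesis rv_Y : rv_family (fun w => mx_coords (Y w)).
Hypothesis V_gt0 : forall x, 0 < V x.
Hypothesis V_ratio : forall u : R, 0 < u -> V (u * x) / V x @[x --> +oo] --> u `^ (- alpha).
Hypothesis alpha_gt0 : 0 < alpha.
Hypothesis rv_Z : forall k, rv_family (fun z => mx_coords (Z k z)).
Hypothesis integrable_Z : forall k, mu.-integrable setT (fun z => (rho (Z k z) `^ alpha)%:E).
Hypothesis limit_Y : forall (H : 'M[R]_(a, b) -> R) (M : R),
  (forall y, 0 < rho y -> {for y, continuous H}) ->
  (forall c y, 0 < c -> H (c *: y) = H y) -> (forall y, `|H y| <= M) ->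
  Ex P (fun w => H (Y w) * (x < rho (Y w))%R%:R) / V x @[x --> +oo] -->
  \sum_(k < n) \int[mu]_z (H (Z k z) * rho (Z k z) `^ alpha).

Let c := \sum_(k < n) \int[mu]_z (rho (Z k z) `^ alpha).

Hypothesis c_gt0 : 0 < c.

Let sr : seminorm rho := is_norm_seminorm norm_rho.
Let S := g_sigma_algebraType (@cyl_gen R ('I_a * 'I_b)).

Let mx_of_coords (x : S) : 'M[R]_(a, b) := \matrix_(i, j) x (i, j).

Let rv_mx_of_coords : rv_family (fun x : S => mx_coords (mx_of_coords x)).
Proof.
apply/rv_coord => i j; have := rv_family_eval (R := R) (i, j).
by congr (measurable_fun _ _); apply/funext => x; rewrite mxE.
Qed.

Let coords k (z : U) : S := mx_coords (Z k z).

Let coordsK k z : mx_of_coords (coords k z) = Z k z.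
Proof. by apply/matrixP => i j; rewrite mxE. Qed.

Let measurable_coords k : measurable_fun setT (coords k).
Proof. exact: (rv_family_cyl (rv_Z k)). Qed.

Let measurable_powR_rho k : measurable_fun setT (fun z => rho (Z k z) `^ alpha).
Proof.
apply: (measurableT_comp (measurable_powR alpha)).
exact: (measurable_continuous_comp (rv_Z k) (seminorm_continuous sr)).
Qed.

Let dens k z : R := rho (Z k z) `^ alpha / c.

Let measurable_dens k : measurable_fun setT (dens k).
Proof.
by apply: measurable_funM => //; exact: measurable_powR_rho.
Qed.

Let dens_ge0 k z : 0 <= dens k z.
Proof. by rewrite divr_ge0 ?powR_ge0// ltW. Qed.

(* The spectral measure is the sum over k of the laws of Z k / rho (Z k), with
   Z k reweighted by rho (Z k) ^ alpha / c. *)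
Let piece k : {measure set S -> \bar R} :=
  push_density_measure mu (measurable_coords k) (measurable_dens k) (@dens_ge0 k).

Let Q0 : {measure set S -> \bar R} := msum piece n.

Let integral_Q0 (g : S -> \bar R) : measurable_fun setT g -> (forall x, 0 <= g x)%E ->
  (\int[Q0]_x g x = \sum_(k < n) \int[mu]_z (g (coords k z) * (dens k z)%:E))%E.
Proof.
move=> mg g0; rewrite ge0_integral_measure_sum//; apply: eq_bigr => k _.
exact: (integral_push_density mu (measurable_coords k) (measurable_dens k) (@dens_ge0 k)).
Qed.

Let integrable_dens k (H : 'M[R]_(a, b) -> R) (M : R) :
  (forall y, 0 < rho y -> {for y, continuous H}) -> (forall y, `|H y| <= M) ->
  mu.-integrable setT (fun z => (H (Z k z) * rho (Z k z) `^ alpha)%:E).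
Proof.
move=> cH bH; have M0 : 0 <= M by exact: le_trans (bH 0).
have iM := integrableZl measurableT M (integrable_Z k).
apply: le_integrable iM => //.
  apply/measurable_EFinP.
  rewrite (_ : (fun z => _) = fun z =>
      (H (Z k z) * (0 < rho (Z k z))%R%:R) * rho (Z k z) `^ alpha); last first.
    apply/funext => z; have := seminorm_ge0 (Z k z) sr; rewrite le_eqVlt.
    by case: eqP => [<- _|_ /= ->]; rewrite ?mulr1// powR0 ?gt_eqF// !mulr0.
  apply: measurable_funM; first exact: (measurable_off_kernel (rv_Z k) sr).
  exact: measurable_powR_rho.
move=> z _; rewrite -EFinM !abse_EFin lee_fin !normrM.
by rewrite ler_wpM2r// [leRHS]ger0_norm.
Qed.

Let sum_Rintegral (f : nat -> U -> R) : (forall k, mu.-integrable setT (EFin \o f k)) ->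
  (\sum_(k < n) \int[mu]_z (f k z)%:E)%E = (\sum_(k < n) \int[mu]_z f k z)%:E.
Proof.
move=> fi; rewrite -sumEFin; apply: eq_bigr => k _.
by rewrite /Rintegral fineK//; exact: (integrable_fin_num measurableT (fi k)).
Qed.

(** The densities have total mass 1, so the constant r passes through. With H = 0 and r = 1 this
    gives the mass of the spectral measure; with r = M it allows a bounded H to be handled by
    integrals of nonnegative functions. *)
Let sum_dens (H : 'M[R]_(a, b) -> R) (M r : R) :
  (forall y, 0 < rho y -> {for y, continuous H}) -> (forall y, `|H y| <= M) ->
  (\sum_(k < n) \int[mu]_z ((H (Z k z) + r) * dens k z)%:E)%E =
  ((\sum_(k < n) \int[mu]_z (H (Z k z) * rho (Z k z) `^ alpha)) / c + r)%:E.
Proof.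
move=> cH bH; have i1 k := integrable_dens k cH bH.
rewrite (sum_Rintegral (f := fun k z => (H (Z k z) + r) * dens k z)); last first.
  move=> k; have := integrableZr measurableT c^-1
     (integrableD measurableT (i1 k) (integrableZl measurableT r (integrable_Z k))).
  congr (integrable _ _ _); apply/funext => z /=.
  by congr EFin; rewrite /dens; ring.
congr EFin; transitivity (\sum_(k < n)
    ((\int[mu]_z (H (Z k z) * rho (Z k z) `^ alpha)) / c + r / c * \int[mu]_z (rho (Z k z) `^ alpha))).
  apply: eq_bigr => k _.
  rewrite -(RintegralZr _ measurableT (i1 k)) -(RintegralZl _ measurableT (integrable_Z k)).
  rewrite -RintegralD//.
  - by apply: eq_Rintegral => z _; rewrite /dens; field; exact: lt0r_neq0.
  - have := integrableZr measurableT c^-1 (i1 k).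
    by congr (integrable _ _ _).
  - have := integrableZl measurableT (r / c) (integrable_Z k).
    by congr (integrable _ _ _).
by rewrite big_split /= -mulr_suml -mulr_sumr -/c divfK// gt_eqF.
Qed.

Let Q0_setT : Q0 setT = 1%E.
Proof.
rewrite -[LHS]mul1e -(integral_cst Q0 measurableT) integral_Q0//.
have n0 : `|0 : R| <= 0 by rewrite normr0.
have := @sum_dens (fun=> 0) 0 1 (fun _ _ => @cst_continuous _ _ _ _) (fun _ => n0).
rewrite [X in (X / c)](_ : _ = 0); last first.
  apply: big1 => k _; rewrite -[RHS](mul0r (fine (mu setT))) -(Rintegral_cst _ measurableT).
  by apply: eq_Rintegral => z _; rewrite mul0r.
rewrite mul0r add0r => h; rewrite -[RHS]h.
by apply: eq_bigr => k _; apply: eq_integral => z _ /=; rewrite mul1e mul1r.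
Qed.

(** Normalisation changes nothing, as [Q0] already has mass 1; it only provides the structure of a
    probability. *)
Let Q : probability S R := mnormalize Q0 (dirac (point : S)).

Let QE : (Q : set S -> \bar R) = Q0.
Proof.
by apply/funext => B; rewrite /= /mnormalize Q0_setT /= onee_eq0 /= invr1 mule1.
Qed.

Section unit_vector.
Variable v0 : 'M[R]_(a, b).
Hypothesis rho_v0 : rho v0 = 1.

(** The spectral vector must lie on the unit sphere at every point of the space, so the matrices
    with rho = 0 are sent to a fixed [v0]. The density vanishes there, so the choice does not affect
    integrals. *)
Let unit_vector (y : 'M[R]_(a, b)) : 'M[R]_(a, b) :=
  if 0 < rho y then (rho y)^-1 *: y else v0.

Let rho_unit y : rho (unit_vector y) = 1.
Proof.
rewrite /unit_vector; case: ifP => // y0.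
by rewrite (seminormZ_pos _ sr) ?invr_ge0 ?(ltW y0)// mulVf// gt_eqF.
Qed.

Let measurable_if_pos (G : 'M[R]_(a, b) -> R) (r : R) :
  (forall y, 0 < rho y -> {for y, continuous G}) ->
  measurable_fun setT (fun x : S => if 0 < rho (mx_of_coords x) then G (mx_of_coords x) else r).
Proof.
move=> cG; rewrite (_ : (fun x => _) = fun x : S =>
    G (mx_of_coords x) * (0 < rho (mx_of_coords x))%R%:R +
    r * (1 - 1 * (0 < rho (mx_of_coords x))%R%:R)).
  apply: measurable_funD; first exact: (measurable_off_kernel rv_mx_of_coords sr).
  apply: measurable_funM => //; apply: measurable_funB => //.
  by apply: (measurable_off_kernel (H := fun=> 1) rv_mx_of_coords sr) => // y _; exact: cst_continuous.
apply/funext => x; case: ifP => _.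
  by rewrite !mulr1 subrr mulr0 addr0.
by rewrite !mulr0 subr0 mulr1 add0r.
Qed.

Let continuous_unit y : 0 < rho y -> {for y, continuous (fun y => (rho y)^-1 *: y)}.
Proof.
move=> y0; change ((rho z)^-1 *: z @[z --> y] --> (rho y)^-1 *: y).
apply: (@cvgZ _ _ _ (nbhs y)); last exact: cvg_id.
exact: (@cvgV _ _ (nbhs y) _ rho _ (lt0r_neq0 y0) (seminorm_continuous sr (x := y))).
Qed.

Section test_function.
Variables (g : 'M[R]_(a, b) -> R) (M : R).
Hypothesis cont_g : {within [set v | rho v = 1], continuous g}.
Hypothesis bound_g : forall v, rho v = 1 -> `|g v| <= M.

(** The extension of g from the unit sphere that is constant along rays; the value 0 on the kernel
    only has to respect the bound. *)
Let H y := if 0 < rho y then g ((rho y)^-1 *: y) else 0.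

Let near_pos y : 0 < rho y -> \forall z \near y, 0 < rho z.
Proof. by move=> y0; exact: (cvgr_gt (rho y) (seminorm_continuous sr (x := y)) 0 y0). Qed.

(** Although g is continuous only within the sphere, normalisation maps a neighbourhood of y into
    the sphere, so the limit within the sphere is the one required. *)
Let H_continuous y : 0 < rho y -> {for y, continuous H}.
Proof.
move=> y0; change (H z @[z --> y] --> H y).
have e : H y = g ((rho y)^-1 *: y) by rewrite /H y0.
rewrite e.
have h : (fun z => g ((rho z)^-1 *: z)) z @[z --> y] --> g ((rho y)^-1 *: y).
  apply: (cvg_comp (fun z => (rho z)^-1 *: z) g (G := within [set v | rho v = 1] (nbhs ((rho y)^-1 *: y)))).
    move=> B; rewrite /within /= => hB.
    have h2 := continuous_unit y0 hB; have h1 := near_pos y0.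
    change (\forall z \near y, B ((rho z)^-1 *: z)); near=> z.
    have z0 : 0 < rho z by near: z.
    have : rho ((rho z)^-1 *: z) = 1 -> B ((rho z)^-1 *: z) by near: z.
    by apply; rewrite (seminormZ_pos _ sr) ?invr_ge0 ?(ltW z0)// mulVf// gt_eqF.
  move/subspace_continuousP : cont_g; apply => /=.
  by rewrite (seminormZ_pos _ sr) ?invr_ge0 ?(ltW y0)// mulVf// gt_eqF.
apply: cvg_trans h; apply: (@near_eq_cvg _ _ (nbhs y)).
by have := near_pos y0; apply: filterS => z z0; rewrite /H z0.
Unshelve. all: by end_near. Qed.

Let H_hom r y : 0 < r -> H (r *: y) = H y.
Proof.
move=> r0; rewrite /H (seminormZ_pos _ sr) ?ltW// pmulr_rgt0//.
case: ifP => // y0; congr g; rewrite scalerA; congr (_ *: _).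
by field; rewrite !gt_eqF.
Qed.

Let g_unit y : g (unit_vector y) = if 0 < rho y then H y else g v0.
Proof. by rewrite /unit_vector /H; case: ifP. Qed.

Let M_ge0 : 0 <= M. Proof. exact: le_trans (bound_g rho_v0). Qed.

Let H_le y : `|H y| <= M.
Proof.
rewrite /H; case: ifP => [y0|_]; last by rewrite normr0.
by apply: bound_g; rewrite (seminormZ_pos _ sr) ?invr_ge0 ?(ltW y0)// mulVf// gt_eqF.
Qed.

Lemma spectral_integral : \int[Q]_x g (unit_vector (mx_of_coords x)) =
  (\sum_(k < n) \int[mu]_z (H (Z k z) * rho (Z k z) `^ alpha)) / c.
Proof.
have mg : measurable_fun setT (fun x : S => g (unit_vector (mx_of_coords x))).
  rewrite (_ : (fun x => _) = fun x : S => if 0 < rho (mx_of_coords x) then H (mx_of_coords x) else g v0).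
    exact: (measurable_if_pos _ H_continuous).
  by apply/funext => x; exact: g_unit.
have bg : bounded_rv (fun x : S => g (unit_vector (mx_of_coords x))).
  by split => //; exists M => x; exact/bound_g/rho_unit.
apply: (addIr M); rewrite -{1}(Ex_cst Q M) -ExD//; last exact: bounded_rv_cst.
apply: EFin_inj; rewrite -(sum_dens M H_continuous H_le).
rewrite Ex_fin; last by apply: bounded_rvD => //; exact: bounded_rv_cst.
rewrite QE integral_Q0; last 2 first.
  by apply/measurable_EFinP; exact: measurable_funD.
  move=> x; rewrite lee_fin -lerBlDr sub0r.
  by have := bound_g (rho_unit (mx_of_coords x)); rewrite ler_norml => /andP[].
apply: eq_bigr => k _; apply: eq_integral => z _; rewrite -EFinM coordsK g_unit.
case: ifP => // /negbT; rewrite -leNgt => z0.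
have {}z0 : rho (Z k z) = 0 by apply/eqP; rewrite eq_le z0 (seminorm_ge0 _ sr).
by rewrite /dens z0 powR0 ?gt_eqF// mul0r !mulr0.
Qed.

Lemma spectral_limit (u : R) : 0 < u ->
  (\int[P]_(w in [set w | u * x < rho (Y w)]) g ((rho (Y w))^-1 *: Y w))
    / fine (P [set w | x < rho (Y w)])
  @[x --> +oo] --> u `^ (- alpha) * (\int[Q]_x g (unit_vector (mx_of_coords x))).
Proof.
move=> u0; rewrite spectral_integral.
have l1 := limit_Y H_continuous H_hom H_le.
have n1 : `|1 : R| <= 1 by rewrite normr1.
have l2 := @limit_Y (fun=> 1) 1 (fun _ _ => @cst_continuous _ _ _ _) (fun _ _ _ => erefl) (fun _ => n1).
have {}l2 : Ex P (fun w => (x < rho (Y w))%R%:R) / V x @[x --> +oo] --> c.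
  rewrite (_ : c = \sum_(k < n) \int[mu]_z (1 * rho (Z k z) `^ alpha)); last first.
    by apply: eq_bigr => k _; apply: eq_Rintegral => z _; rewrite mul1r.
  rewrite (_ : (fun x => _) = fun x => Ex P (fun w => 1 * (x < rho (Y w))%R%:R) / V x); last first.
    by apply/funext => x; congr (Ex _ _ / _); apply/funext => w; rewrite mul1r.
  exact: l2.
have uoo : u * x @[x --> +oo] --> +oo.
  apply/cvgryPge => r; have := nbhs_pinfty_ge (num_real (u^-1 * r)).
  by apply: filterS => x; rewrite ler_pdivrMl.
have {}l1 := cvg_comp (fun x => u * x) _ uoo l1.
(* The quotient is split into the limit at argument u x, the ratio of [V], which yields u^-alpha,
   and the inverse of the tail ratio of Y, which yields 1 / c. *)
have l3 : Ex P (fun w => H (Y w) * (u * x < rho (Y w))%R%:R) / V (u * x) * (V (u * x) / V x) *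
     (Ex P (fun w => (x < rho (Y w))%R%:R) / V x)^-1 @[x --> +oo] -->
    (\sum_(k < n) \int[mu]_z (H (Z k z) * rho (Z k z) `^ alpha)) * u `^ (- alpha) * c^-1.
  apply: cvgM; [apply: cvgM => //; exact: V_ratio|exact: (cvgV (lt0r_neq0 c_gt0) l2)].
set L := (\sum_(k < n) _) in l3 *.
have e : u `^ (- alpha) * (L / c) = L * u `^ (- alpha) * c^-1 by rewrite mulrCA mulrA.
rewrite e; move: l3; apply: cvg_trans; apply: near_eq_cvg; near=> x.
have x0 : 0 <= x by near: x; apply: nbhs_pinfty_ge; exact: num_real.
rewrite Rintegral_ltr -Ex_ltr; last first.
  exact: (measurable_continuous_comp rv_Y (seminorm_continuous sr)).
rewrite (_ : Ex P (fun w => g _ * _) = Ex P (fun w => H (Y w) * (u * x < rho (Y w))%R%:R)); last first.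
  congr Ex; apply/funext => w; case: (ltP (u * x)) => [h|_]; last by rewrite !mulr0.
  by rewrite /H (le_lt_trans _ h)// mulr_ge0// ltW.
rewrite invf_div; have := V_gt0 x; have := V_gt0 (u * x).
set e1 := Ex _ _; set e2 := Ex _ _; move=> v1 v2.
(* If the tail of Y vanishes at x, both sides are 0 by the convention for division by 0. *)
have [->|e20] := eqVneq e2 0; first by rewrite invr0 !mulr0.
by field; rewrite e20 !gt_eqF.
Unshelve. all: by end_near. Qed.

End test_function.

Let rv_unit : rv_family (fun x => mx_coords (unit_vector (mx_of_coords x))).
Proof.
apply/rv_coord => i j.
rewrite (_ : (fun x => _) = fun x : S => if 0 < rho (mx_of_coords x) then
   (fun y => ((rho y)^-1 *: y) i j) (mx_of_coords x) else v0 i j); last first.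
  by apply/funext => x; rewrite /unit_vector; case: ifP.
apply: (measurable_if_pos (G := fun y => ((rho y)^-1 *: y) i j)) => y y0.
have := cvg_comp _ (fun y : 'M[R]_(a, b) => y i j) (continuous_unit y0) (@coord_continuous _ _ _ i j _).
exact.
Qed.

Lemma regvar_with_unit : regvar_with P rho Y alpha Q (fun x => unit_vector (mx_of_coords x)).
Proof.
split=> [|w|u u0 g cg [M bg]]; [exact: rv_unit|exact: rho_unit|].
exact: (spectral_limit cg bg u0).
Qed.

End unit_vector.

Theorem regvar_of_limit : regvar P rho Y alpha.
Proof.
(* The sphere is nonempty: otherwise rho would vanish identically, and c > 0 would fail. *)
have [v v1] : exists v, rho v = 1.
  apply: contrapT => no; have r0 y : rho y = 0.
    apply/eqP; rewrite eq_le (seminorm_ge0 _ sr) andbT leNgt; apply/negP => y0.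
    apply: no; exists ((rho y)^-1 *: y).
    by rewrite (seminormZ_pos _ sr) ?invr_ge0 ?(ltW y0)// mulVf// gt_eqF.
  move: c_gt0; rewrite /c big1 ?ltxx// => k _.
  rewrite -[RHS](mul0r (fine (mu setT))) -(Rintegral_cst _ measurableT).
  by apply: eq_Rintegral => z _; rewrite r0 powR0// gt_eqF.
do 4 eexists; exact: (regvar_with_unit v1).
Qed.

End spectral_measure.

(** * Moving averages with random coefficients *)

Section moving_average.
Context (R : realType) (d q m : nat)
  (dT : measure_display) (T : measurableType dT) (P : probability T R)
  (xi : int -> T -> 'cV[R]_q) (C : 'I_m.+1 -> int -> T -> 'M[R]_(d, q))
  (Nq : 'cV[R]_q -> R) (Nd : 'cV[R]_d -> R) (alpha beta : R)
  (dT' : measure_display) (T' : measurableType dT') (P' : probability T' R)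
  (Th : T' -> 'cV[R]_q).
Hypothesis rv_xi : forall t, rv_family (fun w => mx_coords (xi t w)).
Hypothesis law_xi : forall t,
  same_law P (fun w => mx_coords (xi t w)) (fun w => mx_coords (xi 0 w)).
Hypothesis indep_xi : indep_family P (fun t : int => sigma_of (fun w => mx_coords (xi t w))).
Hypothesis rv_C : forall i t, rv_family (fun w => mx_coords (C i t w)).

Let xif (w : T) (k : int * ('I_q * 'I_1)) : R := mx_coords (xi k.1 w) k.2.
Let Cf (w : T) (k : 'I_m.+1 * int * ('I_d * 'I_q)) : R := mx_coords (C k.1.1 k.1.2 w) k.2.

Hypothesis indep_xi_C : indep2 P (sigma_of xif) (sigma_of Cf).
Hypothesis stationary_C : forall (n : nat) (ts : 'I_n -> int) (h : int),
  same_law P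
    (fun w (k : 'I_n * 'I_m.+1 * ('I_d * 'I_q)) =>
       mx_coords (C k.1.2 (ts k.1.1 + h) w) k.2)
    (fun w (k : 'I_n * 'I_m.+1 * ('I_d * 'I_q)) =>
       mx_coords (C k.1.2 (ts k.1.1) w) k.2).
Hypothesis norm_q : is_norm Nq.
Hypothesis norm_d : is_norm Nd.
Hypothesis alpha_gt0 : 0 < alpha.
Hypothesis rv_tail : regvar_with P Nq (xi 0) alpha P' Th.
Hypothesis alpha_beta : alpha < beta.
Hypothesis moment_C : forall i, (\int[P]_w ((opnorm Nq Nd (C i 0 w)) `^ beta)%:E < +oo)%E.

Local Notation V := (tail P Nq (xi 0)).

Let sq : seminorm Nq := is_norm_seminorm norm_q.
Let sd : seminorm Nd := is_norm_seminorm norm_d.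
Let beta_gt0 : 0 < beta. Proof. exact: lt_trans alpha_beta. Qed.

Lemma tail_stationary t x : tail P Nq (xi t) x = V x.
Proof.
have [x0|x0] := leP 0 x; first exact: (tail_same norm_q rv_xi law_xi t x0).
rewrite /tail; congr Ex; apply/funext => w.
by rewrite !(lt_le_trans x0) ?seminorm_ge0.
Qed.

(** This is where independence of the innovations enters. Each event must be shown to belong to the
    sigma-algebra generated by its own innovation, so the norm is proved measurable on that smaller
    space. *)
Lemma pair_tail t s x : t != s ->
  Ex P (fun w => (x < Nq (xi t w))%R%:R * (x < Nq (xi s w))%R%:R) = V x * V x.
Proof.
move=> ts; pose A u := [set w | x < Nq (xi u w)].
have mA u : sigma_of (fun w => mx_coords (xi u w)) (A u).
  pose S := g_sigma_algebraType (sigma_gen (fun w => mx_coords (xi u w))).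
  have rS : rv_family (fun w : S => mx_coords (xi u w)).
    by move=> k; exact: (rv_sigma_gen (Z := fun w => mx_coords (xi u w))).
  have := measurable_continuous_comp rS (seminorm_continuous sq).
  move=> /(_ measurableT `]x, +oo[%classic (measurable_itv _)).
  rewrite setTI (_ : _ @^-1` _ = A u)//.
  by apply/seteqP; split => w /=; rewrite /A /= in_itv /= andbT.
have mAT u : measurable (A u).
  rewrite -[X in measurable X]setTI (_ : A u = (fun w => Nq (xi u w)) @^-1` `]x, +oo[%classic).
    exact: (measurable_norm_rv norm_q (rv_xi u)).
  by apply/seteqP; split => w /=; rewrite /A /= in_itv /= andbT.
have := indep_xi (J := [:: t; s]) (A := A).
rewrite !big_cons !big_nil setIT mulr1 /= inE ts => /(_ isT (fun i _ => mA i)).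
rewrite -!(tailE P norm_q (rv_xi _)) !tail_stationary => <-.
rewrite /Ex /Rintegral; congr fine.
rewrite -[X in _ = P X]setIT -(integral_indic P measurableT (measurableI _ _ (mAT t) (mAT s))).
apply: eq_integral => w _; rewrite indicE in_setI -natrM mulnb; congr ((nat_of_bool (_ && _))%:R%:E).
  by apply/idP/idP => [h|/set_mem//]; exact/mem_set.
by apply/idP/idP => [h|/set_mem//]; exact/mem_set.
Qed.

Definition mx_of (S : 'I_m.+1)
    (x : g_sigma_algebraType (@cyl_gen R ('I_1 * 'I_m.+1 * ('I_d * 'I_q)))) : 'M[R]_(d, q) :=
  \matrix_(i, l) x (ord0, S, (i, l)).

Lemma rv_mx_of i : rv_family (fun x => mx_coords (mx_of i x)).
Proof.
apply/rv_coord => j l; have := rv_family_eval (R := R) (ord0 : 'I_1, i, (j, l)).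
by congr (measurable_fun _ _); apply/funext => x; rewrite mxE.
Qed.

(** Stationarity is applied to the single time point 0 with shift t; [mx_of] recovers the matrix
    from the family of coordinates indexed by one time. *)
Lemma stationary_integral i t (F : 'M[R]_(d, q) -> \bar R) :
  measurable_fun setT (F \o mx_of i) -> (forall A, 0 <= F A)%E ->
  (\int[P]_w F (C i t w) = \int[P]_w F (C i 0 w))%E.
Proof.
move=> mF F0; have := stationary_C (fun _ : 'I_1 => 0) t.
pose X h w (k : 'I_1 * 'I_m.+1 * ('I_d * 'I_q)) := mx_coords (C k.1.2 (0 + h) w) k.2.
have rX h : rv_family (X h) by move=> [[u i'] k]; exact: (rv_C i' (0 + h) k).
have XE h w : mx_of i (X h w) = C i h w.
  by apply/matrixP => j l; rewrite mxE /X /= add0r.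
move=> law; have law0 : same_law P (X t) (X 0).
  by move: law; rewrite /X addr0.
have := same_law_integral (rX t) (rX 0) law0 mF (fun x => F0 (mx_of i x)).
move=> /=.
by under eq_integral do rewrite XE; under [in RHS]eq_integral do rewrite XE.
Qed.

Lemma integrable_C i t : P.-integrable setT (fun w => (`|C i t w| `^ beta)%:E).
Proof.
have [k k0 hk] := norm_le_opnorm norm_q norm_d.
have mC s : measurable_fun setT (fun w => `|C i s w| `^ beta).
  apply: (measurableT_comp (measurable_powR beta)).
  apply: (measurable_continuous_comp (rv_C i s) (H := fun A => `|A|)).
  exact: norm_continuous.
have i0 : P.-integrable setT (fun w => (`|C i 0 w| `^ beta)%:E).
  have kb : 0 < k `^ beta by rewrite powR_gt0.
  (* After division by k^beta the integrand lies pointwise below the power of [opnorm] in (M2), so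
     the comparison of integrals applies directly. *)
  have i1 : P.-integrable setT (fun w => ((k `^ beta)^-1 * `|C i 0 w| `^ beta)%:E).
    apply/integrableP; split; first by apply/measurable_EFinP; exact: measurable_funM.
    apply: le_lt_trans (moment_C i); apply: ge0_le_integral_nonmeasurable => w //.
    rewrite gee0_abs lee_fin; last by rewrite mulr_ge0 ?invr_ge0 ?powR_ge0// ltW.
    rewrite ler_pdivrMl//; have op0 : 0 <= opnorm Nq Nd (C i 0 w).
      by have := hk (C i 0 w); rewrite -ler_pdivrMl//; apply: le_trans; rewrite mulr_ge0// invr_ge0 ltW.
    rewrite -powRM ?(ltW k0)//; apply: ge0_ler_powR; rewrite ?nnegrE ?mulr_ge0 ?(ltW k0)//.
    exact: ltW.
  have := integrableZl measurableT (k `^ beta) i1; congr (integrable _ _ _).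
  by apply/funext => w; rewrite -EFinM mulrA mulfV ?mul1r// gt_eqF.
apply/integrableP; split; first exact/measurable_EFinP.
have /integrableP[_] := i0; apply: le_lt_trans.
rewrite le_eqVlt; apply/orP; left; apply/eqP.
apply: (@stationary_integral i t (fun A => `|(`|A| `^ beta)%:E|%E)) => //.
apply: measurableT_comp => //; apply/measurable_EFinP.
apply: (measurableT_comp (measurable_powR beta)).
apply: (measurable_continuous_comp (rv_mx_of i) (H := fun A => `|A|)).
exact: norm_continuous.
Qed.

(** X at time c involves only the innovations at times c - m, ..., c; the other indices of a larger
    window contribute 0. *)
Lemma sum_window (W : nmodType) (J : seq int) (c : int) (f : int -> W) : uniq J ->
  (forall i : 'I_m.+1, c - (i : nat)%:Z \in J) ->
  (forall t, ~~ ((0 <= c - t) && (c - t <= m%:Z)) -> f t = 0) ->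
  \sum_(t <- J) f t = \sum_(i < m.+1) f (c - (i : nat)%:Z).
Proof.
move=> uJ cJ f0.
rewrite (sum_uniq_support (S := [seq c - (i : nat)%:Z | i : 'I_m.+1]) uJ) ?big_image//.
- rewrite map_inj_uniq ?enum_uniq// => i j /addrI/oppr_inj [] /val_inj//.
- by move=> _ /mapP[i _ ->].
- move=> t tS; apply: f0; apply: contraNN tS => /andP[h1 h2].
  apply/mapP; have h : (`|(c - t)%R| < m.+1)%N by lia.
  exists (Ordinal h); rewrite ?mem_enum//=; lia.
Qed.

Lemma Cext_window c t s w : ~~ ((0 <= c - t) && (c - t <= m%:Z)) -> Cext C (c - t) s w = 0.
Proof. by rewrite /Cext => /negbTE ->. Qed.

Lemma Cext_ord c s w (i : 'I_m.+1) : Cext C (c - (c - (i : nat)%:Z)) s w = C i s w.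
Proof.
rewrite /Cext opprB addrCA subrr addr0.
by rewrite (_ : _ && _) ?absz_nat ?inord_val//; have := ltn_ord i; lia.
Qed.

Section window.
Variables (b : nat) (tau : 'I_b -> int).

Definition ma_coef (t : int) (j : 'I_b) (w : T) : 'M[R]_(d, q) :=
  Cext C (tau j - t) (tau j) w.

Definition ma_matrix (w : T) : 'M[R]_(d, b) :=
  \matrix_(i, j) MA C xi (tau j) w i ord0.

(** The times of all innovations that enter some column. Distinct pairs may give the same time, and
    each innovation must be counted once with its whole matrix of coefficients, hence [undup]. *)
Definition window : seq int :=
  undup [seq tau p.1 - (p.2 : nat)%:Z | p : 'I_b * 'I_m.+1].

Let uniq_window : uniq window. Proof. exact: undup_uniq. Qed.

Lemma mem_window j (i : 'I_m.+1) : tau j - (i : nat)%:Z \in window.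
Proof. by rewrite mem_undup; apply/mapP; exists (j, i); rewrite ?mem_enum. Qed.

Lemma ma_matrixE w : ma_matrix w = \sum_(t <- window) lin_cols (ma_coef t ^~ w) (xi t w).
Proof.
apply/matrixP => i j; rewrite summxE mxE /MA summxE.
rewrite (sum_window (c := tau j) uniq_window (mem_window j)); last first.
  by move=> t h; rewrite lin_colsE /ma_coef Cext_window// mul0mx mxE.
by apply: eq_bigr => l _; rewrite lin_colsE /ma_coef Cext_ord.
Qed.

Let kq := let: exist2 k _ _ := cid2 (norm_equiv norm_q) in k.
Let kq_gt0 : 0 < kq. Proof. by rewrite /kq; case: cid2. Qed.
Let kq_le v : `|v| <= kq * Nq v. Proof. by rewrite /kq; case: cid2. Qed.

(** The factor q comes from the matrix product in the sup norm, and [kq] converts the sup norm of v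
    into Nq. A sum over the whole window bounds all coefficients at once and keeps a moment of order
    beta. *)
Definition coef_bound (w : T) : R :=
  q%:R * kq * \sum_(p : 'I_b * 'I_m.+1) `|C p.2 (tau p.1) w|.

Lemma coef_bound_ge0 w : 0 <= coef_bound w.
Proof. by rewrite /coef_bound mulr_ge0 ?sumr_ge0// mulr_ge0// (ltW kq_gt0). Qed.

Lemma ma_coef_le t j w : `|ma_coef t j w| <= \sum_(p : 'I_b * 'I_m.+1) `|C p.2 (tau p.1) w|.
Proof.
rewrite /ma_coef /Cext; case: ifP => _; last by rewrite normr0 sumr_ge0.
by rewrite (bigD1 (j, inord `|(tau j - t)%R|%N))//= lerDl sumr_ge0.
Qed.

Lemma lin_cols_le t w v : `|lin_cols (ma_coef t ^~ w) v| <= coef_bound w * Nq v.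
Proof.
apply: mxnorm_le => [|i j]; first by rewrite mulr_ge0 ?coef_bound_ge0 ?seminorm_ge0.
rewrite lin_colsE (le_trans (ler_coord_norm _ _ _))// (le_trans (mulmx_norm_le _ _))//.
rewrite /coef_bound -!mulrA ler_wpM2l// [kq * _]mulrCA ler_pM//.
exact: ma_coef_le.
Qed.

Lemma measurable_coef_bound : measurable_fun setT coef_bound.
Proof.
apply: measurable_funM => //; apply: measurable_sum => p.
apply: (measurable_continuous_comp (rv_C p.2 (tau p.1)) (H := fun A => `|A|)).
exact: norm_continuous.
Qed.

Lemma moment_coef_bound : (\int[P]_w ((coef_bound w) `^ beta)%:E < +oo)%E.
Proof.
pose n := size (index_enum ('I_b * 'I_m.+1)%type).
pose D := (q%:R * kq) `^ beta * n%:R `^ beta.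
have D0 : 0 <= D by rewrite mulr_ge0 ?powR_ge0.
have iS : P.-integrable setT (fun w => (D%:E * \sum_(p : 'I_b * 'I_m.+1) (`|C p.2 (tau p.1) w| `^ beta)%:E)%E).
  by apply: integrableZl => //; apply: integrable_sum => // p _; exact: integrable_C.
have /integrableP[_] := iS; apply: le_lt_trans.
apply: ge0_le_integral_nonmeasurable => w; first by rewrite lee_fin powR_ge0.
apply: le_trans (lee_abs _); rewrite sumEFin -EFinM lee_fin /coef_bound.
rewrite powRM ?mulr_ge0 ?(ltW kq_gt0)// ?sumr_ge0// /D -mulrA ler_wpM2l ?powR_ge0//.
exact: powR_sum_le.
Qed.

Let rv_Cf : rv_family Cf. Proof. by move=> [[i t] k]; exact: (rv_C i t k). Qed.

Let measurable_ma_coef t j i l :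
  measurable_fun [set: g_sigma_algebraType (sigma_gen Cf)] (fun w => ma_coef t j w i l).
Proof.
rewrite /ma_coef /Cext; case: (_ && _).
  exact: (rv_sigma_gen (Z := Cf) (inord `|(tau j - t)%R|%N, tau j, (i, l))).
by under eq_fun do rewrite mxE; exact: measurable_cst.
Qed.

Theorem ma_limit (H rho : 'M[R]_(d, b) -> R) (M : R) : seminorm rho ->
  (forall y, 0 < rho y -> {for y, continuous H}) ->
  (forall c y, 0 < c -> H (c *: y) = H y) -> (forall y, `|H y| <= M) ->
  Ex P (fun w => H (ma_matrix w) * (x < rho (ma_matrix w))%R%:R) / V x
    @[x --> +oo] -->
  \sum_(t <- window) \int[(P \x P')%E]_(z in setT)
    (H (lin_cols (ma_coef t ^~ z.1) (Th z.2)) * rho (lin_cols (ma_coef t ^~ z.1) (Th z.2)) `^ alpha).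
Proof.
move=> sr cH hH bH.
have ind : indep2 P (sigma_of Cf) (sigma_of xif).
  by move=> A B hA hB; rewrite setIC muleC; exact: indep_xi_C.
have := random_sum_limit norm_q rv_xi law_xi alpha_gt0 alpha_beta rv_tail pair_tail
  ind rv_Cf measurable_ma_coef measurable_coef_bound coef_bound_ge0 lin_cols_le moment_coef_bound
  uniq_window sr cH hH bH.
rewrite (_ : (fun x => _) = (fun x => Ex P (fun w => H (ma_matrix w) * (x < rho (ma_matrix w))%R%:R) / V x))//.
by apply/funext => x; congr (Ex _ _ / _); apply/funext => w; rewrite ma_matrixE.
Qed.


Lemma integrable_ma (rho : 'M[R]_(d, b) -> R) t : seminorm rho ->
  (P \x P')%E.-integrable setT
    (fun z => (rho (lin_cols (ma_coef t ^~ z.1) (Th z.2)) `^ alpha)%:E).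
Proof.
move=> sr; have n1 : `|1 : R| <= 1 by rewrite normr1.
have := integrable_spectral alpha_gt0 alpha_beta rv_tail rv_Cf measurable_ma_coef
  measurable_coef_bound coef_bound_ge0 lin_cols_le moment_coef_bound sr
  (H := fun=> 1) (fun _ _ => @cst_continuous _ _ _ _) (fun=> n1) t.
by congr (integrable _ _ _); apply/funext => z; rewrite mul1r.
Qed.

Lemma col_ma_matrix j w : col j (ma_matrix w) = MA C xi (tau j) w.
Proof. by apply/matrixP => i l; rewrite [l]ord1 !mxE. Qed.

Lemma col_lin_cols (B : 'I_b -> 'M[R]_(d, q)) v j : col j (lin_cols B v) = B j *m v.
Proof. by apply/matrixP => i l; rewrite [l]ord1 mxE lin_colsE. Qed.

(** For the seminorm of column j0, a jump at a time t outside the m + 1 times feeding that column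
    leaves it 0, and 0^alpha = 0; the remaining times are tau j0 - i. *)
Lemma sum_window_col (j0 : 'I_b) (H : 'M[R]_(d, b) -> R) :
  \sum_(t <- window) \int[(P \x P')%E]_(z in setT)
    (H (lin_cols (ma_coef t ^~ z.1) (Th z.2)) *
     Nd (col j0 (lin_cols (ma_coef t ^~ z.1) (Th z.2))) `^ alpha) =
  \sum_(i < m.+1) \int[(P \x P')%E]_(z in setT)
    (H (lin_cols (ma_coef (tau j0 - (i : nat)%:Z) ^~ z.1) (Th z.2)) *
     Nd (C i (tau j0) z.1 *m Th z.2) `^ alpha).
Proof.
rewrite (sum_window (c := tau j0) uniq_window (mem_window j0)) => [|t ht].
  apply: eq_bigr => i _; apply: eq_Rintegral => z _.
  by rewrite col_lin_cols [in LHS]/ma_coef Cext_ord.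
rewrite -[RHS](mul0r (fine ((P \x P')%E setT))) -(Rintegral_cst _ measurableT).
apply: eq_Rintegral => z _.
by rewrite col_lin_cols /ma_coef Cext_window// mul0mx seminorm0// powR0 ?mulr0// gt_eqF.
Qed.

Theorem ma_limit_col (j0 : 'I_b) (H : 'M[R]_(d, b) -> R) (M : R) :
  (forall y, 0 < Nd (col j0 y) -> {for y, continuous H}) ->
  (forall c y, 0 < c -> H (c *: y) = H y) -> (forall y, `|H y| <= M) ->
  Ex P (fun w => H (ma_matrix w) * (x < Nd (MA C xi (tau j0) w))%R%:R) / V x
    @[x --> +oo] -->
  \sum_(i < m.+1) \int[(P \x P')%E]_(z in setT)
    (H (lin_cols (ma_coef (tau j0 - (i : nat)%:Z) ^~ z.1) (Th z.2)) *
     Nd (C i (tau j0) z.1 *m Th z.2) `^ alpha).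
Proof.
move=> cH hH bH; rewrite -sum_window_col.
have := ma_limit (seminorm_col norm_d j0) cH hH bH.
rewrite (_ : (fun x => _) = fun x =>
    Ex P (fun w => H (ma_matrix w) * (x < Nd (MA C xi (tau j0) w))%R%:R) / V x)//.
by apply/funext => x; congr (Ex _ _ / _); apply/funext => w; rewrite col_ma_matrix.
Qed.

End window.

Lemma rv_MA t : rv_family (fun w => mx_coords (MA C xi t w)).
Proof.
apply/rv_coord => i j; rewrite /MA.
rewrite (_ : (fun w => _) = fun w => \sum_(k < m.+1) \sum_(l < q)
    C k t w i l * xi (t - (k : nat)%:Z) w l j); last first.
  by apply/funext => w; rewrite summxE; apply: eq_bigr => k _; rewrite mxE.
apply: measurable_sum => k; apply: measurable_sum => l; apply: measurable_funM.
  exact: (rv_C k t (i, l)).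
exact: (rv_xi (t - (k : nat)%:Z) (l, j)).
Qed.

Lemma rv_mulmx (dU dU' : measure_display) (U : measurableType dU) (U' : measurableType dU')
    (A : U -> 'M[R]_(d, q)) (v : U' -> 'cV[R]_q) :
  rv_family (fun x => mx_coords (A x)) -> rv_family (fun x => mx_coords (v x)) ->
  rv_family (fun z : U * U' => mx_coords (A z.1 *m v z.2)).
Proof.
move=> /rv_coord rA /rv_coord rv; apply/rv_coord => i j.
rewrite (_ : (fun w => _) = fun z : U * U' => \sum_(l < q) A z.1 i l * v z.2 l j); last first.
  by apply/funext => z; rewrite mxE.
apply: measurable_sum => l; apply: measurable_funM.
  exact: (measurableT_comp (rA i l) measurable_fst).
exact: (measurableT_comp (rv l j) measurable_snd).
Qed.

Let rv_Th : rv_family (fun w => mx_coords (Th w)). Proof. by case: rv_tail. Qed.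

Let measurable_term (dU : measure_display) (U : measurableType dU) (A : U -> 'M[R]_(d, q)) :
  rv_family (fun x => mx_coords (A x)) ->
  measurable_fun setT (fun z : U * T' => (Nd (A z.1 *m Th z.2) `^ alpha)%:E).
Proof.
move=> rA; apply/measurable_EFinP; apply: (measurableT_comp (measurable_powR alpha)).
exact: (measurable_continuous_comp (rv_mulmx rA rv_Th) (seminorm_continuous sd)).
Qed.

Definition spectral_moment i s : R :=
  \int[(P \x P')%E]_(w in setT) (Nd (C i s w.1 *m Th w.2)) `^ alpha.

(** By Tonelli the integral over Theta comes first and leaves a function of the matrix C i s alone,
    to which stationarity applies. *)
Let spectral_moment_stationary_ereal i s :
  (\int[P \x P']_w (Nd (C i s w.1 *m Th w.2) `^ alpha)%:E =
   \int[P \x P']_w (Nd (C i 0 w.1 *m Th w.2) `^ alpha)%:E)%E.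
Proof.
have p0 (B : 'M[R]_(d, q)) w : (0 <= (Nd (B *m Th w) `^ alpha)%:E)%E by rewrite lee_fin powR_ge0.
rewrite (fubini_tonelli1 _ (measurable_term (rv_C i s))); last by move=> z; exact: p0.
rewrite (fubini_tonelli1 _ (measurable_term (rv_C i 0))); last by move=> z; exact: p0.
apply: (@stationary_integral i s (fun A => \int[P']_w (Nd (A *m Th w) `^ alpha)%:E)%E).
  apply: (measurable_fun_fubini_tonelli_F _ (measurable_term (rv_mx_of i))) => z; exact: p0.
by move=> A; apply: integral_ge0 => w _; exact: p0.
Qed.

Lemma spectral_moment_stationary i s : spectral_moment i s = spectral_moment i 0.
Proof. by rewrite /spectral_moment /Rintegral spectral_moment_stationary_ereal. Qed.

Lemma integrable_spectral_moment i s :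
  (P \x P')%E.-integrable setT (fun w => (Nd (C i s w.1 *m Th w.2) `^ alpha)%:E).
Proof.
have := @integrable_ma 1 (fun=> s) _ (s - (i : nat)%:Z) (seminorm_col norm_d ord0).
congr (integrable _ _ _); apply/funext => z.
by rewrite col_lin_cols /ma_coef Cext_ord.
Qed.

Lemma spectral_moment_ge0 i s : 0 <= spectral_moment i s.
Proof. by apply: Rintegral_ge0 => w _; exact: powR_ge0. Qed.

Hypothesis nondegenerate :
  exists i, (0 < (P \x P')%E [set w | (0 < Nd (C i 0 w.1 *m Th w.2))%R])%E.

(** A vanishing moment would make the norm of C i 0 Theta zero almost everywhere, against (M3).
    Stationarity moves the conclusion from time 0 to any s: s = 0 serves the tail ratio, s = 1 the
    first column of the joint vector. *)
Lemma sum_spectral_moment_gt0 s : 0 < \sum_(i < m.+1) spectral_moment i s.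
Proof.
have [i hi] := nondegenerate.
apply: (@lt_le_trans _ _ (spectral_moment i s)); last first.
  by rewrite (bigD1 i)//= lerDl sumr_ge0// => j _; exact: spectral_moment_ge0.
rewrite spectral_moment_stationary lt0r spectral_moment_ge0 andbT.
apply/negP => /eqP e0.
have {}e0 : (\int[P \x P']_w `|(Nd (C i 0 w.1 *m Th w.2) `^ alpha)%:E| = 0)%E.
  under eq_integral do rewrite gee0_abs ?lee_fin ?powR_ge0//.
  rewrite -[LHS]fineK ?(integrable_fin_num measurableT (integrable_spectral_moment i 0))//.
  by congr EFin.
move/(ae_eq_integral_abs _ measurableT (measurable_term (rv_C i 0))) : e0.
case=> A [mA A0 hA]; move: hi; rewrite ltNge => /negP; apply.
rewrite -A0; apply: le_measure; rewrite ?inE//.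
  rewrite -[X in measurable X]setTI (_ : [set w | _] =
     (fun w : T * T' => Nd (C i 0 w.1 *m Th w.2)) @^-1` `]0, +oo[%classic).
    by apply: (measurable_continuous_comp (rv_mulmx (rv_C i 0) rv_Th) (seminorm_continuous sd)).
  by apply/seteqP; split => w /=; rewrite in_itv /= andbT.
move=> w /= w0; apply: hA => /= /(_ I) [] /eqP; rewrite powR_eq0 (gt_eqF w0)//.
Qed.

Lemma MA_tail_ratio :
  fine (P [set w | x < Nd (MA C xi 0 w)]) / fine (P [set w | x < Nq (xi 0 w)])
    @[x --> +oo] --> \sum_(i < m.+1) spectral_moment i 0.
Proof.
have n1 : `|1 : R| <= 1 by rewrite normr1.
have := @ma_limit_col 1 (fun=> 0 : int) ord0 (fun=> 1) 1 (fun _ _ => @cst_continuous _ _ _ _)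
  (fun _ _ _ => erefl) (fun=> n1).
rewrite (_ : (fun x => _) = fun x =>
    fine (P [set w | x < Nd (MA C xi 0 w)]) / fine (P [set w | x < Nq (xi 0 w)])).
  rewrite (eq_bigr (fun i => spectral_moment i 0))// => i _.
  by apply: eq_Rintegral => z _; rewrite mul1r.
apply/funext => x; rewrite -(tailE P norm_q (rv_xi 0)); congr (_ / _).
rewrite -Ex_ltr; first by congr Ex; apply/funext => w; rewrite mul1r.
exact: (measurable_continuous_comp (rv_MA 0) (seminorm_continuous sd)).
Qed.

Lemma is_norm_colmax k : is_norm (colmax_norm (k := k) Nd).
Proof.
have [sc st] := seminorm_colmax k norm_d; split=> // v v0.
apply/matrixP => i j; rewrite mxE.
have : Nd (col j v) <= 0 by rewrite -v0; exact: ler_colmax.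
move=> h; have : Nd (col j v) = 0 by apply/eqP; rewrite eq_le h seminorm_ge0.
by case: norm_d => N0 _ _ /N0 /matrixP/(_ i ord0); rewrite !mxE.
Qed.

Lemma MA_jointly_regvar : jointly_regvar P Nd (MA C xi) alpha.
Proof.
move=> k; pose tau (j : 'I_k.+1) : int := 1 + (j : nat)%:Z.
have sN := seminorm_colmax k.+1 norm_d.
(* The window is enumerated by naturals to fit [regvar_of_limit]. Beyond its size the default time 0
   is used; such indices are outside the sums but still give random matrices with integrable
   powers. *)
pose Z n (z : T * T') := lin_cols (ma_coef tau (nth 0 (window tau) n) ^~ z.1) (Th z.2).
have toJ (F : int -> R) : \sum_(n < size (window tau)) F (nth 0 (window tau) n) =
    \sum_(t <- window tau) F t.
  by rewrite (big_nth 0) big_mkord.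
apply: (@regvar_of_limit _ _ _ _ _ _ _ (ma_matrix tau) V alpha _ _ (P \x P')%E
          (size (window tau)) Z) => //.
- exact: is_norm_colmax.
- apply/rv_coord => i j; rewrite (_ : (fun w => _) = fun w => MA C xi (tau j) w i ord0).
    exact: (rv_MA (tau j) (i, ord0)).
  by apply/funext => w; rewrite mxE.
- by move=> x; exact: (tail_gt0 norm_q (rv_xi 0) rv_tail).
- by move=> u u0; exact: (tail_ratio norm_q (rv_xi 0) rv_tail).
- move=> n; apply/rv_coord => i j.
  rewrite (_ : (fun w => _) = fun z : T * T' =>
     \sum_(l < q) ma_coef tau (nth 0 (window tau) n) j z.1 i l * Th z.2 l ord0); last first.
    by apply/funext => z; rewrite lin_colsE mxE.
  apply: measurable_sum => l; apply: measurable_funM; last first.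
    exact: (measurableT_comp (rv_Th (l, ord0)) measurable_snd).
  have h : measurable_fun [set: T] (fun w => ma_coef tau (nth 0 (window tau) n) j w i l).
    rewrite /ma_coef /Cext; case: (_ && _).
      exact: (rv_C _ _ (i, l)).
    by under eq_fun do rewrite mxE; exact: measurable_cst.
  exact: (measurableT_comp h measurable_fst).
- by move=> n; exact: integrable_ma.
- move=> H M cH hH bH; rewrite (toJ (fun t => \int[(P \x P')%E]_z
     (H (lin_cols (ma_coef tau t ^~ z.1) (Th z.2)) * colmax_norm Nd (lin_cols (ma_coef tau t ^~ z.1) (Th z.2)) `^ alpha))).
  exact: (ma_limit sN cH hH bH).
rewrite (toJ (fun t => \int[(P \x P')%E]_z
     (colmax_norm Nd (lin_cols (ma_coef tau t ^~ z.1) (Th z.2)) `^ alpha))).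
(* The maximum of the column norms dominates the norm of the first column, which carries time 1, so
   the constant is at least the sum of the moments at time 1. *)
apply: (lt_le_trans (sum_spectral_moment_gt0 1)).
rewrite (_ : \sum_(i < m.+1) _ = \sum_(t <- window tau) \int[(P \x P')%E]_(z in setT)
    (1 * Nd (col ord0 (lin_cols (ma_coef tau t ^~ z.1) (Th z.2))) `^ alpha)); last first.
  rewrite (sum_window_col tau ord0 (fun=> 1)); apply: eq_bigr => i _.
  by apply: eq_Rintegral => z _; rewrite mul1r.
apply: ler_sum => t _; apply: le_Rintegral => //.
- have := @integrable_ma _ tau _ t (seminorm_col norm_d ord0).
  by congr (integrable _ _ _); apply/funext => z /=; rewrite mul1r.
- exact: integrable_ma.
- move=> z _; rewrite mul1r; apply: ge0_ler_powR; rewrite ?nnegrE ?seminorm_ge0 ?(ltW alpha_gt0)//.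
  exact: ler_colmax.
Qed.

Lemma MA_spectral_process (s : int) (n : nat) (f : 'M[R]_(d, n.+1) -> R) :
  continuous f -> (exists M : R, forall v, `|f v| <= M) ->
  (\int[P]_(w in [set w | x < Nd (MA C xi 0 w)])
      f (\matrix_(a < d, j < n.+1)
           ((Nd (MA C xi 0 w))^-1 *: MA C xi (s + (j : nat)%:Z) w) a ord0))
    / fine (P [set w | x < Nd (MA C xi 0 w)])
  @[x --> +oo] -->
  (\sum_(i < m.+1) spectral_moment i 0)^-1 * \sum_(i < m.+1)
    \int[(P \x P')%E]_(w in setT)
      (f (\matrix_(a < d, j < n.+1)
            ((Nd (C i 0 w.1 *m Th w.2))^-1 *:
               (Cext C ((i : nat)%:Z + s + (j : nat)%:Z) (s + (j : nat)%:Z) w.1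
                  *m Th w.2)) a ord0)
       * (Nd (C i 0 w.1 *m Th w.2)) `^ alpha).
Proof.
move=> cf [M bf].
(* Time 0 need not lie between s and s + n, so it gets an extra column in front. That column carries
   the seminorm and the normalisation; f sees the other n + 1 columns. *)
pose tau (j : 'I_n.+2) : int := if unlift ord0 j is Some k then s + (k : nat)%:Z else 0.
have tau0 : tau ord0 = 0 by rewrite /tau unlift_none.
have tauS j : tau (lift ord0 j) = s + (j : nat)%:Z by rewrite /tau liftK.
pose N (y : 'M[R]_(d, n.+2)) := (Nd (col ord0 y))^-1 *: colsub (lift ord0) y.
have cN y : 0 < Nd (col ord0 y) -> {for y, continuous N}.
  move=> y0; change (N z @[z --> y] --> N y).
  have h1 : (Nd (col ord0 z))^-1 @[z --> y] --> (Nd (col ord0 y))^-1.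
    exact: (@cvgV _ _ (nbhs y) _ (fun y => Nd (col ord0 y)) _ (lt0r_neq0 y0)
      (seminorm_continuous (seminorm_col norm_d ord0) (x := y))).
  apply: (@cvgZ _ _ _ (nbhs y)) => //.
  change ({for y, continuous (fun z : 'M[R]_(d, n.+2) => colsub (lift ord0) z : 'M[R]_(d, n.+1))}).
  apply/continuous_atP => e e0; exists e => // u yu.
  apply: le_lt_trans yu; apply: mxnorm_le => // i j; rewrite !mxE.
  by have := ler_coord_norm (y - u) i (lift ord0 j); rewrite !mxE.
have hN c y : 0 < c -> N (c *: y) = N y.
  move=> c0; rewrite /N (seminormZ_pos _ (seminorm_col norm_d ord0) (ltW c0)).
  rewrite linearZ /= scalerA; congr (_ *: _).
  (* Homogeneity is required also on the kernel of the seminorm, where the inverse is 0 by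
     convention and both sides vanish. *)
  have [->|y0] := eqVneq (Nd (col ord0 y)) 0; first by rewrite mulr0 invr0 mul0r.
  by field; rewrite y0 gt_eqF.
have cfN y : 0 < Nd (col ord0 y) -> {for y, continuous (f \o N)}.
  move=> y0; change ((f \o N) z @[z --> y] --> f (N y)).
  exact: (cvg_comp N f (cN y y0) (cf (N y))).
have hfN c y : 0 < c -> (f \o N) (c *: y) = (f \o N) y by move=> c0; rewrite /= hN.
have l1 := ma_limit_col (tau := tau) cfN hfN (fun y => bf (N y)).
rewrite tau0 in l1.
(* Conditioning on the norm of X 0 exceeding x divides by its own tail; the result normalised by the
   tail of xi 0 is corrected by the inverse tail ratio. *)
have l2 : (fine (P [set w | x < Nd (MA C xi 0 w)]) / fine (P [set w | x < Nq (xi 0 w)]))^-1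
    @[x --> +oo] --> (\sum_(i < m.+1) spectral_moment i 0)^-1.
  exact: (cvgV (lt0r_neq0 (sum_spectral_moment_gt0 0)) MA_tail_ratio).
rewrite [_^-1 * _]mulrC.
set S2 := \sum_(i < m.+1) \int[(P \x P')%E]_z _.
have e : \sum_(i < m.+1) \int[(P \x P')%E]_z
    ((f \o N) (lin_cols (ma_coef tau (0 - (i : nat)%:Z) ^~ z.1) (Th z.2)) *
     Nd (C i 0 z.1 *m Th z.2) `^ alpha) = S2.
  (* A jump that reaches X 0 with lag i occurs at time -i, so it reaches time s + j with lag i + s +
     j; this is the shifted index of [Cext]. *)
  apply: eq_bigr => i _; apply: eq_Rintegral => z _; congr (f _ * _).
  rewrite /N col_lin_cols /ma_coef tau0 Cext_ord; apply/matrixP => a j.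
  rewrite mxE [in LHS]mxE lin_colsE [in RHS]mxE [in RHS]mxE; congr (_ * (Cext _ _ _ _ *m _) _ _).
    by rewrite tauS; ring.
  by rewrite tauS.
have l3 : Ex P (fun w => (f \o N) (ma_matrix tau w) * (x < Nd (MA C xi 0 w))%R%:R) / V x *
    (fine (P [set w | x < Nd (MA C xi 0 w)]) / fine (P [set w | x < Nq (xi 0 w)]))^-1
    @[x --> +oo] --> S2 * (\sum_(i < m.+1) spectral_moment i 0)^-1.
  by rewrite -e; apply: cvgM; [exact: l1|exact: l2].
move: l3; apply: cvg_trans; apply: near_eq_cvg; near=> x.
rewrite /= Rintegral_ltr invf_div -(tailE P norm_q (rv_xi 0)).
rewrite (_ : Ex P (fun w => f (N _) * _) = Ex P (fun w =>
  f (\matrix_(a < d, j < n.+1) ((Nd (MA C xi 0 w))^-1 *: MA C xi (s + (j : nat)%:Z) w) a ord0) *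
  (x < Nd (MA C xi 0 w))%R%:R)).
  by rewrite mulrA divfK// gt_eqF// (tail_gt0 norm_q (rv_xi 0) rv_tail).
congr Ex; apply/funext => w; congr (f _ * _).
rewrite /N col_ma_matrix tau0; apply/matrixP => a j.
by rewrite !mxE tauS.
Unshelve. all: by end_near. Qed.

End moving_average.

Theorem theorem2p9 (R : realType) (d q m : nat)
  (dT : measure_display) (T : measurableType dT) (P : probability T R)
  (xi : int -> T -> 'cV[R]_q) (C : 'I_m.+1 -> int -> T -> 'M[R]_(d, q))
  (Nq : 'cV[R]_q -> R) (Nd : 'cV[R]_d -> R) (alpha : R)
  (dT' : measure_display) (T' : measurableType dT') (P' : probability T' R)
  (Th : T' -> 'cV[R]_q) :
  (* the xi_t are i.i.d. random vectors *)
  (forall t, rv_family (fun w => mx_coords (xi t w))) ->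
  (forall t, same_law P (fun w => mx_coords (xi t w)) (fun w => mx_coords (xi 0 w))) ->
  indep_family P (fun t : int => sigma_of (fun w => mx_coords (xi t w))) ->
  (* the C_i(t) are random matrices, independent of (xi_t) *)
  (forall i t, rv_family (fun w => mx_coords (C i t w))) ->
  indep2 P (sigma_of (fun w (k : int * ('I_q * 'I_1)) => mx_coords (xi k.1 w) k.2))
           (sigma_of (fun w (k : 'I_m.+1 * int * ('I_d * 'I_q)) =>
                        mx_coords (C k.1.1 k.1.2 w) k.2)) ->
  (* strict stationarity of the array {C_i(t)} in t *)
  (forall (n : nat) (ts : 'I_n -> int) (h : int),
     same_law P
       (fun w (k : 'I_n * 'I_m.+1 * ('I_d * 'I_q)) =>
          mx_coords (C k.1.2 (ts k.1.1 + h) w) k.2)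
       (fun w (k : 'I_n * 'I_m.+1 * ('I_d * 'I_q)) =>
          mx_coords (C k.1.2 (ts k.1.1) w) k.2)) ->
  (* norms *)
  is_norm Nq -> is_norm Nd ->
  (* (M1) *)
  0 < alpha ->
  regvar_with P Nq (xi 0) alpha P' Th ->
  (* (M2) *)
  (exists beta : R, alpha < beta /\
     forall i, (\int[P]_w ((opnorm Nq Nd (C i 0 w)) `^ beta)%:E < +oo)%E) ->
  (* (M3), Theta independent of {C_i(t)} realized on the product space *)
  (exists i, (0 < (P \x P')%E [set w | (0 < Nd (C i 0 w.1 *m Th w.2))%R])%E) ->
  let X := MA C xi in
  let c := \sum_(i < m.+1)
             \int[(P \x P')%E]_(w in setT) (Nd (C i 0 w.1 *m Th w.2)) `^ alpha in
  [/\ jointly_regvar P Nd X alpha,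
      0 < c,
      fine (P [set w | x < Nd (X 0 w)]) / fine (P [set w | x < Nq (xi 0 w)])
        @[x --> +oo] --> c
    & forall (s : int) (n : nat) (f : 'M[R]_(d, n.+1) -> R),
        continuous f -> (exists M : R, forall v, `|f v| <= M) ->
        (\int[P]_(w in [set w | x < Nd (X 0 w)])
            f (\matrix_(a < d, j < n.+1)
                 ((Nd (X 0 w))^-1 *: X (s + (j : nat)%:Z) w) a ord0))
          / fine (P [set w | x < Nd (X 0 w)])
        @[x --> +oo] -->
        c^-1 * \sum_(i < m.+1)
          \int[(P \x P')%E]_(w in setT)
            (f (\matrix_(a < d, j < n.+1)
                  ((Nd (C i 0 w.1 *m Th w.2))^-1 *:
                     (Cext C ((i : nat)%:Z + s + (j : nat)%:Z) (s + (j : nat)%:Z) w.1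
                        *m Th w.2)) a ord0)
             * (Nd (C i 0 w.1 *m Th w.2)) `^ alpha)].
Proof.
move=> rv_xi law_xi indep_xi rv_C indep_xi_C stationary_C norm_q norm_d alpha_gt0 rv_tail.
move=> [beta [alpha_beta moment_C]] nondegenerate X c; split.
- exact: (MA_jointly_regvar rv_xi law_xi indep_xi rv_C indep_xi_C stationary_C
    norm_q norm_d alpha_gt0 rv_tail alpha_beta moment_C nondegenerate).
- exact: (sum_spectral_moment_gt0 rv_C stationary_C
    norm_q norm_d alpha_gt0 rv_tail alpha_beta moment_C nondegenerate).
- exact: (MA_tail_ratio rv_xi law_xi indep_xi rv_C indep_xi_C stationary_C
    norm_q norm_d alpha_gt0 rv_tail alpha_beta moment_C).
move=> s n f; exact: (MA_spectral_process rv_xi law_xi indep_xi rv_C indep_xi_C stationary_C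
    norm_q norm_d alpha_gt0 rv_tail alpha_beta moment_C nondegenerate).
Qed.
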